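(* Let $G$ be an abelian group, let $X$ be a topological space, and let $f\colon X\to\mathbb{R}$ be a (not necessarily continuous) function such that every sublevel set $f_{\le t}=f^{-1}((-\infty,t])$, $t\in\mathbb{R}$, is a paracompact Hausdorff space. Assume that the sublevel set filtration $f_{\le\bullet}$ is homologically locally connected (HLC) with respect to reduced singular homology with coefficients in $G$. Then the natural map $\varphi\colon H_*(f_{\le\bullet};G)\to\check{H}_*(f_{\le\bullet};G)$ from the persistent singular homology to the persistent Čech homology is a weak isomorphism, i.e. for all $s<t$ the induced maps $\ker\varphi_s\to\ker\varphi_t$ and $\operatorname{coker}\varphi_s\to\operatorname{coker}\varphi_t$ are zero (in every degree).
   Context: All sublevel sets carry the subspace topology. HLC: $f_{\le\bullet}$ is HLC with respect to a homology theory $H$ if for any $x\in X$, any neighborhood $V$ of $x$ in $X$, and any $s,t$ with $f(x)<s<t$ there is a neighborhood $U$ of $x$ with $U\subseteq V$ such that the inclusion $f_{\le s}\cap U\to f_{\le t}\cap V$ induces the zero map under $H$ (in all degrees). Reduced singular homology is $\tilde H_*(Y;G)=\ker(H_*(Y;G)\to H_*(\mathrm{pt};G))$. Covers and Vietoris complexes: a cover of a space $Y$ is a set $\alpha$ of open subsets of $Y$ with union $Y$; $\operatorname{Cov}(Y)$ is the set of covers. For $A\subseteq Y$, a cover $\alpha$ of $A$ refines a cover $\beta$ of $Y$ if each $U\in\alpha$ is contained in some $V\in\beta$. The Vietoris complex of $\alpha$ is the simplicial complex whose simplices are the finite non-empty subsets $\rho\subseteq Y$ contained in some $U\in\alpha$.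 $V_*(\alpha)$ denotes its simplicial (oriented) chain complex with coefficients in $G$. If $\alpha$ refines $\beta$ there is an induced chain map $\pi\colon V_*(\alpha)\to V_*(\beta)$ (identity on vertices). Čech homology: $\check H_*(Y;G)=\lim_{\alpha\in\operatorname{Cov}(Y)}H_*(V_*(\alpha))$, the inverse limit along refinement. It is functorial for an inclusion $A\subseteq Y$ by restricting covers of $Y$ to $A$. Natural map: $S_*(\alpha)$ denotes the subcomplex of the singular chain complex of $Y$ (coefficients in $G$) generated by singular simplices with image contained in some $U\in\alpha$; the inclusions $S_*(\alpha)\to S_*(Y)$ are quasi-isomorphisms, so $H_*(Y;G)\cong\lim_{\alpha}H_*(S_*(\alpha))$. The chain map $\mu\colon S_*(\alpha)\to V_*(\alpha)$ sends a singular $n$-simplex $\sigma$ to the oriented simplex $[\sigma(e_0),\dots,\sigma(e_n)]$ ($e_i$ the vertices of the standard simplex) if the points $\sigma(e_i)$ are pairwise distinct, and to $0$ otherwise. The limit of the maps $H_*(\mu)$ over $\operatorname{Cov}(Y)$ is the natural map $H_*(Y;G)\to\check H_*(Y;G)$; for $Y=f_{\le t}$ it is denoted $\varphi_t$, and $\varphi=(\varphi_t)_{t\in\mathbb{R}}$. $H_*(f_{\le\bullet};G)$ and $\check H_*(f_{\le\bullet};G)$ are regarded as functors from the poset $\mathbb{R}$ to (graded) abelian groups, with structure maps induced by inclusions. Such a functor $M$ is ephemeral if $M_s\to M_t$ is zero whenever $s<t$; a morphism is a weak isomorphism if its pointwise kernel and cokernel are ephemeral. *)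

(* Defs.v *)
From HB Require Import structures.
From mathcomp Require Import all_boot all_order all_fingroup all_algebra.
From mathcomp Require Import ring_quotient generic_quotient.
From mathcomp Require Import all_classical all_reals all_analysis.
From mathcomp Require Import -(notations) monalg.
From mathcomp Require Import zify.

Set Implicit Arguments.
Unset Strict Implicit.
Unset Printing Implicit Defensive.

Import Order.TTheory GRing.Theory Num.Theory.
Import numFieldNormedType.Exports.

Local Open Scope classical_set_scope.
Local Open Scope ring_scope.

(** * Subgroups, quotients, products and limits of abelian groups *)

Section Subgroup.
Variables (A : zmodType) (S : zmodClosed A).

Record subgroup : Type := Subgroup { sg_val : A; sg_valP : sg_val \in S }.

HB.instance Definition _ := [isSub for sg_val].
HB.instance Definition _ := [Choice of subgroup by <:].
HB.instance Definition _ := [SubChoice_isSubZmodule of subgroup by <:].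

Fact sg_val_additive : zmod_morphism sg_val.
Proof. exact: (raddfB \val). Qed.

HB.instance Definition _ :=
  GRing.isZmodMorphism.Build _ _ sg_val sg_val_additive.

End Subgroup.

Section SubgroupMap.
Variables (A B : zmodType) (f : {additive A -> B}).
Variables (S : zmodClosed A) (T : zmodClosed B).
Hypothesis fST : forall x, x \in S -> f x \in T.

Definition subgroup_map (x : subgroup S) : subgroup T :=
  Subgroup (fST (sg_valP x)).

Fact subgroup_map_additive : zmod_morphism subgroup_map.
Proof. by move=> x y; apply: val_inj; rewrite /= !raddfB. Qed.

HB.instance Definition _ :=
  GRing.isZmodMorphism.Build _ _ subgroup_map subgroup_map_additive.

End SubgroupMap.

Section Kernel.
Variables (A B : zmodType) (f : {additive A -> B}).

Definition ker_pred : A -> bool := fun x => f x == 0.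

Fact ker_pred_closed : zmod_closed ker_pred.
Proof.
split; first by rewrite unfold_in /ker_pred raddf0.
by move=> x y; rewrite !unfold_in /ker_pred raddfB => /eqP-> /eqP->; rewrite subrr.
Qed.

HB.instance Definition _ := GRing.isZmodClosed.Build A ker_pred ker_pred_closed.
Definition ker : zmodClosed A := GRing.ZmodClosed.clone A ker_pred _.

End Kernel.

Section Image.
Variables (A B : zmodType) (f : {additive A -> B}).

Definition im_pred : B -> bool := fun y => `[< exists x, f x = y >].

Fact im_pred_closed : zmod_closed im_pred.
Proof.
split; first by apply/asboolP; exists 0; rewrite raddf0.
move=> _ _ /asboolP[x <-] /asboolP[y <-]; apply/asboolP; exists (x - y).
by rewrite raddfB.
Qed.

HB.instance Definition _ := GRing.isZmodClosed.Build B im_pred im_pred_closed.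
Definition im : zmodClosed B := GRing.ZmodClosed.clone B im_pred _.

End Image.

(** The subgroup generated by [S]. *)
Section Generated.
Variables (A : zmodType) (S : set A).

Definition gen_pred : A -> bool := fun x =>
  `[< forall P : set A, P 0 -> (forall y z, P y -> P z -> P (y - z)) ->
        S `<=` P -> P x >].

Fact gen_pred_closed : zmod_closed gen_pred.
Proof.
split; first by apply/asboolP => P P0 _ _; exact: P0.
move=> x y /asboolP gx /asboolP gy; apply/asboolP => P P0 PB SP.
by apply: (PB); [exact: (gx P P0 PB SP)|exact: (gy P P0 PB SP)].
Qed.

HB.instance Definition _ := GRing.isZmodClosed.Build A gen_pred gen_pred_closed.
Definition gen : zmodClosed A := GRing.ZmodClosed.clone A gen_pred _.

Lemma sub_gen x : S x -> x \in gen.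
Proof. by move=> Sx; apply/asboolP => P _ _; apply. Qed.

Lemma gen_map (B : zmodType) (f : {additive A -> B}) (T : zmodClosed B) :
  (forall x, S x -> f x \in T) -> forall x, x \in gen -> f x \in T.
Proof.
move=> ST x /asboolP/(_ [set x | f x \in T]); apply => //=.
- by rewrite raddf0 rpred0.
- by move=> y z fy fz; rewrite raddfB rpredB.
Qed.

End Generated.

Section QuotientMap.
Variables (A B : zmodType) (f : {additive A -> B}).
Variables (I : zmodClosed A) (J : zmodClosed B).

Definition quotient_map & (forall x, x \in I -> f x \in J) :
    {ideal_quot I} -> {ideal_quot J} :=
  fun x => \pi_({ideal_quot J})%qT (f (repr x)).

Hypothesis fIJ : forall x, x \in I -> f x \in J.

Lemma quotient_mapE x :
  quotient_map fIJ (\pi_({ideal_quot I})%qT x) = \pi_({ideal_quot J})%qT (f x).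
Proof.
apply/eqP; rewrite -Quotient.idealrBE -raddfB; apply: fIJ.
by rewrite Quotient.idealrBE reprK.
Qed.

Fact quotient_map_additive : zmod_morphism (quotient_map fIJ).
Proof.
move=> x y; rewrite -[x]reprK -[y]reprK -raddfB /= !quotient_mapE.
by rewrite !raddfB.
Qed.

HB.instance Definition _ :=
  GRing.isZmodMorphism.Build _ _ (quotient_map fIJ) quotient_map_additive.

End QuotientMap.

Definition dep_prod (I : Type) (M : I -> zmodType) : Type := forall i, M i.

Section DepProd.
Variables (I : Type) (M : I -> zmodType).
Implicit Types x y z : dep_prod M.

HB.instance Definition _ := gen_eqMixin (dep_prod M).
HB.instance Definition _ := gen_choiceMixin (dep_prod M).

Let zero : dep_prod M := fun=> 0.
Let opp x : dep_prod M := fun i => - x i.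
Let add x y : dep_prod M := fun i => x i + y i.

Let addA : associative add.
Proof. by move=> x y z; apply: functional_extensionality_dep => i; exact: addrA. Qed.
Let addC : commutative add.
Proof. by move=> x y; apply: functional_extensionality_dep => i; exact: addrC. Qed.
Let add0 : left_id zero add.
Proof. by move=> x; apply: functional_extensionality_dep => i; exact: add0r. Qed.
Let addN : left_inverse zero opp add.
Proof. by move=> x; apply: functional_extensionality_dep => i; exact: addNr. Qed.

HB.instance Definition _ :=
  GRing.isZmodule.Build (dep_prod M) addA addC add0 addN.

End DepProd.

(** Only the transition maps are recorded; [is_rel i j] means that there is a
    map from the [i]-th to the [j]-th object. *)
Record inverse_system := InverseSystem {
  is_idx : Type;
  is_rel : is_idx -> is_idx -> Prop;
  is_obj : is_idx -> zmodType;
  is_map : forall i j, is_rel i j -> {additive is_obj i -> is_obj j} }.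

Section Limit.
Variable M : inverse_system.

Definition lim_pred : dep_prod (@is_obj M) -> bool := fun x =>
  `[< forall i j (ij : is_rel i j), is_map ij (x i) = x j >].

Fact lim_pred_closed : zmod_closed lim_pred.
Proof.
split; first by apply/asboolP => i j ij; rewrite raddf0.
move=> x y /asboolP xP /asboolP yP; apply/asboolP => i j ij.
by rewrite raddfB xP yP.
Qed.

HB.instance Definition _ := GRing.isZmodClosed.Build (dep_prod (@is_obj M)) lim_pred
    lim_pred_closed.
Definition compatible : zmodClosed (dep_prod (@is_obj M)) :=
  GRing.ZmodClosed.clone (dep_prod (@is_obj M)) lim_pred _.

Definition inv_lim : zmodType := subgroup compatible.

Definition lim_proj (x : inv_lim) i : is_obj i := sg_val x i.

Lemma lim_projP (x : inv_lim) i j (ij : is_rel i j) :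
  is_map ij (lim_proj x i) = lim_proj x j.
Proof. by case: x => x xP; move/asboolP: (xP); exact. Qed.

Lemma lim_ext (x y : inv_lim) : (forall i, lim_proj x i = lim_proj y i) -> x = y.
Proof.
move=> xy; apply: val_inj; apply: functional_extensionality_dep => i.
exact: xy.
Qed.

End Limit.

(** A morphism from a system indexed by [I] to a system indexed by [J] is a map
    [J -> I] together with compatible homomorphisms. *)
Section LimMap.
Variables (M N : inverse_system) (r : is_idx N -> is_idx M).
Variable g : forall j, {additive is_obj (r j) -> is_obj j}.
Hypothesis r_rel : forall j k : is_idx N, is_rel j k -> is_rel (r j) (r k).
Hypothesis g_nat : forall j k (jk : is_rel j k) x,
  g k (is_map (r_rel jk) x) = is_map jk (g j x).

Fact lim_map_subproof (x : inv_lim M) :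
  (fun j => g j (lim_proj x (r j))) \in compatible N.
Proof.
by apply/asboolP => j k jk; rewrite -(g_nat jk) lim_projP.
Qed.

Definition lim_map (x : inv_lim M) : inv_lim N := Subgroup (lim_map_subproof x).

Fact lim_map_additive : zmod_morphism lim_map.
Proof.
by move=> x y; apply: lim_ext => j; exact: (raddfB (g j)).
Qed.

HB.instance Definition _ :=
  GRing.isZmodMorphism.Build _ _ lim_map lim_map_additive.

End LimMap.

(** * Chain complexes (in degrees [n >= 0]) and homology *)

Record chain_complex := ChainComplex {
  cc_obj :> nat -> zmodType;
  cc_d : forall n, {additive cc_obj n.+1 -> cc_obj n};
  cc_dd : forall n c, cc_d n (cc_d n.+1 c) = 0 }.

Record chain_map (C D : chain_complex) := ChainMap {
  cm_fun :> forall n, {additive C n -> D n};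
  cm_d : forall n c, cm_fun n (cc_d C n c) = cc_d D n (cm_fun n.+1 c) }.

Section Homology.
Variables (C : chain_complex) (n : nat).

(** The differential leaving degree [m], which is zero for [m = 0]. *)
Definition boundary_out m : {additive C m -> C m.-1} :=
  match m return {additive C m -> C m.-1} with
  | 0 => \0
  | k.+1 => cc_d C k
  end.

Definition cycles : zmodType := subgroup (ker (boundary_out n)).

Definition boundaries_pred : cycles -> bool :=
  fun z => sg_val z \in im (cc_d C n).

Fact boundaries_pred_closed : zmod_closed boundaries_pred.
Proof.
split; first exact: (rpred0 (im (cc_d C n))).
move=> x y xB yB; rewrite unfold_in /boundaries_pred raddfB.
exact: rpredB.
Qed.

HB.instance Definition _ :=
  GRing.isZmodClosed.Build cycles boundaries_pred boundaries_pred_closed.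
Definition boundaries : zmodClosed cycles :=
  GRing.ZmodClosed.clone cycles boundaries_pred _.

Definition homology : zmodType := {ideal_quot boundaries}.

Definition homology_class (z : cycles) : homology :=
  \pi_({ideal_quot boundaries})%qT z.

Lemma homology_classP (x : homology) : exists z, homology_class z = x.
Proof. by exists (repr x); exact: reprK. Qed.

End Homology.

Section HomologyMap.
Variables (C D : chain_complex) (f : chain_map C D) (n : nat).

Fact cycles_map_subproof x :
  x \in ker (boundary_out C n) -> f n x \in ker (boundary_out D n).
Proof.
rewrite !unfold_in /ker_pred; case: n x => [|m] x //= /eqP dx.
by rewrite -cm_d dx raddf0.
Qed.

Definition cycles_map : {additive cycles C n -> cycles D n} :=
  subgroup_map cycles_map_subproof.

Fact homology_map_subproof z :
  z \in boundaries C n -> cycles_map z \in boundaries D n.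
Proof.
move=> /asboolP[b db]; apply/asboolP; exists (f n.+1 b).
by rewrite -cm_d db.
Qed.

Definition homology_map : {additive homology C n -> homology D n} :=
  quotient_map homology_map_subproof.

Lemma homology_mapE z :
  homology_map (homology_class z) = homology_class (cycles_map z).
Proof. exact: quotient_mapE. Qed.

End HomologyMap.

Lemma homology_map_id (C : chain_complex) (f : chain_map C C) n :
  (forall m c, f m c = c) -> forall x, homology_map f n x = x.
Proof.
move=> fid x; have [z <-] := homology_classP x; rewrite homology_mapE.
by congr homology_class; apply: val_inj; rewrite /= fid.
Qed.

Lemma homology_map_comp (C D E : chain_complex)
    (f : chain_map C D) (g : chain_map D E) (h : chain_map C E) n :
  (forall m c, h m c = g m (f m c)) ->
  forall x, homology_map h n x = homology_map g n (homology_map f n x).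
Proof.
move=> hgf x; have [z <-] := homology_classP x; rewrite !homology_mapE.
by congr homology_class; apply: val_inj; rewrite /= hgf.
Qed.

(** * Free complexes

    [malg K G] from [monalg] is the group of finitely supported functions
    [K -> G], and [mkmalgU k g] is the chain [g k]. *)

Section MalgLin.
Variables (K : choiceType) (G A : zmodType) (h : K -> {additive G -> A}).

Definition malg_lin (c : malg K G) : A :=
  \sum_(k <- finmap.enum_fset (msupp c)) h k (mcoeff k c).

Lemma malg_linEw (d : finmap.finset_of (Phant K)) (c : malg K G) :
  finmap.fsubset (msupp c) d ->
  malg_lin c = \sum_(k <- finmap.enum_fset d) h k (mcoeff k c).
Proof.
move=> cd; rewrite /malg_lin; apply: finmap.big_fset_incl => // k _ kc.
by rewrite (mcoeff_outdom kc) raddf0.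
Qed.

Fact malg_lin_additive : zmod_morphism malg_lin.
Proof.
move=> c1 c2; pose d := finmap.fsetU (msupp c1) (msupp c2).
rewrite (@malg_linEw d (c1 - c2)) ?msuppB_le// (@malg_linEw d c1) ?finmap.fsubsetUl//.
rewrite (@malg_linEw d c2) ?finmap.fsubsetUr// -sumrB.
by apply: eq_bigr => k _; rewrite mcoeffB raddfB.
Qed.

HB.instance Definition _ :=
  GRing.isZmodMorphism.Build _ _ malg_lin malg_lin_additive.

Lemma malg_linU k g : malg_lin (mkmalgU k g) = h k g.
Proof.
rewrite (@malg_linEw (finmap.fset1 k)) ?msuppU_le//.
by rewrite finmap.big_seq_fset1 mcoeffUU.
Qed.

Lemma malg_ext (f f' : {additive malg K G -> A}) :
  (forall k g, f (mkmalgU k g) = f' (mkmalgU k g)) -> f =1 f'.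
Proof. by move=> ff' c; rewrite (monalgE c) !raddf_sum; apply: eq_bigr. Qed.

End MalgLin.

Definition malg_map (K L : choiceType) (G : zmodType) (h : K -> L) :
    {additive malg K G -> malg L G} :=
  malg_lin (fun k => mkmalgU (h k)).

Lemma malg_mapU (K L : choiceType) (G : zmodType) (h : K -> L) k (g : G) :
  malg_map G h (mkmalgU k g) = mkmalgU (h k) g.
Proof. exact: malg_linU. Qed.

Lemma malg_map_id (K : choiceType) (G : zmodType) (h : K -> K) (c : malg K G) :
  (forall k, h k = k) -> malg_map G h c = c.
Proof.
move=> hid; rewrite -[RHS]/((idfun : {additive _ -> _}) c); move: c.
by apply: malg_ext => k g; rewrite malg_mapU hid.
Qed.

Lemma malg_map_comp (K L M : choiceType) (G : zmodType) (h : K -> L)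
    (h' : L -> M) (h'' : K -> M) (c : malg K G) :
  (forall k, h'' k = h' (h k)) -> malg_map G h'' c = malg_map G h' (malg_map G h c).
Proof.
move=> hh; rewrite -[RHS]/((malg_map G h' \o malg_map G h) c); move: c.
by apply: malg_ext => k g; rewrite /= !malg_mapU hh.
Qed.

(** A contravariant functor on the ordinals ['I_n.+1] and all maps between them
    (identities are not needed).  The [i]-th face operator is the action of
    [lift i], the increasing map that omits [i]; permutations act by reordering
    vertices. *)
Record symmetric_set := SymmetricSet {
  ss_obj :> nat -> choiceType;
  ss_re : forall m n, ('I_m.+1 -> 'I_n.+1) -> ss_obj n -> ss_obj m;
  ss_reM : forall l m n (f : 'I_l.+1 -> 'I_m.+1) (g : 'I_m.+1 -> 'I_n.+1) x,
    ss_re f (ss_re g x) = ss_re (g \o f) x }.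

Record symmetric_map (K L : symmetric_set) := SymmetricMap {
  sm_fun :> forall n, K n -> L n;
  sm_re : forall m n (f : 'I_m.+1 -> 'I_n.+1) x,
    sm_fun (ss_re f x) = ss_re f (sm_fun x) }.

Lemma bump_bump i j k : (i <= j)%N ->
  bump (bump 0 j) (bump i k) = bump i (bump j k).
Proof. by rewrite /bump /= => ij; do 4?case: leqP => ? /=; lia. Qed.

Lemma lift_lift n (i j : 'I_n.+2) : (i <= j)%N ->
  lift (lift ord0 j) \o lift i = lift (widen_ord (leqnSn _) i) \o lift j.
Proof.
move=> ij; apply: functional_extensionality_dep => k; apply: val_inj.
exact: bump_bump.
Qed.

Lemma intmul_congr (A : zmodType) (x y : A) m : x = y -> x *~ m = y *~ m.
Proof. by move=> ->. Qed.

Section FreeComplex.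
Variables (G : zmodType) (K : symmetric_set).

Definition free_d n (c : malg (K n.+1) G) : malg (K n) G :=
  \sum_(i < n.+2) malg_map G (ss_re (lift i)) c *~ (-1) ^+ i.

Fact free_d_additive n : zmod_morphism (@free_d n).
Proof.
move=> c c'; rewrite /free_d -sumrB; apply: eq_bigr => i _.
by rewrite raddfB mulrzBl.
Qed.

HB.instance Definition _ n :=
  GRing.isZmodMorphism.Build _ _ (@free_d n) (@free_d_additive n).

Lemma free_dU n (x : K n.+1) g : free_d (mkmalgU x g) =
  \sum_(i < n.+2) mkmalgU (ss_re (lift i) x) g *~ (-1) ^+ i.
Proof. by apply: eq_bigr => i _; rewrite malg_mapU. Qed.

Fact free_dd n (c : malg (K n.+2) G) : free_d (free_d c) = 0.
Proof.
pose F (i : 'I_n.+3) (j : 'I_n.+2) : malg (K n) G :=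
  malg_map G (ss_re (lift i \o lift j)) c *~ (-1) ^+ (i + j).
have -> : free_d (free_d c) = \sum_j \sum_i F i j.
  apply: eq_bigr => j _; rewrite /free_d raddf_sum mulrz_suml.
  apply: eq_bigr => i _; rewrite raddfMz -mulrzA -exprD /F.
  by apply: intmul_congr; apply/esym/malg_map_comp => x; rewrite ss_reM.
have -> : \sum_j \sum_i F i j =
    \sum_(j < n.+2) \sum_(k < n.+2 | (j <= k)%N) F (lift ord0 k) j +
    \sum_(j < n.+2) \sum_(k < n.+2 | (k <= j)%N) F (widen_ord (leqnSn _) k) j.
  rewrite -big_split; apply: eq_bigr => j _ /=.
  rewrite (bigID (fun i : 'I_n.+3 => (j < i)%N)) /=; congr (_ + _).
    by rewrite big_mkcond big_ord_recl /= add0r -big_mkcond.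
  rewrite big_mkcond big_ord_recr /= -leqNgt leqNgt ltn_ord addr0 -big_mkcond.
  by apply: eq_bigl => k; rewrite -leqNgt.
rewrite [X in _ + X](exchange_big_dep predT) //= -big_split /=.
rewrite big1 // => j _; rewrite -big_split /= big1 // => k jk.
rewrite /F lift_lift // /= /bump /= add1n addSn exprS mulN1r mulrNz addnC.
exact: addNr.
Qed.

Definition free_complex : chain_complex :=
  @ChainComplex (fun n => malg (K n) G) (fun n => @free_d n) free_dd.

End FreeComplex.

Section FreeMap.
Variables (G : zmodType) (K L : symmetric_set) (h : symmetric_map K L).

Fact free_map_subproof n (c : malg (K n.+1) G) :
  malg_map G (h n) (free_d c) = free_d (malg_map G (h n.+1) c).
Proof.
rewrite /free_d raddf_sum; apply: eq_bigr => i _; rewrite raddfMz.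
apply: intmul_congr; pose h2 x := ss_re (lift i) (h n.+1 x).
rewrite -(@malg_map_comp _ _ _ G (ss_re (lift i)) (h n) h2).
  exact: malg_map_comp.
by move=> x; rewrite sm_re.
Qed.

Definition free_map : chain_map (free_complex G K) (free_complex G L) :=
  @ChainMap (free_complex G K) (free_complex G L) (fun n => malg_map G (h n))
    free_map_subproof.

End FreeMap.

(** * Subspaces and standard simplices

    A set [A : set T] is used as a type through [set_type], which carries the
    subspace topology; [set_val] is the inclusion. *)

Definition restrict (T U : Type) (A : set T) (B : set U) (f : T -> U)
    (fAB : forall x, A x -> B (f x)) (x : A) : B :=
  exist _ (f (set_val x)) (mem_set (fAB _ (set_valP x))).

Lemma set_val_inj (T : Type) (A : set T) : injective (@set_val T A).
Proof. by move=> x y; rewrite set_valE; exact: val_inj. Qed.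

Lemma set_val_exist (T : Type) (A : set T) x (p : x \in A) :
  set_val (exist _ x p : A) = x.
Proof. by rewrite set_valE. Qed.

Lemma set_val_restrict (T U : Type) (A : set T) (B : set U) (f : T -> U)
    (fAB : forall x, A x -> B (f x)) (x : A) :
  set_val (restrict fAB x) = f (set_val x).
Proof. by rewrite [in LHS]set_valE. Qed.

Lemma restrict_continuous (T U : topologicalType) (A : set T) (B : set U)
    (f : T -> U) (fAB : forall x, A x -> B (f x)) :
  continuous f -> continuous (restrict fAB).
Proof.
move=> fc; apply: (@continuous_comp_initial _ _ _ (@set_val U B)).
have -> : set_val \o restrict fAB = f \o set_val.
  by apply: funext => x /=; rewrite set_val_restrict.
move=> x; apply: continuous_comp; first exact: initial_continuous.
exact: fc.
Qed.

Lemma continuous_mx (R : realType) (T : topologicalType) m n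
    (g : T -> 'M[R]_(m, n)) :
  (forall i j, continuous (fun x => g x i j)) -> continuous g.
Proof.
move=> gc x A [P PA sPA]; rewrite /= nbhs_simpl /=.
have : \forall y \near x, forall i j, P i j (g y i j).
  apply: filter_forall => i; apply: filter_forall => j.
  exact: (gc i j x _ (PA i j)).
by apply: filterS => y Py; exact: sPA.
Qed.

Definition std_simplex (R : realType) n : set 'rV[R]_n.+1 :=
  [set x | (forall i, 0 <= x 0 i) /\ \sum_i x 0 i = 1].

Arguments std_simplex : clear implicits.

Section StandardSimplex.
Variable R : realType.

(** The affine map of simplices that sends the vertex [e_i] to [e_(f i)]. *)
Definition affine_map m n (f : 'I_m.+1 -> 'I_n.+1) (x : 'rV[R]_m.+1) :
    'rV[R]_n.+1 :=
  \row_j \sum_(i | f i == j) x 0 i.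

Fact affine_map_simplex m n (f : 'I_m.+1 -> 'I_n.+1) x :
  std_simplex R m x -> std_simplex R n (affine_map f x).
Proof.
move=> [x0 x1]; split=> [j|]; first by rewrite mxE sumr_ge0.
rewrite -[RHS]x1 [RHS](partition_big f predT) //=.
by apply: eq_bigr => j _; rewrite mxE.
Qed.

Lemma affine_map_continuous m n (f : 'I_m.+1 -> 'I_n.+1) :
  continuous (affine_map f).
Proof.
apply: continuous_mx => i j.
have -> : (fun x => affine_map f x i j) =
    (fun x : 'rV[R]_m.+1 => \sum_(k | f k == j) x 0 k).
  by apply: funext => x; rewrite mxE.
apply: continuous_big => [|k _]; first exact: add_continuous.
exact: coord_continuous.
Qed.

Lemma affine_map_comp l m n (f : 'I_l.+1 -> 'I_m.+1) (g : 'I_m.+1 -> 'I_n.+1) x :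
  affine_map g (affine_map f x) = affine_map (g \o f) x.
Proof.
apply/rowP => k; rewrite !mxE.
rewrite [RHS](partition_big f (fun j => g j == k)) //=.
apply: eq_bigr => j /eqP gjk; rewrite mxE; apply: eq_bigl => i.
by case: (f i =P j) => [->|]; rewrite ?gjk ?eqxx ?andbF.
Qed.

Definition simplex_map m n (f : 'I_m.+1 -> 'I_n.+1) :
    std_simplex R m -> std_simplex R n :=
  restrict (@affine_map_simplex m n f).

Lemma simplex_map_continuous m n (f : 'I_m.+1 -> 'I_n.+1) :
  continuous (simplex_map f).
Proof. by apply: restrict_continuous; exact: affine_map_continuous. Qed.

Lemma simplex_map_comp l m n (f : 'I_l.+1 -> 'I_m.+1) (g : 'I_m.+1 -> 'I_n.+1) x :
  simplex_map g (simplex_map f x) = simplex_map (g \o f) x.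
Proof.
by apply: set_val_inj; rewrite !set_val_restrict affine_map_comp.
Qed.

Fact vertex_subproof n (i : 'I_n.+1) : std_simplex R n (delta_mx 0 i).
Proof.
split=> [j|]; first by rewrite mxE eqxx; case: eqP.
rewrite (bigD1 i) //= mxE !eqxx big1 ?addr0 // => j /negPf ji.
by rewrite mxE ji andbF.
Qed.

Definition vertex n (i : 'I_n.+1) : std_simplex R n :=
  exist _ (delta_mx 0 i) (mem_set (vertex_subproof i)).

Lemma simplex_map_vertex m n (f : 'I_m.+1 -> 'I_n.+1) i :
  simplex_map f (vertex i) = vertex (f i).
Proof.
apply: set_val_inj; rewrite set_val_restrict !set_valE /=.
apply/rowP => j; rewrite !mxE eqxx /= eq_sym.
case: eqP => [<-|fij].
  rewrite (bigD1 i) //= mxE !eqxx big1 ?addr0 // => k /andP[_ /negPf ki].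
  by rewrite mxE ki.
rewrite big1 // => k /eqP fkj; rewrite mxE /=.
by case: eqP => // ki; case: fij; rewrite -fkj ki.
Qed.

End StandardSimplex.

(** * Singular homology *)

Section Singular.
Variables (R : realType) (Y : topologicalType).

Definition singular_simplex n : choiceType :=
  [set s : std_simplex R n -> Y | continuous s].

Fact singular_re_subproof m n (f : 'I_m.+1 -> 'I_n.+1)
    (s : std_simplex R n -> Y) :
  continuous s -> continuous (s \o simplex_map f).
Proof.
move=> sc x; apply: continuous_comp; first exact: simplex_map_continuous.
exact: sc.
Qed.

Definition singular_re m n (f : 'I_m.+1 -> 'I_n.+1) :
    singular_simplex n -> singular_simplex m :=
  restrict (@singular_re_subproof m n f).

Fact singular_reM l m n (f : 'I_l.+1 -> 'I_m.+1) (g : 'I_m.+1 -> 'I_n.+1) s :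
  singular_re f (singular_re g s) = singular_re (g \o f) s.
Proof.
apply: set_val_inj; rewrite !set_val_restrict; apply: funext => x /=.
by rewrite simplex_map_comp.
Qed.

Definition singular_set : symmetric_set := SymmetricSet singular_reM.

End Singular.

(** * Covers, Vietoris complexes and Cech homology *)

Record cover (Y : topologicalType) := Cover {
  cover_sets : set (set Y);
  cover_open : forall U, cover_sets U -> open U;
  cover_full : \bigcup_(U in cover_sets) U = setT }.

Definition refines_along (A Y : topologicalType) (h : A -> Y)
    (alpha : cover A) (beta : cover Y) : Prop :=
  forall U, cover_sets alpha U -> exists2 V, cover_sets beta V & h @` U `<=` V.

Definition refines (Y : topologicalType) : cover Y -> cover Y -> Prop :=
  refines_along id.

(** When [h] is the inclusion of a subspace, [pull_cover] restricts the cover. *)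
Section PullCover.
Variables (A Y : topologicalType) (h : A -> Y) (hc : continuous h).
Variable beta : cover Y.

Fact pull_cover_open U : [set h @^-1` V | V in cover_sets beta] U -> open U.
Proof.
by move=> [V bV <-]; move/continuousP: hc; apply; exact: cover_open bV.
Qed.

Fact pull_cover_full : \bigcup_(U in [set h @^-1` V | V in cover_sets beta]) U = setT.
Proof.
rewrite -subTset => y _.
have [V bV Vy] : (\bigcup_(V in cover_sets beta) V) (h y) by rewrite cover_full.
by exists (h @^-1` V) => //; exists V.
Qed.

Definition pull_cover : cover A := Cover pull_cover_open pull_cover_full.

Lemma pull_cover_refines : refines_along h pull_cover beta.
Proof. by move=> _ [V bV <-]; exists V => // _ [y Vhy <-]. Qed.

End PullCover.

Lemma pull_cover_mono (A Y : topologicalType) (h : A -> Y) (hc : continuous h)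
    (alpha beta : cover Y) :
  refines alpha beta -> refines (pull_cover hc alpha) (pull_cover hc beta).
Proof.
move=> ab _ [U aU <-]; have [V bV UV] := ab U aU.
exists (h @^-1` V); first by exists V.
by move=> _ [y Uy <-]; apply: UV; exists (h y).
Qed.

Arguments pull_cover_refines {A Y h} hc beta.
Arguments pull_cover_mono {A Y h} hc {alpha beta} ab.

Definition locally_finite (Y : topologicalType) (alpha : cover Y) : Prop :=
  forall y : Y, exists2 N, nbhs y N &
    finite_set [set U | cover_sets alpha U /\ U `&` N !=set0].

Definition paracompact (Y : topologicalType) : Prop :=
  forall alpha : cover Y, exists2 beta : cover Y,
    refines beta alpha & locally_finite beta.

(** Singular simplices whose image lies in a member of the cover; their free
    complex is the complex of small singular chains. *)
Section SmallSingular.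
Variables (R : realType) (Y : topologicalType) (alpha : cover Y).

Definition small_simplex n : choiceType :=
  [set s : singular_simplex R Y n |
    exists2 U, cover_sets alpha U & range (set_val s) `<=` U].

Fact small_re_subproof m n (f : 'I_m.+1 -> 'I_n.+1) (s : singular_simplex R Y n) :
  (exists2 U, cover_sets alpha U & range (set_val s) `<=` U) ->
  exists2 U, cover_sets alpha U & range (set_val (singular_re f s)) `<=` U.
Proof.
move=> [U aU sU]; exists U => // _ [x _ <-]; rewrite set_val_restrict.
by apply: sU; exists (simplex_map f x).
Qed.

Definition small_re m n (f : 'I_m.+1 -> 'I_n.+1) :
    small_simplex n -> small_simplex m :=
  restrict (@small_re_subproof m n f).

Fact small_reM l m n (f : 'I_l.+1 -> 'I_m.+1) (g : 'I_m.+1 -> 'I_n.+1) s :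
  small_re f (small_re g s) = small_re (g \o f) s.
Proof. by apply: set_val_inj; rewrite !set_val_restrict singular_reM. Qed.

Definition small_set : symmetric_set := SymmetricSet small_reM.

Definition small_incl_set : symmetric_map small_set (singular_set R Y) :=
  @SymmetricMap small_set (singular_set R Y) (fun n => set_val)
    (fun m n f s => set_val_restrict _ s).

End SmallSingular.

Section SmallRefine.
Variables (R : realType) (Y : topologicalType) (alpha beta : cover Y).
Hypothesis ab : refines alpha beta.

Fact small_refine_subproof n (s : singular_simplex R Y n) :
  (exists2 U, cover_sets alpha U & range (set_val s) `<=` U) ->
  exists2 V, cover_sets beta V & range (set_val s) `<=` V.
Proof.
move=> [U /ab[V bV UV] sU]; exists V => // y sy; apply: UV.
by exists y => //; exact: sU.
Qed.

Definition small_refine n : small_simplex R alpha n -> small_simplex R beta n :=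
  restrict (@small_refine_subproof n).

Fact small_refine_re m n (f : 'I_m.+1 -> 'I_n.+1) (s : small_simplex R alpha n) :
  small_refine (small_re f s) = small_re f (small_refine s).
Proof. by apply: set_val_inj; rewrite !set_val_restrict. Qed.

Definition small_refine_set :
    symmetric_map (small_set R alpha) (small_set R beta) :=
  @SymmetricMap (small_set R alpha) (small_set R beta) small_refine
    small_refine_re.

End SmallRefine.

(** Ordered tuples [(v_0, ..., v_n)] of points, possibly with repetitions, whose
    underlying set is a simplex of the Vietoris complex of the cover. *)
Section Tuples.
Variables (Y : topologicalType) (alpha : cover Y).

Definition vtuple n : choiceType :=
  [set v : {ffun 'I_n.+1 -> Y} | exists2 U, cover_sets alpha U & forall i, U (v i)].

Fact vtuple_re_subproof m n (f : 'I_m.+1 -> 'I_n.+1) (v : {ffun 'I_n.+1 -> Y}) :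
  (exists2 U, cover_sets alpha U & forall i, U (v i)) ->
  exists2 U, cover_sets alpha U & forall i, U ([ffun j => v (f j)] i).
Proof. by move=> [U aU vU]; exists U => // i; rewrite ffunE. Qed.

Definition vtuple_re m n (f : 'I_m.+1 -> 'I_n.+1) : vtuple n -> vtuple m :=
  restrict (@vtuple_re_subproof m n f).

Fact vtuple_reM l m n (f : 'I_l.+1 -> 'I_m.+1) (g : 'I_m.+1 -> 'I_n.+1) v :
  vtuple_re f (vtuple_re g v) = vtuple_re (g \o f) v.
Proof.
by apply: set_val_inj; rewrite !set_val_restrict; apply/ffunP => i; rewrite !ffunE.
Qed.

Definition vtuple_set : symmetric_set := SymmetricSet vtuple_reM.

End Tuples.

Lemma perm_lift n (t : 'S_n.+2) i : exists2 s : 'S_n.+1,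
  t = lift_perm i (t i) s & t \o lift i = lift (t i) \o s.
Proof.
pose f k := odflt k (unlift (t i) (t (lift i k))).
have fE k : lift (t i) (f k) = t (lift i k).
  rewrite /f; case: unliftP => [k' -> //|/perm_inj/eqP].
  by rewrite eq_sym (negPf (neq_lift _ _)).
have f_inj : injective f.
  by move=> j k jk; apply: (@lift_inj _ i); apply: (@perm_inj _ t); rewrite -!fE jk.
exists (perm f_inj); last by apply: funext => k /=; rewrite permE fE.
apply/permP => k; case: (unliftP i k) => [j ->|->]; last by rewrite lift_perm_id.
by rewrite lift_perm_lift permE fE.
Qed.

(** Oriented simplicial chains of the Vietoris complex.  The oriented simplex
    [[v_0, ..., v_n]] is the class of the tuple: reordering the vertices by a
    permutation multiplies it by the sign, and tuples with a repeated vertex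
    represent zero. *)
Section Oriented.
Variables (G : zmodType) (Y : topologicalType) (alpha : cover Y).
Notation vtuple := (vtuple_set alpha).

Definition orientation_rel n : set (malg (vtuple n) G) :=
  [set c | (exists (v : vtuple n) (s : 'S_n.+1) (g : G),
              c = mkmalgU (ss_re s v) g - mkmalgU v (g *~ (-1) ^+ s))
        \/ (exists (v : vtuple n) (g : G),
              ~ injective (set_val v) /\ c = mkmalgU v g)].

Definition oriented n : zmodType := {ideal_quot (gen (@orientation_rel n))}.

Definition orient n : {additive malg (vtuple n) G -> oriented n} :=
  \pi_({ideal_quot (gen (@orientation_rel n))})%qT.

Lemma orient_eq0 n c : c \in gen (@orientation_rel n) -> orient n c = 0.
Proof.
move=> cg; rewrite -(raddf0 (orient n)); apply/eqP.
by rewrite -Quotient.idealrBE subr0.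
Qed.

Lemma orient_eq0P n c : orient n c = 0 -> c \in gen (@orientation_rel n).
Proof.
rewrite -(raddf0 (orient n)) => /eqP.
by rewrite -Quotient.idealrBE subr0.
Qed.

Lemma orient_perm n (v : vtuple n) (s : 'S_n.+1) g :
  orient n (mkmalgU (ss_re s v) g) = orient n (mkmalgU v g) *~ (-1) ^+ s.
Proof.
rewrite -raddfMz -[(mkmalgU v g) *~ _](raddfMz (mkmalgU v)).
apply/eqP; rewrite -subr_eq0 -raddfB; apply/eqP/orient_eq0/sub_gen.
by left; exists v, s, g.
Qed.

Lemma orient_degenerate n (v : vtuple n) g :
  ~ injective (set_val v) -> orient n (mkmalgU v g) = 0.
Proof. by move=> vi; apply/orient_eq0/sub_gen; right; exists v, g. Qed.

Lemma vtuple_reE m n (f : 'I_m.+1 -> 'I_n.+1) (v : vtuple n) i :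
  set_val (ss_re f v) i = set_val v (f i).
Proof. by rewrite set_val_restrict ffunE. Qed.

Lemma orientMz n (v : vtuple n) g m :
  orient n (mkmalgU v (g *~ m)) = orient n (mkmalgU v g) *~ m.
Proof. by rewrite (raddfMz (mkmalgU v)) (raddfMz (orient n)). Qed.

Lemma orient_dU n (v : vtuple n.+1) g :
  orient n (free_d (mkmalgU v g)) =
  \sum_(i < n.+2) orient n (mkmalgU (ss_re (lift i) v) g) *~ (-1) ^+ i.
Proof.
rewrite free_dU (raddf_sum (orient n)); apply: eq_bigr => i _.
by rewrite (raddfMz (orient n)).
Qed.

Lemma orient_d_perm n (v : vtuple n.+1) (t : 'S_n.+2) g :
  orient n (free_d (mkmalgU (ss_re t v) g)) =
  orient n (free_d (mkmalgU v g)) *~ (-1) ^+ t.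
Proof.
rewrite [LHS](orient_dU (ss_re t v) g).
rewrite [orient n (free_d _)](orient_dU v g).
rewrite mulrz_suml.
rewrite [RHS](reindex_inj (@perm_inj _ t)).
apply: eq_bigr => i _; have [s ts tl] := perm_lift t i.
have -> : ss_re (lift i) (ss_re t v) = ss_re s (ss_re (lift (t i)) v).
  by rewrite !ss_reM tl.
rewrite [X in X *~ _ = _](orient_perm (ss_re (lift (t i)) v) s g).
set E := orient n _.
rewrite -!mulrzA.
apply: (congr1 (fun m => _ *~ m)).
rewrite -(signr_odd _ i) -(signr_odd _ (t i)) -!signr_addb.
have := congr1 (@odd_perm _) ts; rewrite odd_lift_perm => ->.
by case: (odd i) (odd (t i)) (odd_perm s) => [] [] [].
Qed.

Lemma orient_d_degenerate n (v : vtuple n.+1) g :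
  ~ injective (set_val v) -> orient n (free_d (mkmalgU v g)) = 0.
Proof.
move=> vi.
have [a [b [ab vab]]] : exists a b, a != b /\ set_val v a = set_val v b.
  apply: contrapT => H; apply: vi => a b vab; apply: contrapT => /eqP ab.
  by apply: H; exists a, b.
rewrite (orient_dU v g) (bigD1 a) //= (bigD1 b) 1?eq_sym //=.
rewrite [X in _ + (_ + X)]big1 => [|i /andP[ia ib]]; last first.
  rewrite orient_degenerate ?mul0rz // => inj.
  have [a' ea _] := unlift_some ia; have [b' eb _] := unlift_some ib.
  have := inj a' b'; rewrite !vtuple_reE -ea -eb => /(_ vab) e.
  by move/eqP: ab; apply; rewrite ea eb e.
have [s ts tl] := perm_lift (tperm a b) a.
rewrite tpermL in ts tl.
have va : vtuple_re (lift a) v = vtuple_re s (vtuple_re (lift b) v).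
  have {1}-> : v = vtuple_re (tperm a b) v.
    apply: set_val_inj; apply/ffunP => i; rewrite vtuple_reE.
    by case: tpermP => [->|->|].
  by rewrite !vtuple_reM tl.
rewrite va [X in X *~ _ + _](orient_perm (vtuple_re (lift b) v) s g).
set E := orient n _.
rewrite addr0 -mulrzA -mulrzDr.
have := congr1 (@odd_perm _) ts; rewrite odd_tperm ab odd_lift_perm.
rewrite -(signr_odd _ a) -(signr_odd _ b) => sab.
rewrite [X in _ *~ X](_ : _ = 0) ?mulr0z //.
by case: (odd a) (odd b) (odd_perm s) sab => [] [] [].
Qed.

Fact oriented_d_subproof n c : c \in gen (@orientation_rel n.+1) ->
  free_d c \in gen (@orientation_rel n).
Proof.
move: c; apply: gen_map => c cr; apply: orient_eq0P.
case: cr => [[v [t [g ->]]]|[v [g [vi ->]]]]; last exact: orient_d_degenerate.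
rewrite (raddfB (@free_d G vtuple n)) (raddfB (orient n)).
rewrite [X in X - _](orient_d_perm v t g).
rewrite (raddfMz (mkmalgU v)) (raddfMz (@free_d G vtuple n)).
by rewrite (raddfMz (orient n)) subrr.
Qed.

Definition oriented_d n : {additive oriented n.+1 -> oriented n} :=
  quotient_map (@oriented_d_subproof n).

Lemma oriented_dE n c : oriented_d n (orient n.+1 c) = orient n (free_d c).
Proof. exact: quotient_mapE. Qed.

Lemma orientP n (x : oriented n) : exists c, orient n c = x.
Proof. by exists (repr x); exact: reprK. Qed.

Fact oriented_dd n (x : oriented n.+2) : oriented_d n (oriented_d n.+1 x) = 0.
Proof.
by have [c <-] := orientP x; rewrite !oriented_dE free_dd raddf0.
Qed.

Definition vietoris : chain_complex := ChainComplex oriented_dd.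

Definition orient_map : chain_map (free_complex G vtuple) vietoris :=
  @ChainMap (free_complex G vtuple) vietoris orient
    (fun n c => esym (oriented_dE c)).

End Oriented.

Section VietorisMap.
Variables (G : zmodType) (A Y : topologicalType) (h : A -> Y).
Variables (alpha : cover A) (beta : cover Y).
Hypothesis hab : refines_along h alpha beta.

Fact vtuple_map_subproof n (v : {ffun 'I_n.+1 -> A}) :
  (exists2 U, cover_sets alpha U & forall i, U (v i)) ->
  exists2 V, cover_sets beta V & forall i, V ([ffun j => h (v j)] i).
Proof.
move=> [U /hab[V bV UV] vU]; exists V => // i; rewrite ffunE.
by apply: UV; exists (v i).
Qed.

Definition vtuple_map n : vtuple alpha n -> vtuple beta n :=
  restrict (@vtuple_map_subproof n).

Fact vtuple_map_re m n (f : 'I_m.+1 -> 'I_n.+1) (v : vtuple alpha n) :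
  vtuple_map (vtuple_re f v) = vtuple_re f (vtuple_map v).
Proof.
apply: set_val_inj; rewrite !set_val_restrict; apply/ffunP => i.
by rewrite !ffunE.
Qed.

Definition vtuple_map_set : symmetric_map (vtuple_set alpha) (vtuple_set beta) :=
  @SymmetricMap (vtuple_set alpha) (vtuple_set beta) vtuple_map vtuple_map_re.

Fact vietoris_map_subproof n c :
  c \in gen (@orientation_rel G A alpha n) ->
  malg_map G (@vtuple_map n) c \in gen (@orientation_rel G Y beta n).
Proof.
move: c; apply: gen_map => c [[v [s [g ->]]]|[v [g [vi ->]]]].
  rewrite (raddfB (malg_map G (@vtuple_map n))).
rewrite [X in X - _]malg_mapU [X in _ - X]malg_mapU.
  apply: sub_gen; left; exists (vtuple_map v), s, g.
  by rewrite -[ss_re s v]/(vtuple_re s v) vtuple_map_re.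
rewrite malg_mapU; apply: sub_gen; right; exists (vtuple_map v), g; split=> //.
move=> inj; apply: vi => i j vij; apply: inj.
by rewrite set_val_restrict !ffunE vij.
Qed.

Definition oriented_map n :
    {additive oriented G alpha n -> oriented G beta n} :=
  quotient_map (@vietoris_map_subproof n).

Lemma oriented_mapE n c :
  oriented_map n (orient G alpha n c) =
  orient G beta n (malg_map G (@vtuple_map n) c).
Proof. exact: quotient_mapE. Qed.

Fact oriented_map_d n (x : oriented G alpha n.+1) :
  oriented_map n (oriented_d G alpha n x) =
  oriented_d G beta n (oriented_map n.+1 x).
Proof.
have [c <-] := orientP x; rewrite oriented_dE !oriented_mapE oriented_dE.
apply: (congr1 (orient G beta n)).
exact: (free_map_subproof vtuple_map_set).
Qed.

Definition vietoris_map : chain_map (vietoris G alpha) (vietoris G beta) :=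
  @ChainMap (vietoris G alpha) (vietoris G beta) oriented_map oriented_map_d.

End VietorisMap.

Lemma vietoris_map_id (G : zmodType) (Y : topologicalType) (h : Y -> Y)
    (alpha : cover Y) (haa : refines_along h alpha alpha) :
  (forall y, h y = y) -> forall n c, vietoris_map G haa n c = c.
Proof.
move=> hid n c; have [{}c <-] := orientP c; rewrite [LHS]oriented_mapE.
apply: (congr1 (orient G alpha n)); apply: malg_map_id => v; apply: set_val_inj.
by rewrite set_val_restrict; apply/ffunP => i; rewrite ffunE hid.
Qed.

Lemma vietoris_map_comp (G : zmodType) (A Y Z : topologicalType) (h : A -> Y)
    (k : Y -> Z) (l : A -> Z) (alpha : cover A) (beta : cover Y)
    (gamma : cover Z) (hab : refines_along h alpha beta)
    (kbc : refines_along k beta gamma) (lac : refines_along l alpha gamma) :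
  (forall y, l y = k (h y)) -> forall n c,
  vietoris_map G lac n c = vietoris_map G kbc n (vietoris_map G hab n c).
Proof.
move=> lkh n c; have [{}c <-] := orientP c.
rewrite [LHS]oriented_mapE [vietoris_map G hab n _]oriented_mapE.
rewrite [RHS]oriented_mapE; apply: (congr1 (orient G gamma n)).
apply: malg_map_comp => v.
apply: set_val_inj; rewrite !set_val_restrict; apply/ffunP => i.
by rewrite !ffunE lkh.
Qed.

(** The map [mu] sends a small singular simplex [s] to the oriented simplex
    [[s(e_0), ..., s(e_n)]], which is zero unless the points [s(e_i)] are
    pairwise distinct. *)
Section Mu.
Variables (R : realType) (G : zmodType) (Y : topologicalType) (alpha : cover Y).

Fact vertices_subproof n (s : small_simplex R alpha n) :
  exists2 U, cover_sets alpha U &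
    forall i, U ([ffun i => set_val (set_val s) (vertex R i)] i).
Proof.
have [U aU sU] := set_valP s; exists U => // i.
by rewrite ffunE; apply: sU; exists (vertex R i).
Qed.

Definition vertices n (s : small_simplex R alpha n) : vtuple alpha n :=
  exist _ [ffun i => set_val (set_val s) (vertex R i)]
    (mem_set (vertices_subproof s)).

Lemma verticesE n (s : small_simplex R alpha n) i :
  set_val (vertices s) i = set_val (set_val s) (vertex R i).
Proof. by rewrite /vertices set_val_exist ffunE. Qed.

Fact vertices_re m n (f : 'I_m.+1 -> 'I_n.+1) (s : small_simplex R alpha n) :
  vertices (small_re f s) = vtuple_re f (vertices s).
Proof.
apply: set_val_inj; rewrite set_val_restrict; apply/ffunP => i.
rewrite [LHS]verticesE [RHS]ffunE [RHS]verticesE !set_val_restrict /=.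
by rewrite simplex_map_vertex.
Qed.

Definition vertices_set : symmetric_map (small_set R alpha) (vtuple_set alpha) :=
  @SymmetricMap (small_set R alpha) (vtuple_set alpha) vertices vertices_re.

Definition mu_fun n : {additive malg (small_simplex R alpha n) G ->
    oriented G alpha n} :=
  orient G alpha n \o malg_map G (@vertices n).

Fact mu_d n (c : malg (small_simplex R alpha n.+1) G) :
  mu_fun n (@free_d G (small_set R alpha) n c) =
  oriented_d G alpha n (mu_fun n.+1 c).
Proof.
rewrite [in RHS]/mu_fun /= oriented_dE.
apply: (congr1 (orient G alpha n)).
exact: (free_map_subproof vertices_set).
Qed.

Definition mu : chain_map (free_complex G (small_set R alpha)) (vietoris G alpha) :=
  @ChainMap (free_complex G (small_set R alpha)) (vietoris G alpha) mu_fun mu_d.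

End Mu.

Section Systems.
Variables (R : realType) (G : zmodType) (Y : topologicalType) (n : nat).

Definition small_system : inverse_system :=
  @InverseSystem (cover Y) (@refines Y)
    (fun alpha => homology (free_complex G (small_set R alpha)) n)
    (fun alpha beta ab => homology_map (free_map G (small_refine_set R ab)) n).

Definition cech_system : inverse_system :=
  @InverseSystem (cover Y) (@refines Y)
    (fun alpha => homology (vietoris G alpha) n)
    (fun alpha beta ab => homology_map (vietoris_map G ab) n).

Definition cech : zmodType := inv_lim cech_system.

Definition singular_homology : zmodType :=
  homology (free_complex G (singular_set R Y)) n.

Definition small_incl (alpha : cover Y) :
    {additive homology (free_complex G (small_set R alpha)) n ->
              singular_homology} :=
  homology_map (free_map G (small_incl_set R alpha)) n.

Fact mu_refine (alpha beta : cover Y) (ab : refines alpha beta) x :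
  homology_map (mu R G beta) n
    (homology_map (free_map G (small_refine_set R ab)) n x) =
  homology_map (vietoris_map G ab) n (homology_map (mu R G alpha) n x).
Proof.
have [z <-] := homology_classP x; rewrite !homology_mapE; congr homology_class.
apply: val_inj => /=; case: z => z /= _.
rewrite [RHS]oriented_mapE; apply: (congr1 (orient G beta n)).
rewrite -(@malg_map_comp _ _ _ G (@small_refine R Y alpha beta ab n)
  (@vertices R Y beta n) (fun s => vtuple_map ab (vertices s))).
  exact: malg_map_comp.
move=> s; apply: set_val_inj; rewrite set_val_restrict.
apply/ffunP => i; rewrite [RHS]verticesE [LHS]ffunE [LHS]verticesE.
by rewrite set_val_restrict.
Qed.

Definition mu_lim : {additive inv_lim small_system -> cech} :=
  @lim_map small_system cech_system id
    (fun alpha => homology_map (mu R G alpha) n)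
    (fun alpha beta ab => ab) mu_refine.

(** The inverse of the isomorphism from the limit of the homology of small
    singular chains to singular homology: the compatible family of classes of
    small chains all of which map to [x].  By the theorem of small simplices
    there is exactly one; the default value of [xget] is never used. *)
Definition small_family (x : singular_homology) : inv_lim small_system :=
  xget 0 [set z : inv_lim small_system |
    forall alpha, small_incl alpha (@lim_proj small_system z alpha) = x].

Definition natural_map (x : singular_homology) : cech := mu_lim (small_family x).

End Systems.

Arguments natural_map : clear implicits.

(** Functors from topological spaces to graded abelian groups, with the functor
    laws stated up to pointwise equality of the continuous maps involved. *)
Record top_functor := TopFunctor {
  tf_obj :> topologicalType -> nat -> zmodType;
  tf_map : forall (Y Z : topologicalType) (h : Y -> Z), continuous h ->
    forall n, {additive tf_obj Y n -> tf_obj Z n};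
  tf_map_id : forall (Y : topologicalType) (h : Y -> Y) (hc : continuous h) n x,
    (forall y, h y = y) -> tf_map hc n x = x;
  tf_map_comp : forall (X Y Z : topologicalType) (h : X -> Y) (k : Y -> Z)
    (l : X -> Z) (hc : continuous h) (kc : continuous k) (lc : continuous l) n x,
    (forall y, l y = k (h y)) -> tf_map lc n x = tf_map kc n (tf_map hc n x) }.

Section SingularMap.
Variables (R : realType) (G : zmodType) (Y Z : topologicalType) (h : Y -> Z).
Hypothesis hc : continuous h.

Fact singular_map_subproof n (s : std_simplex R n -> Y) :
  continuous s -> continuous (h \o s).
Proof. by move=> sc x; apply: continuous_comp; [exact: sc|exact: hc]. Qed.

Fact singular_map_re m n (g : 'I_m.+1 -> 'I_n.+1) (s : singular_simplex R Y n) :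
  restrict (@singular_map_subproof m) (singular_re g s) =
  singular_re g (restrict (@singular_map_subproof n) s).
Proof. by apply: set_val_inj; rewrite !set_val_restrict. Qed.

Definition singular_map_set : symmetric_map (singular_set R Y) (singular_set R Z) :=
  @SymmetricMap (singular_set R Y) (singular_set R Z)
    (fun n => restrict (@singular_map_subproof n)) singular_map_re.

Definition singular_map n :
    {additive singular_homology R G Y n -> singular_homology R G Z n} :=
  homology_map (free_map G singular_map_set) n.

End SingularMap.
Arguments singular_map R G {Y Z h} hc n.

Section SingularFunctor.
Variables (R : realType) (G : zmodType).

Fact singular_map_id (Y : topologicalType) (h : Y -> Y) (hc : continuous h) n
    (x : singular_homology R G Y n) :
  (forall y, h y = y) -> singular_map R G hc n x = x.
Proof.
move=> hid; apply: homology_map_id => m c; apply: malg_map_id => s.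
apply: set_val_inj; rewrite set_val_restrict; apply: funext => y.
by rewrite /= hid.
Qed.

Fact singular_map_comp (X Y Z : topologicalType) (h : X -> Y) (k : Y -> Z)
    (l : X -> Z) (hc : continuous h) (kc : continuous k) (lc : continuous l) n
    (x : singular_homology R G X n) :
  (forall y, l y = k (h y)) ->
  singular_map R G lc n x = singular_map R G kc n (singular_map R G hc n x).
Proof.
move=> lkh; apply: homology_map_comp => m c; apply: malg_map_comp => s.
apply: set_val_inj; rewrite !set_val_restrict; apply: funext => y.
by rewrite /= lkh.
Qed.

Definition singular_functor : top_functor :=
  @TopFunctor (singular_homology R G) (fun _ _ _ hc n => singular_map R G hc n)
    singular_map_id singular_map_comp.

Definition to_point (Y : topologicalType) : Y -> discrete_topology unit :=
  fun=> tt.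

Lemma to_point_continuous (Y : topologicalType) : continuous (@to_point Y).
Proof. by move=> y; exact: cvg_cst. Qed.

Definition augmentation (Y : topologicalType) n :=
  singular_map R G (@to_point_continuous Y) n.

Definition reduced_homology (Y : topologicalType) n : zmodType :=
  subgroup (ker (augmentation Y n)).

Fact reduced_map_subproof (Y Z : topologicalType) (h : Y -> Z)
    (hc : continuous h) n x :
  x \in ker (augmentation Y n) -> singular_map R G hc n x \in ker (augmentation Z n).
Proof.
rewrite !unfold_in /ker_pred => /eqP xp; apply/eqP; rewrite -[RHS]xp.
by apply/esym; exact: singular_map_comp.
Qed.

Definition reduced_map (Y Z : topologicalType) (h : Y -> Z) (hc : continuous h)
    n : {additive reduced_homology Y n -> reduced_homology Z n} :=
  subgroup_map (@reduced_map_subproof Y Z h hc n).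

Fact reduced_map_id (Y : topologicalType) (h : Y -> Y) (hc : continuous h) n
    (x : reduced_homology Y n) :
  (forall y, h y = y) -> reduced_map hc n x = x.
Proof. by move=> hid; apply: val_inj; exact: singular_map_id. Qed.

Fact reduced_map_comp (X Y Z : topologicalType) (h : X -> Y) (k : Y -> Z)
    (l : X -> Z) (hc : continuous h) (kc : continuous k) (lc : continuous l) n
    (x : reduced_homology X n) :
  (forall y, l y = k (h y)) ->
  reduced_map lc n x = reduced_map kc n (reduced_map hc n x).
Proof. by move=> lkh; apply: val_inj; exact: singular_map_comp. Qed.

Definition reduced_functor : top_functor :=
  @TopFunctor reduced_homology reduced_map reduced_map_id reduced_map_comp.

End SingularFunctor.

Section CechFunctor.
Variable G : zmodType.

Section CechMap.
Variables (A Y : topologicalType) (h : A -> Y) (hc : continuous h) (n : nat).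

Fact cech_map_subproof (alpha beta : cover Y) (ab : refines alpha beta) x :
  homology_map (vietoris_map G (pull_cover_refines hc beta)) n
    (homology_map (vietoris_map G (pull_cover_mono hc ab)) n x) =
  homology_map (vietoris_map G ab) n
    (homology_map (vietoris_map G (pull_cover_refines hc alpha)) n x).
Proof.
have hab : refines_along h (pull_cover hc alpha) beta.
  move=> _ [U aU <-]; have [V bV UV] := ab U aU; exists V => //.
  by move=> _ [y hy <-]; apply: UV; exists (h y).
transitivity (homology_map (vietoris_map G hab) n x).
  by apply/esym/homology_map_comp; exact: vietoris_map_comp.
by apply/homology_map_comp; exact: vietoris_map_comp.
Qed.

Definition cech_map : {additive cech G A n -> cech G Y n} :=
  @lim_map (cech_system G A n) (cech_system G Y n) (pull_cover hc)
    (fun beta => homology_map (vietoris_map G (pull_cover_refines hc beta)) n)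
    (fun alpha beta ab => pull_cover_mono hc ab) cech_map_subproof.

End CechMap.

Fact cech_map_id (Y : topologicalType) (h : Y -> Y) (hc : continuous h) n
    (x : cech G Y n) :
  (forall y, h y = y) -> cech_map hc n x = x.
Proof.
move=> hid; apply: lim_ext => alpha.
have raa : refines (pull_cover hc alpha) alpha.
  move=> _ [U aU <-]; exists U => // _ [y Uy <-].
  by move: Uy; rewrite /= hid.
rewrite -[RHS](@lim_projP (cech_system G Y n) x _ _ raa).
transitivity (homology_map (vietoris_map G (pull_cover_refines hc alpha)) n
  (lim_proj x (pull_cover hc alpha))) => //.
have rid : refines (pull_cover hc alpha) (pull_cover hc alpha).
  by move=> U aU; exists U => // _ [y Uy <-].
have hid0 : refines_along h (pull_cover hc alpha) (pull_cover hc alpha).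
  by move=> U aU; exists U => // _ [y Uy <-]; rewrite hid.
rewrite (@homology_map_comp _ _ _ (vietoris_map G hid0) (vietoris_map G raa)).
  by rewrite (@homology_map_id _ (vietoris_map G hid0)) //; exact: vietoris_map_id.
by apply: vietoris_map_comp => y; rewrite /= hid.
Qed.

Fact cech_map_comp (X Y Z : topologicalType) (h : X -> Y) (k : Y -> Z)
    (l : X -> Z) (hc : continuous h) (kc : continuous k) (lc : continuous l) n
    (x : cech G X n) :
  (forall y, l y = k (h y)) ->
  cech_map lc n x = cech_map kc n (cech_map hc n x).
Proof.
move=> lkh; apply: lim_ext => alpha.
pose p1 := pull_cover lc alpha; pose p2 := pull_cover hc (pull_cover kc alpha).
have r21 : refines p2 p1.
  move=> _ [_ [U aU <-] <-]; exists (l @^-1` U); first by exists U.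
  by move=> _ [y Uy <-]; rewrite /= lkh.
have hp : refines_along l p2 alpha.
  by move=> _ [_ [U aU <-] <-]; exists U => // _ [y Uy <-]; rewrite lkh.
transitivity (homology_map (vietoris_map G (pull_cover_refines lc alpha)) n
  (homology_map (vietoris_map G r21) n (lim_proj x p2))).
  congr (homology_map _ _ _).
  exact/esym/(@lim_projP (cech_system G X n) x _ _ r21).
transitivity (homology_map (vietoris_map G (pull_cover_refines kc alpha)) n
  (homology_map (vietoris_map G
     (pull_cover_refines hc (pull_cover kc alpha))) n (lim_proj x p2))) => //.
transitivity (homology_map (vietoris_map G hp) n (lim_proj x p2)).
  by apply/esym/homology_map_comp; exact: vietoris_map_comp.
by apply/homology_map_comp; exact: vietoris_map_comp.
Qed.

Definition cech_functor : top_functor :=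
  @TopFunctor (cech G) (fun _ _ _ hc n => cech_map hc n) cech_map_id cech_map_comp.

End CechFunctor.

(** * Persistence modules *)

Section Persistence.
Variable R : realType.

Record pmodule := PModule {
  pm_obj :> R -> zmodType;
  pm_map : forall s t, s <= t -> {additive pm_obj s -> pm_obj t};
  pm_map_id : forall t (tt : t <= t) x, pm_map tt x = x;
  pm_map_comp : forall r s t (rs : r <= s) (st : s <= t) (rt : r <= t) x,
    pm_map rt x = pm_map st (pm_map rs x) }.

Record pmorphism (M N : pmodule) := PMorphism {
  pmor_fun :> forall t, {additive M t -> N t};
  pmor_nat : forall s t (st : s <= t) x,
    pmor_fun t (pm_map M st x) = pm_map N st (pmor_fun s x) }.

Definition ephemeral (M : pmodule) : Prop :=
  forall s t (st : s <= t), s < t -> forall x, pm_map M st x = 0.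

Section KerCoker.
Variables (M N : pmodule) (phi : pmorphism M N).

Fact pker_subproof s t (st : s <= t) x :
  x \in ker (phi s) -> pm_map M st x \in ker (phi t).
Proof.
by rewrite !unfold_in /ker_pred pmor_nat => /eqP->; rewrite raddf0.
Qed.

Fact pcoker_subproof s t (st : s <= t) y :
  y \in im (phi s) -> pm_map N st y \in im (phi t).
Proof.
move=> /asboolP[x <-]; apply/asboolP; exists (pm_map M st x).
by rewrite pmor_nat.
Qed.

Definition pker_map s t (st : s <= t) :
    {additive subgroup (ker (phi s)) -> subgroup (ker (phi t))} :=
  subgroup_map (@pker_subproof s t st).

Fact pker_map_id t (tt : t <= t) x : pker_map tt x = x.
Proof. by apply: val_inj; exact: pm_map_id. Qed.

Fact pker_map_comp r s t (rs : r <= s) (st : s <= t) (rt : r <= t) x :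
  pker_map rt x = pker_map st (pker_map rs x).
Proof. by apply: val_inj; exact: pm_map_comp. Qed.

Definition pker : pmodule := PModule pker_map_id pker_map_comp.

Definition pcoker_map s t (st : s <= t) :
    {additive {ideal_quot (im (phi s))} -> {ideal_quot (im (phi t))}} :=
  quotient_map (@pcoker_subproof s t st).

Fact pcoker_map_id t (tt : t <= t) x : pcoker_map tt x = x.
Proof.
rewrite -[x]reprK [LHS]quotient_mapE.
by congr (\pi%qT _); exact: pm_map_id.
Qed.

Fact pcoker_map_comp r s t (rs : r <= s) (st : s <= t) (rt : r <= t) x :
  pcoker_map rt x = pcoker_map st (pcoker_map rs x).
Proof.
rewrite -[x]reprK [LHS]quotient_mapE.
rewrite [pcoker_map rs _]quotient_mapE [RHS]quotient_mapE.
by congr (\pi%qT _); exact: pm_map_comp.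
Qed.

Definition pcoker : pmodule := PModule pcoker_map_id pcoker_map_comp.

Definition weak_isomorphism : Prop := ephemeral pker /\ ephemeral pcoker.

End KerCoker.

End Persistence.

(** * Sublevel set filtrations *)

Section Sublevel.
Variables (R : realType) (X : topologicalType).

Definition set_incl (A B : set X) (AB : A `<=` B) : A -> B :=
  @restrict X X A B id AB.

Lemma set_incl_continuous (A B : set X) (AB : A `<=` B) :
  continuous (set_incl AB).
Proof. by apply: restrict_continuous => x; exact: cvg_id. Qed.
Arguments set_incl_continuous {A B} AB.

Variable f : X -> R.

Definition sublevel (t : R) : set X := [set x | f x <= t].

Lemma sublevel_mono s t : s <= t -> sublevel s `<=` sublevel t.
Proof. by move=> st x /le_trans; exact. Qed.

Section Persistent.
Variables (H : top_functor) (n : nat).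

Definition persistent_map s t (st : s <= t) :
    {additive H (sublevel s) n -> H (sublevel t) n} :=
  tf_map H (set_incl_continuous (sublevel_mono st)) n.

Fact persistent_map_id t (tt : t <= t) x : persistent_map tt x = x.
Proof.
apply: tf_map_id => y; apply: set_val_inj.
by rewrite set_val_restrict.
Qed.

Fact persistent_map_comp r s t (rs : r <= s) (st : s <= t) (rt : r <= t) x :
  persistent_map rt x = persistent_map st (persistent_map rs x).
Proof.
apply: tf_map_comp => y; apply: set_val_inj.
by rewrite !set_val_restrict.
Qed.

Definition persistent : pmodule R :=
  @PModule R (fun t => H (sublevel t) n) persistent_map persistent_map_id
    persistent_map_comp.

End Persistent.

Definition HLC (H : top_functor) : Prop :=
  forall (x : X) (V : set X) (s t : R) (st : s < t),
    nbhs x V -> f x < s ->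
    exists (U : set X) (UV : U `<=` V), nbhs x U /\
      forall n (z : H (sublevel s `&` U) n),
        tf_map H (set_incl_continuous (setISS (sublevel_mono (ltW st)) UV)) n z
        = 0.

End Sublevel.

(* Main.v *)
(** The Vietoris and the singular chains are compared through the double complex
    [dbl p q] of oriented Vietoris [p]-chains with coefficients in singular
    [q]-chains, restricted to pairs (tuple, simplex) contained in a common member
    of a cover.  It has augmentations [dbl_aug] to Vietoris and [forget] to
    singular chains; the Alexander-Whitney map [aw] is a section of [forget] with
    [dbl_aug \o aw = mu], and the join of a tuple with the vertices of a simplex
    is a homotopy between [dbl_aug] and [mu \o forget] on total cycles.  HLC and
    point-star refinements, which exist on paracompact Hausdorff spaces, make the
    columns exact up to raising the level and coarsening the cover.  Chasing
    through the finitely many columns of a given total degree shows that a small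
    singular cycle which bounds in the Vietoris complex bounds at a higher level,
    and that a Vietoris cycle is, at a higher level, homologous to [mu] of a
    singular cycle.  Only elements are chased: since HLC is assumed with
    coefficients in [G], the fillings need not depend additively on the
    coefficients, so they do not form a chain map from Vietoris to singular chains.
    Passing to the limit needs that small chains compute singular homology, which
    is proved by barycentric subdivision.  All chains of the comparison live in
    the ambient space [X], where sublevels and covers become families of
    subsets. *)

Require Import Defs.
From mathcomp Require Import all_boot all_order all_algebra.
From mathcomp Require Import all_classical all_reals all_analysis.
From HB Require Import structures.
From mathcomp Require Import all_fingroup ring_quotient generic_quotient.
From mathcomp Require Import -(notations) monalg.
From mathcomp Require Import zify lra.
(** Imported again so that [cover] means covers of spaces. *)
Require Import Defs.

Set Implicit Arguments.
Unset Strict Implicit.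
Unset Printing Implicit Defensive.

Import Order.TTheory GRing.Theory Num.Theory.
Import numFieldNormedType.Exports.

Local Open Scope classical_set_scope.
Local Open Scope ring_scope.

(** * Point-star refinements *)

(** Filling one column costs a strict increase of the level and a passage to a coarser cover. A
    chase in total degree N fills N columns, so finitely many levels between s and t suffice, and
    they are found by repeated halving. A tuple may lie in several members of a cover, and the
    simplices paired with it in [dbl] need not share a member. A point-star refinement puts all of
    them into one set to which HLC applies; this is where paracompactness and the Hausdorff property
    enter. Inverse limits are not exact, so the cokernel needs more than surjectivity at each cover:
    a Cech class lifts at every cover separately, and the lifts need not be compatible. The interval
    is therefore halved once more. Lifts are taken at the midpoint r, and injectivity from r to t,
    which is controlled by one cover fixed in advance, makes their images at t agree. *)

Lemma finite_bigcap_nbhs (Y : topologicalType) (I : choiceType) (D : set I)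
    (F : I -> set Y) (y : Y) :
  finite_set D -> (forall i, D i -> nbhs y (F i)) ->
  nbhs y (\bigcap_(i in D) F i).
Proof.
move=> /fset_setK Dfin DF; rewrite -Dfin; apply: filter_bigI => i iD.
by apply: DF; rewrite -Dfin.
Qed.

Section StarRefinement.
Variable Y : topologicalType.
Hypotheses (Ypara : paracompact Y) (Yhaus : hausdorff_space Y).

(** Locally finite families are closure preserving. Only finitely many members meet [N], and a
    closure that meets the interior of [N] forces the member itself to meet [N]. *)
Lemma locally_finite_closure_bigcup (alpha : cover Y) (D : set (set Y)) x :
  locally_finite alpha -> D `<=` cover_sets alpha ->
  (forall C, D C -> ~ closure C x) ->
  nbhs x (\bigcap_(C in D) ~` closure C).
Proof.
move=> alf Dalpha Dx; have [N Nx Nfin] := alf x.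
pose E := D `&` [set C | C `&` N !=set0].
have Efin : finite_set E.
  by apply: sub_finite_set Nfin => C [DC CN]; split => //; exact: Dalpha.
have EN : nbhs x (\bigcap_(C in E) ~` closure C).
  apply: finite_bigcap_nbhs => // C [DC _].
  apply: open_nbhs_nbhs; split; last exact: Dx.
  exact/closed_openC/closed_closure.
have Ni : nbhs x N^° by apply: nbhs_interior.
apply: filterS2 Ni EN => z Nz EzP C DC clC.
have [CN|CN] := pselect (C `&` N !=set0); first exact: (EzP C).
have [w [Cw Nw]] := clC N Nz.
by apply: CN; exists w.
Qed.

(** By the Hausdorff property, [U] and the open sets whose closure misses [x] cover [Y]. In a
    locally finite refinement the members whose closure misses [x] stay away from a neighborhood of
    [x], and they contain every point outside [U]. *)
Lemma paracompact_regular (x : Y) (U : set Y) : open U -> U x ->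
  exists N, [/\ open N, N x & closure N `<=` U].
Proof.
move=> oU Ux.
pose P (O : set Y) := open O /\ ~ closure O x.
have cfull : \bigcup_(O in [set O | O = U \/ P O]) O = setT.
  rewrite -subTset => y _; have [yU|yU] := pselect (U y).
    by exists U => //; left.
  have xy : x != y by apply/eqP => xy; apply: yU; rewrite -xy.
  have := Yhaus; rewrite open_hausdorff => /(_ _ _ xy)[[A B] /= [xA yB] [oA oB AB0]].
  exists B; last exact: set_mem.
  right; split => // clB; 
  have [z [Bz Az]] := clB A (open_nbhs_nbhs (conj oA (set_mem xA))).
  by have : (A `&` B) z by []; rewrite (eqP AB0).
have copen O : [set O | O = U \/ P O] O -> open O by move=> [->|[]].
have [beta bref blf] := Ypara (Cover copen cfull).
pose D := [set C | cover_sets beta C /\ ~ closure C x].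
have Dnb : nbhs x (\bigcap_(C in D) ~` closure C).
  apply: (@locally_finite_closure_bigcup beta) => // C; [by case|by case].
exists (\bigcap_(C in D) ~` closure C)^°; split.
- exact: open_interior.
- exact: Dnb.
- move=> y cly; apply: contrapT => Uy.
  have [C bC Cy] : (\bigcup_(C in cover_sets beta) C) y by rewrite cover_full.
  have DC : D C.
    split => // clC; have [V /= PV CV] := bref C bC.
    have {}CV : C `<=` V by move=> z Cz; apply: CV; exists z.
    case: PV => [VU|[_]]; first by apply: Uy; rewrite -VU; exact: CV.
    by apply; apply: closureS clC.
  have [z [zi Cz]] := cly C (open_nbhs_nbhs (conj (cover_open bC) Cy)).
  have := interior_subset zi => /(_ C DC); apply; exact: subset_closure.
Qed.

(** Take [gamma] locally finite with the closure of each member [C] inside some [V C] of [alpha].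
    The set [N x] lies in [V C] whenever [x] is in the closure of [C], and misses the other
    closures. If [y] lies in [C], every [N x] containing [y] meets [C], so [x] is in the closure of
    [C] and [N x] lies in [V C]. *)
Lemma point_star_refinement (alpha : cover Y) : exists beta : cover Y,
  forall y, exists2 V, cover_sets alpha V &
    forall U, cover_sets beta U -> U y -> U `<=` V.
Proof.
pose P (O : set Y) := open O /\ exists2 V, cover_sets alpha V & closure O `<=` V.
have cfull : \bigcup_(O in P) O = setT.
  rewrite -subTset => y _.
  have [V aV Vy] : (\bigcup_(V in cover_sets alpha) V) y by rewrite cover_full.
  have [N [oN Ny NV]] := paracompact_regular (cover_open aV) Vy.
  by exists N => //; split => //; exists V.
have copen O : P O -> open O by case.
have [gamma gref glf] := Ypara (Cover copen cfull).
have /(@choice (set Y) (set Y)) [V VP] : forall C, exists V, cover_sets gamma C ->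
    cover_sets alpha V /\ closure C `<=` V.
  move=> C; have [gC|gC] := pselect (cover_sets gamma C); last by exists set0.
  have [W [_ [V aV WV]] CW] := gref C gC; exists V => _; split => //.
  by apply: subset_trans WV; apply: closureS => z Cz; apply: CW; exists z.
pose D x := [set C | cover_sets gamma C /\ ~ closure C x].
pose E x := [set C | cover_sets gamma C /\ closure C x].
pose N x := (\bigcap_(C in E x) V C `&` \bigcap_(C in D x) ~` closure C)^°.
have Nx x : N x x.
  apply: filterI; last first.
    by apply: (@locally_finite_closure_bigcup gamma) => // C; [case|case].
  have [M Mx Mfin] := glf x.
  apply: finite_bigcap_nbhs.
    apply: sub_finite_set Mfin => C [gC clC]; split => //.
    exact: clC.
  move=> C [gC clC]; have [aV CV] := VP C gC.
  apply: open_nbhs_nbhs; split; [exact: cover_open aV|exact: CV].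
have bfull : \bigcup_(U in range N) U = setT.
  by rewrite -subTset => y _; exists (N y) => //; exists y.
have bopen U : range N U -> open U by move=> [x _ <-]; exact: open_interior.
exists (Cover bopen bfull) => y.
have [C gC Cy] : (\bigcup_(C in cover_sets gamma) C) y by rewrite cover_full.
exists (V C); first by case: (VP C gC).
move=> _ [x _ <-] Ny.
have clCx : closure C x.
  apply: contrapT => clC; have [_ /(_ C)] := interior_subset Ny.
  by apply => //; exact: subset_closure.
by move=> z /interior_subset[Ez _]; apply: (Ez C).
Qed.

End StarRefinement.

(** * Chains, homology classes and oriented chains *)

Section Supported.
Variables (K : choiceType) (G : zmodType).
Implicit Types (P : K -> Prop) (c : malg K G).

Definition supp_pred P c : bool := `[< forall k, mcoeff k c != 0 -> P k >].

Fact supp_pred_closed P : zmod_closed (supp_pred P).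
Proof.
split=> [|c c' /asboolP cP /asboolP cP'].
  by apply/asboolP => k; rewrite mcoeff0 eqxx.
apply/asboolP => k; rewrite mcoeffB => cc'.
have [ck|ck] := eqVneq (mcoeff k c) 0; last exact: cP.
by apply: cP'; move: cc'; rewrite ck sub0r oppr_eq0.
Qed.

HB.instance Definition _ P :=
  GRing.isZmodClosed.Build (malg K G) (supp_pred P) (supp_pred_closed P).
Definition supported P : zmodClosed (malg K G) :=
  GRing.ZmodClosed.clone (malg K G) (supp_pred P) _.

Lemma supportedU P k g : P k -> mkmalgU k g \in supported P.
Proof.
move=> Pk; apply/asboolP => l; rewrite mcoeffU; case: (k =P l) => [<- //|_].
by rewrite eqxx.
Qed.

Lemma supportedS P P' c :
  (forall k, P k -> P' k) -> c \in supported P -> c \in supported P'.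
Proof. by move=> PP' /asboolP cP; apply/asboolP => k /cP /PP'. Qed.

Lemma supported_eq0 P c : (forall k, ~ P k) -> c \in supported P -> c = 0.
Proof.
move=> P0 /asboolP cP; apply/malgP => k; rewrite mcoeff0.
by apply/eqP; apply: contraT => /cP/P0.
Qed.

Lemma supported_ind P (T : set (malg K G)) :
  T 0 -> (forall c c', T c -> T c' -> T (c - c')) ->
  (forall k g, P k -> T (mkmalgU k g)) ->
  forall c, c \in supported P -> T c.
Proof.
move=> T0 TB TU c /asboolP cP.
have TN c' : T c' -> T (- c') by move=> Tc; rewrite -sub0r; exact: TB.
rewrite (monalgE c) big_seq; apply: (big_ind T) => //.
  by move=> x y Tx Ty; rewrite -[y]opprK; apply: TB => //; exact: TN.
by move=> k kc; apply/TU/cP; rewrite mcoeff_neq0.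
Qed.

Lemma supported_map (B : zmodType) P (f : {additive malg K G -> B})
    (T : zmodClosed B) :
  (forall k g, P k -> f (mkmalgU k g) \in T) ->
  forall c, c \in supported P -> f c \in T.
Proof.
move=> fT; apply: (@supported_ind P (fun c => f c \in T)) => //.
  by rewrite raddf0 rpred0.
by move=> c c' fc fc'; rewrite raddfB rpredB.
Qed.

End Supported.
Arguments supported {K} G P.

Section MalgMap.
Variables (K L : choiceType) (G : zmodType) (h : L -> K).

Lemma malg_map_supported (Q : L -> Prop) (c : malg L G) :
  c \in supported G Q ->
  malg_map G h c \in supported G (fun k => exists2 l, Q l & h l = k).
Proof.
move: c; apply: supported_map => l g Ql; rewrite malg_mapU; apply: supportedU.
by exists l.
Qed.

Lemma malg_map_lift (Q : L -> Prop) (c : malg K G) :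
  c \in supported G (fun k => exists2 l, Q l & h l = k) ->
  exists2 c', c' \in supported G Q & malg_map G h c' = c.
Proof.
move: c; apply: (@supported_ind _ _ _ (fun c => exists2 c', _ & _)).
- by exists 0; rewrite ?raddf0 ?rpred0.
- move=> _ _ [a aQ <-] [b bQ <-].
  by exists (a - b); rewrite ?raddfB ?rpredB.
- move=> _ g [l Ql <-].
  by exists (mkmalgU l g); rewrite ?malg_mapU ?supportedU.
Qed.

Lemma malg_map_inj : injective h -> injective (malg_map G h).
Proof.
move=> h_inj; apply: raddf_inj => c c0; apply/malgP => l; rewrite mcoeff0.
suff cE : forall c, mcoeff (h l) (malg_map G h c) = mcoeff l c.
  by rewrite -cE c0 mcoeff0.
apply: (@malg_ext _ _ _ (mcoeff (h l) \o malg_map G h) (mcoeff l)) => k g /=.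
by rewrite malg_mapU !mcoeffU (inj_eq h_inj).
Qed.

End MalgMap.

Section HomologyClass.
Variables (C D : chain_complex) (f : chain_map C D) (n : nat).

Lemma boundary_out_map c :
  f n.-1 (boundary_out C n c) = boundary_out D n (f n c).
Proof. by case: n c => [|m] c /=; [rewrite raddf0|rewrite cm_d]. Qed.

Lemma homology_class_eq0 (z : cycles C n) :
  homology_class z = 0 <-> exists b, cc_d C n b = sg_val z.
Proof.
rewrite -(raddf0 (\pi_({ideal_quot (boundaries C n)})%qT)); split.
  by move=> /eqP; rewrite -Quotient.idealrBE subr0 => /asboolP.
by move=> zb; apply/eqP; rewrite -Quotient.idealrBE subr0; apply/asboolP.
Qed.

Lemma cycleP (c : C n) : boundary_out C n c = 0 -> c \in ker (boundary_out C n).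
Proof. by move=> c0; apply/eqP. Qed.

Lemma cycle_boundary_out (z : cycles C n) : boundary_out C n (sg_val z) = 0.
Proof. exact/eqP/(sg_valP z). Qed.

End HomologyClass.

(** * Homomorphisms out of oriented chains *)

Section OrientedLin.
Variables (Y : topologicalType) (alpha : cover Y).

Section Osim.
Variable G : zmodType.

Definition osim n (v : vtuple alpha n) : {additive G -> oriented G alpha n} :=
  orient G alpha n \o mkmalgU v.

Lemma osimE n (v : vtuple alpha n) g :
  orient G alpha n (mkmalgU v g) = osim v g.
Proof. by []. Qed.

Lemma osim_perm n (v : vtuple alpha n) (s : 'S_n.+1) g :
  osim (vtuple_re s v) g = osim v g *~ (-1) ^+ s.
Proof. exact: orient_perm. Qed.

Lemma osim_degenerate n (v : vtuple alpha n) g :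
  ~ injective (set_val v) -> osim v g = 0.
Proof. exact: orient_degenerate. Qed.

Lemma oriented_d_osim n (v : vtuple alpha n.+1) g :
  oriented_d G alpha n (osim v g) =
  \sum_(i < n.+2) osim (vtuple_re (lift i) v) g *~ (-1) ^+ i.
Proof. by rewrite oriented_dE; exact: orient_dU. Qed.

Lemma oriented_ext (A : zmodType) n (f f' : {additive oriented G alpha n -> A}) :
  (forall v g, f (osim v g) = f' (osim v g)) -> f =1 f'.
Proof.
move=> ff' x; have [c <-] := orientP x.
exact: (@malg_ext _ _ _ (f \o orient G alpha n) (f' \o orient G alpha n)).
Qed.

End Osim.
Arguments osim G {n} v : simpl never.

Section Lin.
Variables (G A : zmodType) (n : nat) (h : vtuple alpha n -> {additive G -> A}).

Definition alternating : Prop :=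
  (forall (v : vtuple alpha n) (s : 'S_n.+1) g,
    h (vtuple_re s v) g = h v g *~ (-1) ^+ s) /\
  (forall (v : vtuple alpha n) g, ~ injective (set_val v) -> h v g = 0).

(** The universal property of oriented chains. The proof of alternation is an argument so that the
    additive structure can be attached to the resulting map. *)
Definition oriented_lin & alternating : oriented G alpha n -> A :=
  fun x => malg_lin h (repr x).

Hypothesis h_alt : alternating.

Fact oriented_lin_subproof c :
  c \in gen (@orientation_rel G Y alpha n) -> malg_lin h c = 0.
Proof.
move=> /(gen_map (f := malg_lin h) (T := ker idfun)) cr; apply/eqP/cr.
move=> _ [[v [s [g ->]]]|[v [g [vi ->]]]]; apply/eqP => /=.
  rewrite (raddfB (malg_lin h)) [X in X - _]malg_linU [X in _ - X]malg_linU.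
  by rewrite h_alt.1 raddfMz subrr.
by rewrite malg_linU h_alt.2.
Qed.

Lemma oriented_linE c : oriented_lin h_alt (orient G alpha n c) = malg_lin h c.
Proof.
apply/eqP; rewrite -subr_eq0 -raddfB; apply/eqP/oriented_lin_subproof.
by rewrite Quotient.idealrBE reprK.
Qed.

Fact oriented_lin_additive : zmod_morphism (oriented_lin h_alt).
Proof.
move=> x y; have [c <-] := orientP x; have [c' <-] := orientP y.
by rewrite -raddfB !oriented_linE raddfB.
Qed.

HB.instance Definition _ :=
  GRing.isZmodMorphism.Build _ _ (oriented_lin h_alt) oriented_lin_additive.

Lemma oriented_linU v g : oriented_lin h_alt (osim G v g) = h v g.
Proof. by rewrite oriented_linE malg_linU. Qed.

End Lin.
End OrientedLin.
Arguments osim {Y alpha} G {n} v : simpl never.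

Section Coefficients.
Variables (A B : zmodType) (phi : {additive A -> B}).

Definition malg_coef (K : choiceType) : {additive malg K A -> malg K B} :=
  malg_lin (fun k => mkmalgU k \o phi).

Lemma mcoeff_malg_coef (K : choiceType) k (c : malg K A) :
  mcoeff k (malg_coef K c) = phi (mcoeff k c).
Proof.
move: c; apply: (@malg_ext _ _ _ (mcoeff k \o malg_coef K) (phi \o mcoeff k)).
move=> l g; rewrite /= malg_linU /= !mcoeffU; case: eqP => // _.
by rewrite !mulr0n raddf0.
Qed.

Variables (Y : topologicalType) (alpha : cover Y).

Fact coef_alternating n :
  @alternating Y alpha A _ n (fun v => osim B v \o phi).
Proof.
split=> [v s g|v g vi] /=; last exact: osim_degenerate.
exact: osim_perm.
Qed.

Definition coef n : {additive oriented A alpha n -> oriented B alpha n} :=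
  oriented_lin (@coef_alternating n).

Lemma coefU n (v : vtuple alpha n) a : coef n (osim A v a) = osim B v (phi a).
Proof. exact: oriented_linU. Qed.

Lemma coef_d n (x : oriented A alpha n.+1) :
  coef n (oriented_d A alpha n x) = oriented_d B alpha n (coef n.+1 x).
Proof.
move: x; apply: (@oriented_ext _ _ _ _ _ (coef n \o oriented_d A alpha n)
  (oriented_d B alpha n \o coef n.+1)) => v a /=.
rewrite coefU !oriented_d_osim raddf_sum; apply: eq_bigr => i _.
by rewrite raddfMz /= coefU.
Qed.

End Coefficients.
Arguments coef {A B} phi {Y alpha n}.
Arguments malg_coef {A B} phi {K}.

(** Multiplication by a sign as an additive map, so that signed composites fall under the
    extensionality lemmas. *)
Definition zscale (A : zmodType) (m : int) (x : A) : A := x *~ m.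

Fact zscale_additive (A : zmodType) (m : int) : zmod_morphism (@zscale A m).
Proof. by move=> x y; exact: mulrzBl. Qed.

HB.instance Definition _ (A : zmodType) (m : int) :=
  GRing.isZmodMorphism.Build _ _ (@zscale A m) (zscale_additive m).

(** Choosing an ordering of each finite set of vertices splits the quotient map
    from ordered to oriented chains, naturally in the coefficients (but not
    compatibly with the boundary). *)
Section NormalForm.
Variables (Y : topologicalType) (alpha : cover Y) (n : nat).
Implicit Types (v w : vtuple alpha n) (s : 'S_n.+1).

Definition vorbit v : set (vtuple alpha n) := [set vtuple_re s v | s in [set: 'S_n.+1]].

Definition vrep v : vtuple alpha n := xget v (vorbit v).

Lemma vtuple_re_perm v s s' :
  vtuple_re s' (vtuple_re s v) = vtuple_re (s' * s)%g v.
Proof.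
by rewrite vtuple_reM; congr vtuple_re; apply: funext => i; rewrite permM.
Qed.

Lemma vtuple_re1 v : vtuple_re (1%g : 'S_n.+1) v = v.
Proof.
by apply: set_val_inj; apply/ffunP => i; rewrite vtuple_reE perm1.
Qed.

Lemma vrepP v : exists s : 'S_n.+1, vrep v = vtuple_re s v.
Proof.
suff [s _ <-] : vorbit v (vrep v) by exists s.
by apply: xgetPex; exists v, 1%g => //; rewrite vtuple_re1.
Qed.

Lemma vrep_re v s : vrep (vtuple_re s v) = vrep v.
Proof.
(* The orbit is non-empty, so the default of [xget] may be changed; it then remains to compare the
   two orbits. *)
have -> : vrep v = xget (vtuple_re s v) (vorbit v).
  rewrite /vrep /xget; case: pselect => // nv; exfalso; apply: nv.
  by exists v; apply/asboolP; exists 1%g => //; rewrite vtuple_re1.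
congr xget; rewrite eqEsubset; split=> _ [s' _ <-].
  by exists (s' * s)%g; rewrite // vtuple_re_perm.
by exists (s' * s^-1)%g; rewrite // vtuple_re_perm mulgKV.
Qed.

Definition vperm v : 'S_n.+1 := xget 1%g [set s : 'S_n.+1 | vrep v = vtuple_re s v].

Lemma vpermE v : vrep v = vtuple_re (vperm v) v.
Proof. by have := xgetPex 1%g (vrepP v). Qed.

(** The value 0 on tuples with a repeated vertex makes [vnormal] vanish there, and also disposes of
    the ambiguity of [vperm] on such tuples. *)
Definition vsign v : int :=
  if `[< injective (set_val v) >] then (-1) ^+ vperm v else 0.

Variable A : zmodType.

Definition vnormal v : {additive A -> malg (vtuple alpha n) A} :=
  mkmalgU (vrep v) \o @zscale A (vsign v).

Fact normal_alternating : alternating vnormal.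
Proof.
split=> [v s g|v g vi]; last first.
  by rewrite /vnormal /= /vsign asboolF // /zscale mulr0z raddf0.
rewrite /vnormal /= vrep_re -(raddfMz (mkmalgU (vrep v))) /zscale -mulrzA.
congr mkmalgU; congr intmul; rewrite /vsign.
have [vi|vi] := pselect (injective (set_val v)); last first.
  rewrite !asboolF ?mul0r // => svi; apply: vi => i j vij.
  have := svi (s^-1 i)%g (s^-1 j)%g; rewrite !vtuple_reE !permKV => /(_ vij).
  exact: perm_inj.
rewrite !asboolT //; last first.
  by move=> i j; rewrite !vtuple_reE => /vi/perm_inj.
have -> : vperm v = (vperm (vtuple_re s v) * s)%g.
  apply/permP => i; apply: vi.
  transitivity (set_val (vrep v) i); first by rewrite vpermE [RHS]vtuple_reE.
  by rewrite -(vrep_re v s) vpermE vtuple_re_perm [LHS]vtuple_reE.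
by rewrite odd_permM -signr_addb -addbA addbb addbF.
Qed.

Definition normal_form : {additive oriented A alpha n -> malg (vtuple alpha n) A} :=
  oriented_lin normal_alternating.

Lemma normal_formU v a :
  normal_form (osim A v a) = mkmalgU (vrep v) (a *~ vsign v).
Proof. exact: (oriented_linU normal_alternating). Qed.

Lemma normal_formK x : orient A alpha n (normal_form x) = x.
Proof.
move: x; apply: (@oriented_ext _ _ _ _ _ (orient A alpha n \o normal_form) idfun).
move=> v a; change (orient A alpha n (normal_form (osim A v a)) = osim A v a).
rewrite normal_formU osimE.
rewrite (raddfMz (osim A (vrep v))) vpermE osim_perm /vsign.
case: asboolP => [vi|vi]; last by rewrite mulr0z osim_degenerate.
by rewrite -mulrzA -signr_addb addbb.
Qed.

End NormalForm.
Arguments normal_form {Y alpha n A}.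

Lemma normal_form_coef (A B : zmodType) (phi : {additive A -> B})
    (Y : topologicalType) (alpha : cover Y) n (x : oriented A alpha n) :
  normal_form (coef phi x) = malg_coef phi (normal_form x).
Proof.
move: x; apply: (@oriented_ext _ _ _ _ _ (@normal_form _ alpha n B \o coef phi)
  (malg_coef phi \o @normal_form _ alpha n A)) => v a /=.
by rewrite coefU !normal_formU malg_linU /= (raddfMz phi).
Qed.

(** * The double complex *)

Section Alternating.
Variables (Y : topologicalType) (alpha : cover Y) (G A : zmodType) (n : nat).
Variable h : vtuple alpha n -> {additive G -> A}.

(** Transpositions generate the symmetric group; for them the effect on a join is explicit. *)
Lemma alternating_tperm :
  (forall v (a b : 'I_n.+1) g, a != b ->
     h (vtuple_re (tperm a b) v) g = - h v g) ->
  (forall (v : vtuple alpha n) g, ~ injective (set_val v) -> h v g = 0) ->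
  alternating h.
Proof.
move=> ht hd; split=> // v s g; have [ts -> /=] := prod_tpermP s.
elim: ts v => [|[a b] ts IH] v /=; first by rewrite big_nil odd_perm1 vtuple_re1.
case/andP => ab /IH{}IH; rewrite big_cons -vtuple_re_perm ht //= IH.
by rewrite odd_permM odd_tperm [in a != b]ab signr_addb mulN1r mulrNz.
Qed.

End Alternating.

Lemma addr_congr (A : zmodType) (x x' y y' : A) :
  x = x' -> y = y' -> x + y = x' + y'.
Proof. by move=> -> ->. Qed.

Lemma mulrz_sign_cancel (A : zmodType) (x : A) p :
  x *~ (-1) ^+ p.+1 + x *~ (-1) ^+ 0 *~ (-1) ^+ p = 0.
Proof. by rewrite expr0 mulr1z exprS mulN1r mulrNz addNr. Qed.

Lemma sum_recl (A : zmodType) n (F : nat -> A) :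
  \sum_(i < n.+1) F i = F 0%N + \sum_(i < n) F i.+1.
Proof. by rewrite big_ord_recl. Qed.

Lemma sum_recr (A : zmodType) n (F : nat -> A) :
  \sum_(i < n.+1) F i = \sum_(i < n) F i + F n.
Proof. by rewrite big_ord_recr. Qed.

Lemma big_ord_split (A : zmodType) m a b (F : nat -> A) : m = (a + b)%N ->
  \sum_(i < m) F i = \sum_(i < a) F i + \sum_(j < b) F (a + j)%N.
Proof. by move=> ->; rewrite big_split_ord. Qed.

(** Maps of ordinals given by functions on [nat]; the value is junk where the
    function exceeds the bound. *)
Definition nre m n (f : nat -> nat) : 'I_m.+1 -> 'I_n.+1 := fun i => inord (f i).
Arguments nre : clear implicits.

Lemma lift_nre n (i : 'I_n.+2) : lift i = nre n n.+1 (bump i).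
Proof. apply: funext => k; apply: ord_inj; rewrite inordK //.
exact: (ltn_ord (lift i k)). Qed.

Lemma nre_ext m n f g : (forall k, (k <= m)%N -> f k = g k) ->
  nre m n f = nre m n g.
Proof. by move=> fg; apply: funext => k; rewrite /nre fg // -ltnS. Qed.

Lemma nre_comp l m n f g : (forall k, (k <= l)%N -> (g k <= m)%N) ->
  nre m n f \o nre l m g = nre l n (f \o g).
Proof.
by move=> gm; apply: funext => k; rewrite /nre /= inordK // ltnS gm // -ltnS.
Qed.

Section DoubleComplex.
Variables (R : realType) (G : zmodType) (X : topologicalType).

Fact triv_open U : [set setT] U -> @open X U.
Proof. by move=> ->; exact: openT. Qed.

Fact triv_full : \bigcup_(U in [set setT]) U = [set: X].
Proof. by rewrite bigcup_set1. Qed.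

(** With this cover the Vietoris complex is the full simplex on [X]. Smallness is imposed later by
    subgroups, so the chain groups stay fixed while levels and covers vary. *)
Definition triv : cover X := Cover triv_open triv_full.

Definition tup (n : nat) : choiceType := vtuple triv n.

Fact mktup_subproof n (v : nat -> X) :
  exists2 U, cover_sets triv U & forall i, U ([ffun i : 'I_n.+1 => v i] i).
Proof. by exists setT. Qed.

Definition mktup n (v : nat -> X) : tup n :=
  exist _ [ffun i : 'I_n.+1 => v i] (mem_set (mktup_subproof n v)).

Lemma mktupE n v i : set_val (mktup n v) i = v i.
Proof. by rewrite set_val_exist ffunE. Qed.

Lemma mktup_ext n v w : (forall k, (k <= n)%N -> v k = w k) ->
  mktup n v = mktup n w.
Proof.
move=> vw; apply: set_val_inj; apply/ffunP => i.
by rewrite !mktupE vw // -ltnS.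
Qed.

Definition tupn n (v : tup n) (k : nat) : X := set_val v (inord k).

Lemma mktup_re m n f v : (forall k, (k <= m)%N -> (f k <= n)%N) ->
  vtuple_re (nre m n f) (mktup n v) = mktup m (v \o f).
Proof.
move=> fm; apply: set_val_inj; apply/ffunP => i.
by rewrite vtuple_reE !mktupE /= inordK // ltnS fm // -ltnS.
Qed.

Lemma tupn_re m n (f : 'I_m.+1 -> 'I_n.+1) (v : tup n) k :
  tupn (vtuple_re f v) k = set_val v (f (inord k)).
Proof. exact: vtuple_reE. Qed.

Definition sing n : choiceType := singular_simplex R X n.
Definition singn n (s : sing n) (k : nat) : X := set_val s (vertex R (inord k)).

Lemma singn_re m n (f : 'I_m.+1 -> 'I_n.+1) (s : sing n) k :
  singn (singular_re f s) k = set_val s (vertex R (f (inord k))).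
Proof. by rewrite /singn set_val_restrict /= simplex_map_vertex. Qed.

Definition schain n : zmodType := malg (sing n) G.
Definition schain_d n : {additive schain n.+1 -> schain n} :=
  cc_d (free_complex G (singular_set R X)) n.

Definition ssim n (s : sing n) : {additive G -> schain n} := mkmalgU s.

Lemma schain_ext n (A : zmodType) (f f' : {additive schain n -> A}) :
  (forall s g, f (ssim s g) = f' (ssim s g)) -> f =1 f'.
Proof. exact: malg_ext. Qed.

Lemma schain_dd n c : schain_d n (schain_d n.+1 c) = 0.
Proof. exact: (@cc_dd (free_complex G (singular_set R X)) n c). Qed.

Lemma schain_dU n (s : sing n.+1) g : schain_d n (ssim s g) =
  \sum_(i < n.+2) ssim (singular_re (nre n n.+1 (bump i)) s) g *~ (-1) ^+ i.
Proof.
rewrite [LHS]free_dU; apply: eq_bigr => i _.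
by rewrite -lift_nre.
Qed.

Definition vtx n (s : sing n) : tup n := mktup n (singn s).

Lemma vtx_re m n f (s : sing n) : (forall k, (k <= m)%N -> (f k <= n)%N) ->
  vtx (singular_re (nre m n f) s) = mktup m (singn s \o f).
Proof.
move=> fm; apply: mktup_ext => k km.
by rewrite singn_re /nre /= inordK.
Qed.

Definition vchain n : zmodType := oriented G triv n.
Definition vchain_d n : {additive vchain n.+1 -> vchain n} :=
  cc_d (vietoris G triv) n.

Definition vsim n (v : tup n) : {additive G -> vchain n} := osim G v.

Lemma vsim_perm n (v : tup n) (s : 'S_n.+1) g :
  vsim (vtuple_re s v) g = vsim v g *~ (-1) ^+ s.
Proof. exact: osim_perm. Qed.

Lemma vsim_degenerate n (v : tup n) g :
  ~ injective (set_val v) -> vsim v g = 0.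
Proof. exact: osim_degenerate. Qed.

Lemma vchain_dU N w g : vchain_d N (vsim (mktup N.+1 w) g) =
  \sum_(i < N.+2) vsim (mktup N (w \o bump i)) g *~ (-1) ^+ i.
Proof.
rewrite [LHS]oriented_d_osim; apply: eq_bigr => i _.
rewrite lift_nre mktup_re // => k; have := ltn_ord i; rewrite /bump; lia.
Qed.

Definition vert n : {additive schain n -> vchain n} :=
  malg_lin (fun s => vsim (vtx s)).

Lemma vertU n s g : vert n (ssim s g) = vsim (vtx s) g.
Proof. exact: malg_linU. Qed.

(** Singular chains serve as coefficients of oriented chains. Vertical maps are then changes of
    coefficients, and the commuting squares are instances of [coef_d]. *)
Definition dbl p q : zmodType := oriented (schain q) triv p.

Definition hor p q : {additive dbl p.+1 q -> dbl p q} :=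
  cc_d (vietoris (schain q) triv) p.
Definition ver p q : {additive dbl p q.+1 -> dbl p q} := coef (schain_d q).

Definition saug : {additive schain 0 -> G} := malg_lin (fun=> idfun).
Definition dbl_aug p : {additive dbl p 0 -> vchain p} := coef saug.

Fact forget_alternating q :
  @alternating X triv (schain q) (schain q) 0 (fun=> idfun).
Proof.
apply: alternating_tperm => [v a b g|v g []]; first by rewrite !ord1.
by move=> i j _; rewrite !ord1.
Qed.

Definition forget q : {additive dbl 0 q -> schain q} :=
  oriented_lin (forget_alternating q).

Definition dsim p q (v : tup p) (s : sing q) g : dbl p q :=
  osim (schain q) v (ssim s g).

Lemma dsim_congr p q (v v' : tup p) (s s' : sing q) g m :
  v = v' -> s = s' -> dsim v s g *~ m = dsim v' s' g *~ m.
Proof. by move=> -> ->. Qed.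

Lemma dblP p q (A : zmodType) (f f' : {additive dbl p q -> A}) :
  (forall v s g, f (dsim v s g) = f' (dsim v s g)) -> f =1 f'.
Proof.
move=> ff'; apply: oriented_ext => v.
apply: (@schain_ext q A (f \o osim (schain q) v)
  (f' \o osim (schain q) v)) => s g.
exact: ff'.
Qed.

Lemma hor_dsim p q (v : tup p.+1) (s : sing q) g : hor p q (dsim v s g) =
  \sum_(i < p.+2) dsim (vtuple_re (nre p p.+1 (bump i)) v) s g *~ (-1) ^+ i.
Proof.
rewrite [LHS]oriented_d_osim; apply: eq_bigr => i _.
by rewrite -lift_nre.
Qed.

Lemma ver_dsim p q (v : tup p) (s : sing q.+1) g : ver p q (dsim v s g) =
  \sum_(i < q.+2) dsim v (singular_re (nre q q.+1 (bump i)) s) g *~ (-1) ^+ i.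
Proof.
rewrite [LHS]coefU schain_dU (raddf_sum (osim _ v)); apply: eq_bigr => i _.
by rewrite (raddfMz (osim _ v)).
Qed.

Lemma saugU s g : saug (ssim s g) = g.
Proof. exact: malg_linU. Qed.

Lemma dbl_aug_dsim p (v : tup p) (s : sing 0) g :
  dbl_aug p (dsim v s g) = vsim v g.
Proof. by rewrite [LHS]coefU saugU. Qed.

Lemma forget_dsim q (v : tup 0) (s : sing q) g :
  forget q (dsim v s g) = ssim s g.
Proof. exact: oriented_linU. Qed.

Lemma hor_hor p q x : hor p q (hor p.+1 q x) = 0.
Proof. exact: oriented_dd. Qed.

Lemma ver_hor p q x : ver p q (hor p q.+1 x) = hor p q (ver p.+1 q x).
Proof. exact: coef_d. Qed.

Lemma dbl_aug_hor p x : dbl_aug p (hor p 0 x) = vchain_d p (dbl_aug p.+1 x).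
Proof. exact: coef_d. Qed.

(** Alexander-Whitney: front face in the Vietoris factor, back face in the
    singular factor. *)
Definition aw p q n : {additive schain n -> dbl p q} :=
  malg_lin (fun s => osim (schain q) (vtuple_re (nre p n id) (vtx s)) \o
    ssim (singular_re (nre q n (addn p)) s)).

Lemma awU p q n s g : aw p q n (ssim s g) =
  dsim (vtuple_re (nre p n id) (vtx s)) (singular_re (nre q n (addn p)) s) g.
Proof. exact: malg_linU. Qed.

Lemma ver_osim p q (v : tup p) a :
  ver p q (osim (schain q.+1) v a) = osim (schain q) v (schain_d q a).
Proof. exact: coefU. Qed.


Lemma forget_hor q x : forget q (hor 0 q x) = 0.
Proof.
move: x; apply: (@dblP _ _ _ (forget q \o hor 0 q) \0) => v s g.
change (forget q (hor 0 q (dsim v s g)) = 0).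
rewrite -> hor_dsim; rewrite (raddf_sum (forget q)) !big_ord_recl big_ord0.
rewrite 2!(raddfMz (forget q)).
rewrite -> !forget_dsim.
by rewrite /= expr0 expr1 mulrN1z addr0 subrr.
Qed.

Lemma forget_ver q x : forget q (ver 0 q x) = schain_d q (forget q.+1 x).
Proof.
move: x; apply: (@dblP _ _ _ (forget q \o ver 0 q) (schain_d q \o forget q.+1)).
move=> v s g.
change (forget q (ver 0 q (dsim v s g)) = schain_d q (forget q.+1 (dsim v s g))).
rewrite -> ver_dsim, forget_dsim, schain_dU; rewrite (raddf_sum (forget q)).
by apply: eq_bigr => i _; rewrite (raddfMz (forget q)); rewrite -> forget_dsim.
Qed.

(** The last horizontal face of the component [(p.+1, q)] and the zeroth vertical face of
    [(p, q.+1)] are the same pair with opposite signs. The remaining faces are those of the simplex: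
    indices up to [p] come from the front part, the others from the back part. *)
Lemma aw_d p q n c : n = (p + q)%N ->
  hor p q (aw p.+1 q n.+1 c) + ver p q (aw p q.+1 n.+1 c) *~ (-1) ^+ p =
  aw p q n (schain_d n c).
Proof.
move=> npq; move: c.
apply: (@schain_ext _ _ ((hor p q \o aw p.+1 q n.+1) \+
  (@zscale _ ((-1) ^+ p) \o (ver p q \o aw p q.+1 n.+1))) (aw p q n \o schain_d n)).
move=> s g.
change (hor p q (aw p.+1 q n.+1 (ssim s g)) +
  ver p q (aw p q.+1 n.+1 (ssim s g)) *~ (-1) ^+ p =
  aw p q n (schain_d n (ssim s g))).
pose F i := dsim (mktup p (singn s \o bump i))
  (singular_re (nre q n.+1 (fun k => bump i (p + k))) s) g *~ (-1) ^+ i.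
transitivity (\sum_(i < n.+2) F i); last first.
  rewrite -> schain_dU; rewrite (raddf_sum (aw p q n)).
  apply: eq_bigr => i _; rewrite (raddfMz (aw p q n)).
  rewrite -> awU.
  apply: dsim_congr.
    rewrite vtx_re; last by move=> k; rewrite /bump; lia.
    by rewrite mktup_re // => k; lia.
  by rewrite singular_reM nre_comp // => k; lia.
rewrite (@big_ord_split _ _ p.+1 q.+1 F); last by lia.
pose A i := dsim (vtuple_re (nre p p.+1 (bump i))
  (vtuple_re (nre p.+1 n.+1 id) (vtx s)))
  (singular_re (nre q n.+1 (addn p.+1)) s) g *~ (-1) ^+ i.
pose B i := dsim (vtuple_re (nre p n.+1 id) (vtx s)) (singular_re
  (nre q q.+1 (bump i)) (singular_re (nre q.+1 n.+1 (addn p)) s)) g *~ (-1) ^+ i.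
have -> : hor p q (aw p.+1 q n.+1 (ssim s g)) = \sum_(i < p.+2) A i.
  by rewrite -> awU; exact: hor_dsim.
have -> : ver p q (aw p q.+1 n.+1 (ssim s g)) = \sum_(i < q.+2) B i.
  by rewrite -> awU; exact: ver_dsim.
rewrite (sum_recr p.+1 A) (sum_recl q.+1 B) mulrzDl -addrA.
apply: addr_congr.
  apply: eq_bigr => i _; apply: dsim_congr.
    rewrite vtuple_reM nre_comp; last by move=> k; rewrite /bump; have := ltn_ord i; lia.
    by rewrite mktup_re // => k; rewrite /= /bump; have := ltn_ord i; lia.
  congr singular_re; apply: nre_ext => k _.
  by rewrite /= /bump; have := ltn_ord i; lia.
rewrite addrA -[RHS]add0r; apply: addr_congr.
  have -> : A p.+1 = dsim (vtuple_re (nre p n.+1 id) (vtx s))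
      (singular_re (nre q n.+1 (addn p.+1)) s) g *~ (-1) ^+ p.+1.
    apply: dsim_congr => //.
    rewrite vtuple_reM nre_comp; last by move=> k; rewrite /bump; lia.
    by congr vtuple_re; apply: nre_ext => k; rewrite /= /bump; lia.
  have -> : B 0 = dsim (vtuple_re (nre p n.+1 id) (vtx s))
      (singular_re (nre q n.+1 (addn p.+1)) s) g *~ (-1) ^+ 0.
    apply: dsim_congr => //.
    rewrite singular_reM nre_comp; last by move=> k; rewrite /bump; lia.
    by congr singular_re; apply: nre_ext => k; rewrite /= /bump; lia.
  exact: mulrz_sign_cancel.
rewrite mulrz_suml; apply: eq_bigr => j _; rewrite -mulrzA -exprD /F.
have -> : (j.+1 + p = p.+1 + j)%N by lia.
apply: dsim_congr.
  rewrite mktup_re; last by move=> k; lia.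
  by apply: mktup_ext => k kp; rewrite /= /bump; congr singn; lia.
rewrite singular_reM nre_comp; last by move=> k; rewrite /bump; lia.
by congr singular_re; apply: nre_ext => k _; rewrite /= /bump; lia.
Qed.

Lemma forget_aw n c : forget n (aw 0 n n c) = c.
Proof.
move: c; apply: (@schain_ext _ _ (forget n \o aw 0 n n) idfun) => s g.
change (forget n (aw 0 n n (ssim s g)) = ssim s g).
rewrite -> awU, forget_dsim; congr (ssim _ g); apply: set_val_inj.
rewrite set_val_restrict; apply: funext => x /=; congr (set_val s _).
apply: set_val_inj; rewrite set_val_restrict; apply/rowP => j; rewrite mxE.
rewrite (bigD1 j) /=; last by rewrite /nre add0n inord_val.
rewrite big1 ?addr0 // => i /andP[/eqP].
by rewrite /nre add0n inord_val => ->; rewrite eqxx.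
Qed.

Lemma dbl_aug_aw n c : dbl_aug n (aw n 0 n c) = vert n c.
Proof.
move: c; apply: (@schain_ext _ _ (dbl_aug n \o aw n 0 n) (vert n)) => s g.
change (dbl_aug n (aw n 0 n (ssim s g)) = vert n (ssim s g)).
rewrite -> awU, dbl_aug_dsim, vertU; congr (vsim _ g).
by rewrite mktup_re.
Qed.

End DoubleComplex.

Lemma mulrz_sign_SS (A : zmodType) (y x : A) p :
  y + x *~ (-1) ^+ p.+2 = y + x *~ (-1) ^+ p.
Proof. by rewrite !exprS mulrA mulrNN !mul1r. Qed.

Lemma vsim_congr (G : zmodType) (X : topologicalType) n (v v' : tup X n) (g : G) m :
  v = v' -> vsim G v g *~ m = vsim G v' g *~ m.
Proof. by move=> ->. Qed.

(** * The join of a tuple with the vertices of a singular simplex *)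

Section Join.
Variables (R : realType) (G : zmodType) (X : topologicalType).
Local Notation tup := (tup X).
Local Notation sing := (sing R X).
Local Notation dbl := (dbl R G X).
Local Notation schain := (schain R G X).
Local Notation vchain := (vchain G X).
Local Notation hor := (hor R G X).
Local Notation ver := (ver R G X).
Local Notation vchain_d := (vchain_d G X).

(** The sequence [v 0, ..., v p, s e_0, s e_1, ...]. *)
Definition jseq p q (v : tup p) (s : sing q) (k : nat) : X :=
  if (k <= p)%N then tupn v k else singn s (k - p.+1).

Definition join_col p q N (v : tup p) : {additive schain q -> vchain N} :=
  malg_lin (fun s : sing q => vsim G (mktup N (jseq v s))).

Lemma join_colU p q N (v : tup p) (s : sing q) g :
  join_col q N v (ssim G s g) = vsim G (mktup N (jseq v s)) g.
Proof. exact: malg_linU. Qed.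

(** The intended degree is [N = p + q + 1]; keeping [N] as a parameter avoids casts between chain
    groups. The test makes the formula alternating for every [N], which a truncation losing vertices
    of [v] would not be. *)
Definition join_gen p q N (v : tup p) : {additive schain q -> vchain N} :=
  if (p < N)%N then join_col q N v else \0.

Fact join_alternating p q N : alternating (@join_gen p q N).
Proof.
apply: alternating_tperm => [v a b c ab|v c vi]; rewrite /join_gen; last first.
  case: ifP => // pN; move: c; apply: (@schain_ext _ _ _ _ _ _ \0) => s g.
  rewrite -> join_colU, vsim_degenerate => // => inj; apply: vi => i j vij.
  have := inj (inord i) (inord j); rewrite !mktupE /jseq.
  have ip := ltn_ord i; have jp := ltn_ord j.
  rewrite !inordK; try lia.
  rewrite -ltnS ip -ltnS jp /tupn !inord_val => /(_ vij)/(congr1 (@nat_of_ord _)).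
  by rewrite !inordK; try lia; move/ord_inj.
case: ifP => pN; last by rewrite oppr0.
move: c; apply: (@schain_ext _ _ _ _ _ _
  (-%R \o join_col q N v)) => s g.
change (join_col q N (vtuple_re (tperm a b) v) (ssim G s g) =
  - join_col q N v (ssim G s g)).
rewrite -> !join_colU; pose a' : 'I_N.+1 := inord a; pose b' : 'I_N.+1 := inord b.
have ap := ltn_ord a; have bp := ltn_ord b.
have ea : a' = a :> nat by rewrite inordK; lia.
have eb : b' = b :> nat by rewrite inordK; lia.
have ab' : a' != b'.
  apply: contra ab => /eqP/(congr1 (@nat_of_ord _)); rewrite !inordK; try lia.
  by move=> /ord_inj ->.
have -> : mktup N (jseq (vtuple_re (tperm a b) v) s) =
    vtuple_re (tperm a' b') (mktup N (jseq v s)).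
  apply: set_val_inj; apply/ffunP => i; rewrite vtuple_reE !mktupE.
  have kN := ltn_ord i; rewrite /jseq tupn_re /tupn.
  case: (tpermP a' b' i) => [->|->|/eqP ia /eqP ib].
  - by rewrite ea eb !inord_val tpermL -ltnS ap -ltnS bp.
  - by rewrite ea eb !inord_val tpermR -ltnS bp -ltnS ap.
  case: ifP => // ip; congr (set_val v _); rewrite tpermD //.
    by apply: contra ia => /eqP E; apply/eqP/ord_inj; rewrite ea E inordK.
  by apply: contra ib => /eqP E; apply/eqP/ord_inj; rewrite eb E inordK.
by rewrite vsim_perm odd_tperm ab' expr1 mulrN1z.
Qed.

Definition join p q N : {additive dbl p q -> vchain N} :=
  oriented_lin (@join_alternating p q N).

Lemma join_dsim p q N (v : tup p) (s : sing q) g : (p < N)%N ->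
  join p q N (dsim v s g) = vsim G (mktup N (jseq v s)) g.
Proof. by move=> pN; rewrite [LHS]oriented_linU /join_gen pN; exact: malg_linU. Qed.

(** A face of the join omits a vertex of [v] or one of [s], the latter with the sign shifted by
    [p.+1]. For [p = 0] or [q = 0] one factor disappears altogether; these terms produce [vert]
    after [forget], and [dbl_aug]. *)
Lemma join_d_split p q N (v : tup p) (s : sing q) g : N = (p + q)%N ->
  vchain_d N (join p q N.+1 (dsim v s g)) =
  \sum_(i < p.+1) vsim G (mktup N (jseq v s \o bump i)) g *~ (-1) ^+ i +
  (\sum_(i < q.+1) vsim G (mktup N (jseq v s \o bump (p.+1 + i))) g *~ (-1) ^+ i)
    *~ (-1) ^+ p.+1.
Proof.
move=> Npq; rewrite -> join_dsim; last by lia.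
rewrite -> vchain_dU.
rewrite (@big_ord_split _ _ p.+1 q.+1
  (fun i => vsim G (mktup N (jseq v s \o bump i)) g *~ (-1) ^+ i)); last by lia.
apply: addr_congr => //; rewrite mulrz_suml; apply: eq_bigr => i _.
by rewrite -mulrzA -exprD [(i + _)%N]addnC.
Qed.

Lemma join_hor p q N (v : tup p.+1) (s : sing q) g : (p < N)%N ->
  \sum_(i < p.+2) vsim G (mktup N (jseq v s \o bump i)) g *~ (-1) ^+ i =
  join p q N (hor p q (dsim v s g)).
Proof.
move=> pN; rewrite -> hor_dsim; rewrite [RHS]raddf_sum; apply: eq_bigr => i _.
rewrite [RHS]raddfMz; rewrite -> join_dsim; last by [].
apply: vsim_congr; apply: mktup_ext => k kN.
have ip := ltn_ord i; rewrite /jseq /= tupn_re /nre /tupn.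
case: ifP => b1; case: ifP => b2; move: b1 b2; rewrite /bump; try lia.
  by move=> _ kp; congr (set_val v _); apply: ord_inj; rewrite !inordK /bump; lia.
by move=> _ kp; congr singn; lia.
Qed.

Lemma join_ver p q N (v : tup p) (s : sing q.+1) g : N = (p + q).+1 ->
  \sum_(i < q.+2) vsim G (mktup N (jseq v s \o bump (p.+1 + i))) g *~ (-1) ^+ i =
  join p q N (ver p q (dsim v s g)).
Proof.
move=> Npq; rewrite -> ver_dsim; rewrite [RHS]raddf_sum; apply: eq_bigr => i _.
rewrite [RHS]raddfMz; rewrite -> join_dsim; last by lia.
apply: vsim_congr; apply: mktup_ext => k kN.
have ip := ltn_ord i; rewrite /jseq /= singn_re /nre /singn.
case: ifP => b1; case: ifP => b2; move: b1 b2; rewrite /bump; try lia.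
  by move=> _ kp; congr tupn; lia.
move=> _ kp; congr (set_val s (vertex R _)); apply: ord_inj.
rewrite !inordK; lia.
Qed.

Lemma join_forget q (v : tup 0) (s : sing q) g :
  \sum_(i < 1) vsim G (mktup q (jseq v s \o bump i)) g *~ (-1) ^+ i =
  vert R G X q (forget R G X q (dsim v s g)).
Proof.
rewrite -> forget_dsim, vertU; rewrite big_ord1; apply: (vsim_congr _ 1).
by apply: mktup_ext => k kN; rewrite /jseq /= /bump; congr singn; lia.
Qed.

Lemma join_aug p (v : tup p) (s : sing 0) g :
  \sum_(i < 1) vsim G (mktup p (jseq v s \o bump (p.+1 + i))) g *~ (-1) ^+ i =
  dbl_aug R G X p (dsim v s g).
Proof.
rewrite -> dbl_aug_dsim; rewrite big_ord1; apply: (vsim_congr _ 1).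
apply: set_val_inj; apply/ffunP => k; rewrite mktupE /jseq /=.
have kp := ltn_ord k; have -> : bump (p.+1 + 0) k = k by rewrite /bump; lia.
by rewrite -ltnS kp /tupn inord_val.
Qed.

Lemma join_d00 y : vchain_d 0 (join 0 0 1 y) =
  vert R G X 0 (forget R G X 0 y) - dbl_aug R G X 0 y.
Proof.
move: y; apply: (@dblP _ _ _ _ _ _ (vchain_d 0 \o join 0 0 1)
  ((vert R G X 0 \o forget R G X 0) \- dbl_aug R G X 0)) => v s g.
transitivity (vchain_d 0 (join 0 0 1 (dsim v s g))) => //.
rewrite -> join_d_split; last by []; rewrite -> join_forget, join_aug.
by rewrite expr1 mulrN1z.
Qed.

Lemma join_d0S q y : vchain_d q.+1 (join 0 q.+1 q.+2 y) =
  vert R G X q.+1 (forget R G X q.+1 y) - join 0 q q.+1 (ver 0 q y).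
Proof.
move: y; apply: (@dblP _ _ _ _ _ _ (vchain_d q.+1 \o join 0 q.+1 q.+2)
  ((vert R G X q.+1 \o forget R G X q.+1) \- (join 0 q q.+1 \o ver 0 q))) => v s g.
transitivity (vchain_d q.+1 (join 0 q.+1 q.+2 (dsim v s g))) => //.
rewrite -> join_d_split; last by []; rewrite -> join_forget, join_ver; last by [].
by rewrite expr1 mulrN1z.
Qed.

Lemma join_dS0 p y : vchain_d p.+1 (join p.+1 0 p.+2 y) =
  join p 0 p.+1 (hor p 0 y) + dbl_aug R G X p.+1 y *~ (-1) ^+ p.
Proof.
move: y; apply: (@dblP _ _ _ _ _ _ (vchain_d p.+1 \o join p.+1 0 p.+2)
  ((join p 0 p.+1 \o hor p 0) \+ (@zscale _ ((-1) ^+ p) \o dbl_aug R G X p.+1)))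
  => v s g.
transitivity (vchain_d p.+1 (join p.+1 0 p.+2 (dsim v s g))) => //.
rewrite -> join_d_split; last by rewrite addn0.
rewrite -> join_hor, join_aug; last by []; exact: mulrz_sign_SS.
Qed.

Lemma join_dSS p q N y : N = (p + q).+2 ->
  vchain_d N (join p.+1 q.+1 N.+1 y) =
  join p q.+1 N (hor p q.+1 y) + join p.+1 q N (ver p.+1 q y) *~ (-1) ^+ p.
Proof.
move=> Npq; move: y.
apply: (@dblP _ _ _ _ _ _ (vchain_d N \o join p.+1 q.+1 N.+1)
  ((join p q.+1 N \o hor p q.+1) \+
   (@zscale _ ((-1) ^+ p) \o (join p.+1 q N \o ver p.+1 q)))) => v s g.
transitivity (vchain_d N (join p.+1 q.+1 N.+1 (dsim v s g))) => //.
rewrite -> join_d_split; last by lia.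
rewrite -> join_hor; last by lia.
rewrite -> join_ver; last by lia.
exact: mulrz_sign_SS.
Qed.

End Join.

Lemma gen_ind (A : zmodType) (S P : set A) x :
  x \in gen S -> P 0 -> (forall y z, P y -> P z -> P (y - z)) -> S `<=` P -> P x.
Proof. by move=> /asboolP xS P0 PB SP; exact: xS. Qed.

Lemma rpred_sign (A : zmodType) (S : zmodClosed A) (x : A) n :
  x \in S -> x *~ (-1) ^+ n \in S.
Proof.
by move=> xS; rewrite -signr_odd; case: odd; rewrite ?expr1 ?mulrN1z ?rpredN.
Qed.

(** Empty members are exempt: no tuple or simplex lies in them, and the refinements below are found
    by choosing a point of [W]. *)
Definition refine_family (X : Type) (U U' : set (set X)) : Prop :=
  forall W, U W -> W !=set0 -> exists2 W', U' W' & W `<=` W'.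

(** * Small chains and the chase through the double complex *)

Section Small.
Variables (R : realType) (G : zmodType) (X : topologicalType).
Local Notation tup := (tup X).
Local Notation sing := (sing R X).
Local Notation dbl := (dbl R G X).
Local Notation schain := (schain R G X).
Local Notation vchain := (vchain G X).
Local Notation hor := (hor R G X).
Local Notation ver := (ver R G X).
Local Notation vchain_d := (vchain_d G X).
Local Notation schain_d := (schain_d R G X).
Local Notation forget := (forget R G X).
Local Notation dbl_aug := (dbl_aug R G X).
Local Notation vert := (vert R G X).
Local Notation join := (join R G X).
Local Notation aw := (aw R G X).
Implicit Types (U : set (set X)).

Definition fits U p q (v : tup p) (s : sing q) : Prop :=
  exists W, [/\ U W, forall i, W (set_val v i) & range (set_val s) `<=` W].

(** An oriented chain, being a coset, has no support of its own, so smallness is membership in a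
    generated subgroup. Singular chains are free, and [s_small] can speak of supports. *)
Definition dbl_small U p q : zmodClosed (dbl p q) :=
  gen [set x | exists v s g, fits U v s /\ x = dsim v s g].

Definition v_small U n : zmodClosed (vchain n) :=
  gen [set x | exists (v : tup n) g,
    (exists2 W, U W & forall i, W (set_val v i)) /\ x = vsim G v g].

Definition s_small U n : zmodClosed (schain n) :=
  supported G (fun s : sing n => exists2 W, U W & range (set_val s) `<=` W).

Lemma dsim_small U p q (v : tup p) (s : sing q) (g : G) :
  fits U v s -> dsim v s g \in dbl_small U p q.
Proof. by move=> vs; apply: sub_gen; exists v, s, g. Qed.

Lemma vsim_small U n (v : tup n) g W :
  U W -> (forall i, W (set_val v i)) -> vsim G v g \in v_small U n.
Proof. by move=> UW vW; apply: sub_gen; exists v, g; split=> //; exists W. Qed.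

Lemma dbl_small_map U p q (A : zmodType) (f : {additive dbl p q -> A})
    (T : zmodClosed A) :
  (forall v s g, fits U v s -> f (dsim v s g) \in T) ->
  forall x, x \in dbl_small U p q -> f x \in T.
Proof. by move=> fT; apply: gen_map => _ [v [s [g [vs ->]]]]; exact: fT. Qed.

Lemma dbl_small_mono U U' p q x : refine_family U U' ->
  x \in dbl_small U p q -> x \in dbl_small U' p q.
Proof.
move=> UU'; apply: (@dbl_small_map _ _ _ _ idfun) => v s g [W [UW vW sW]].
have W0 : W !=set0 by exists (set_val v ord0).
have [W' UW' WW'] := UU' W UW W0; apply: dsim_small; exists W'; split=> //.
  by move=> i; exact: WW'.
exact: subset_trans WW'.
Qed.

Lemma singular_re_range m n (f : 'I_m.+1 -> 'I_n.+1) (s : sing n) W :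
  range (set_val s) `<=` W -> range (set_val (singular_re f s)) `<=` W.
Proof.
by move=> sW _ [x _ <-]; rewrite set_val_restrict; apply: sW; exists (simplex_map f x).
Qed.

Lemma hor_small U p q x : x \in dbl_small U p.+1 q -> hor p q x \in dbl_small U p q.
Proof.
move: x; apply: dbl_small_map => v s g [W [UW vW sW]].
rewrite -> hor_dsim; apply: rpred_sum => i _; apply/rpred_sign/dsim_small.
by exists W; split=> // j; rewrite vtuple_reE.
Qed.

Lemma forget_small U q x : x \in dbl_small U 0 q -> forget q x \in s_small U q.
Proof.
move: x; apply: dbl_small_map => v s g [W [UW vW sW]].
by rewrite -> forget_dsim; apply: supportedU; exists W.
Qed.

Lemma jseq_fits U p q (v : tup p) (s : sing q) W :
  (forall i, W (set_val v i)) -> range (set_val s) `<=` W ->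
  forall k, W (jseq v s k).
Proof.
move=> vW sW k; rewrite /jseq; case: ifP => _; first exact: vW.
by apply: sW; exists (vertex R (inord (k - p.+1))).
Qed.

Lemma join_small U p q N x : (p < N)%N ->
  x \in dbl_small U p q -> join p q N x \in v_small U N.
Proof.
move=> pN; move: x; apply: dbl_small_map => v s g [W [UW vW sW]].
rewrite -> join_dsim; last by [].
by apply: (vsim_small _ UW) => i; rewrite mktupE; exact: jseq_fits.
Qed.

Lemma aw_small U p q n c : (p <= n)%N ->
  c \in s_small U n -> aw p q n c \in dbl_small U p q.
Proof.
move=> pn; move: c; apply: supported_map => s g [W UW sW].
change (aw p q n (ssim G s g) \in dbl_small U p q).
rewrite -> awU; apply: dsim_small.
exists W; split=> //; last exact: singular_re_range.
by move=> i; rewrite vtuple_reE mktupE; apply: sW; eexists.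
Qed.

Fact const_sing_subproof q (x : X) :
  [set s : std_simplex R q -> X | continuous s] (cst x).
Proof. exact: cst_continuous. Qed.

Definition const_sing q (x : X) : sing q :=
  exist _ (cst x) (mem_set (@const_sing_subproof q x)).

Lemma dbl_aug_lift U n w : w \in v_small U n ->
  exists2 y, y \in dbl_small U n 0 & dbl_aug n y = w.
Proof.
move=> wU; apply: (@gen_ind _ _
  (fun w => exists2 y, y \in dbl_small U n 0 & dbl_aug n y = w) w wU).
- by exists 0; rewrite ?rpred0 ?raddf0.
- move=> _ _ [y yU <-] [z zU <-]; exists (y - z); first exact: rpredB.
  exact: (raddfB (dbl_aug n)).
- move=> _ [v [g [[W UW vW] ->]]].
  (* The point at a vertex of [v] is a 0-simplex that fits every set containing [v]. *)
  exists (dsim v (const_sing 0 (set_val v ord0)) g); last exact: dbl_aug_dsim.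
  apply: dsim_small; exists W; split=> // _ [y _ <-].
  by rewrite set_val_exist; exact: vW.
Qed.

Section Homotopy.
Variables (U : set (set X)) (N : nat) (y : forall p q, dbl p q).
Hypothesis y_small : forall p q, (p + q)%N = N -> y p q \in dbl_small U p q.
Hypothesis y_cycle : forall p q, (p + q).+1 = N ->
  hor p q (y p.+1 q) + ver p q (y p q.+1) *~ (-1) ^+ p = 0.

Let y_hor p q : (p + q).+1 = N -> hor p q (y p.+1 q) = - ver p q (y p q.+1) *~ (-1) ^+ p.
Proof. by move=> /y_cycle/eqP; rewrite addr_eq0 mulNrz => /eqP. Qed.

(** The homotopy is an alternating sum of joins along the antidiagonal. As [y] is a total cycle, the
    [hor] term of each new join cancels the [ver] term left by the preceding one. *)
Let partial i j : (i + j.+1)%N = N -> exists2 K, K \in v_small U N.+1 &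
  vchain_d N K = vert N (forget N (y 0 N)) - join i j N (ver i j (y i j.+1)).
Proof.
elim: i j => [|i IH] j ijN.
  move: y_small; rewrite -ijN add0n => ys.
  exists (join 0 j.+1 j.+2 (y 0 j.+1)); last exact: join_d0S.
  by apply: join_small => //; exact: ys.
have [|K KU KE] := IH j.+1; first by lia.
exists (K - join i.+1 j.+1 N.+1 (y i.+1 j.+1) *~ (-1) ^+ i).
  apply: rpredB => //; apply: rpred_sign; apply: join_small; first by lia.
  by apply: y_small; lia.
rewrite (raddfB (vchain_d N)) KE; rewrite -> (raddfMz (vchain_d N)).
rewrite -> join_dSS; last by lia.
rewrite y_hor; last by lia.
rewrite -> (raddfMz (join i j.+1 N)), (raddfN (join i j.+1 N)).
by rewrite mulrzDl -!mulrzA -!exprD addnn -signr_odd odd_double expr0 !mulr1z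
  opprD opprK addrA subrK.
Qed.

Lemma join_homotopy : exists2 K, K \in v_small U N.+1 &
  vchain_d N K = vert N (forget N (y 0 N)) - dbl_aug N (y N 0).
Proof.
case: N y_small y_cycle y_hor partial => [|M] ys yc yh part.
  exists (join 0 0 1 (y 0 0)); last exact: join_d00.
  by apply: join_small => //; exact: ys.
have [|K KU KE] := part M 0%N; first by rewrite addn1.
exists (K - join M.+1 0 M.+2 (y M.+1 0) *~ (-1) ^+ M).
  apply: rpredB => //; apply: rpred_sign; apply: join_small => //.
  by apply: ys; rewrite addn0.
rewrite (raddfB (vchain_d M.+1)) KE; rewrite -> (raddfMz (vchain_d M.+1)).
rewrite -> join_dS0; rewrite yh ?addn0 //.
rewrite -> (raddfMz (join M 0 M.+1)), (raddfN (join M 0 M.+1)).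
by rewrite mulrzDl -!mulrzA -!exprD addnn -signr_odd odd_double expr0 !mulr1z
  opprD opprK addrA subrK.
Qed.

End Homotopy.

(** Vertical exactness up to enlarging the family. *)
Definition prec U U' : Prop :=
  [/\ refine_family U U',
    forall p x, x \in dbl_small U p 0 -> dbl_aug p x = 0 ->
      exists2 y, y \in dbl_small U' p 1 & ver p 0 y = x
  & forall p q x, x \in dbl_small U p q.+1 -> ver p q x = 0 ->
      exists2 y, y \in dbl_small U' p q.+2 & ver p q.+1 y = x].

Section Chase.
Variables (N : nat) (U : nat -> set (set X)).
Hypothesis U_prec : forall i, (i < N)%N -> prec (U i) (U i.+1).

Lemma refine_family_refl U0 : refine_family U0 U0.
Proof. by move=> W UW _; exists W. Qed.

Lemma refine_family_trans U0 U1 U2 :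
  refine_family U0 U1 -> refine_family U1 U2 -> refine_family U0 U2.
Proof.
move=> U01 U12 W UW [a Wa]; have [|W1 UW1 WW1] := U01 W UW; first by exists a.
have [|W2 UW2 W12] := U12 W1 UW1; first by exists a; exact: WW1.
by exists W2 => //; exact: subset_trans W12.
Qed.

Lemma prec_refine i j : (i <= j <= N)%N -> refine_family (U i) (U j).
Proof.
elim: j => [|j IH] /andP[ij jN].
  by move: ij; rewrite leqn0 => /eqP ->; exact: refine_family_refl.
move: ij; rewrite leq_eqVlt => /predU1P[->|ij]; first exact: refine_family_refl.
apply: refine_family_trans (IH _) _; first by rewrite -ltnS ij ltnW.
by have [] := U_prec jN.
Qed.

Variables (w : forall n, vchain n) (x : forall p q, dbl p q).
Hypothesis w_small : w N \in v_small (U 0) N.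
Hypothesis x_small : forall p q, (p + q).+1 = N -> x p q \in dbl_small (U 0) p q.
Hypothesis x_cycle : forall p q, (p + q).+2 = N ->
  hor p q (x p.+1 q) + ver p q (x p q.+1) *~ (-1) ^+ p = 0.
Hypothesis x_aug : forall M, M.+1 = N ->
  dbl_aug M (x M 0) = vchain_d M (w M.+1).

Let update (y : forall p q, dbl p q) p0 q0 (a : dbl p0 q0) :
  exists2 y' : forall p q, dbl p q, y' p0 q0 = a &
    forall p q, (p != p0) || (q != q0) -> y' p q = y p q.
Proof.
pose y0 := @dfwith nat (fun q => dbl p0 q) (y p0) q0 a.
pose y' := @dfwith nat (fun p => forall q, dbl p q) y p0 y0.
have y'p0 : y' p0 = y0 by exact: dfwith_in.
exists y'; first by rewrite y'p0; exact: dfwith_in.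
move=> p q; have [->|pp0] := eqVneq p p0.
  by rewrite /= y'p0 => qq0; apply: dfwith_out; rewrite eq_sym.
suff -> : y' p = y p by [].
by apply: dfwith_out; rewrite eq_sym.
Qed.

(** The total cycle [x], whose augmentation bounds [w], is written as a total boundary, one singular
    degree at a time. The component of degree 0 lifts [w]; each further one is a vertical filling
    and uses up one step of the sequence [U]. The element [w] is given as a family over all degrees
    so that [x_aug] needs no cast. *)
Lemma dbl_chase : exists y : forall p q, dbl p q,
  [/\ forall p q, (p + q)%N = N -> y p q \in dbl_small (U N) p q,
      dbl_aug N (y N 0) = w N &
      forall p q, (p + q).+1 = N ->
        hor p q (y p.+1 q) + ver p q (y p q.+1) *~ (-1) ^+ p = x p q].
Proof.
suff H k : (k <= N)%N -> exists y : forall p q, dbl p q,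
  [/\ forall p q, (p + q)%N = N -> (q <= k)%N -> y p q \in dbl_small (U k) p q,
      dbl_aug N (y N 0) = w N &
      forall p q, (p + q).+1 = N -> (q < k)%N ->
        hor p q (y p.+1 q) + ver p q (y p q.+1) *~ (-1) ^+ p = x p q].
  have [y [y1 y2 y3]] := H N (leqnn N); exists y; split=> // p q pq.
    by apply: y1 => //; lia.
  by apply: y3 => //; lia.
elim: k => [|k IH] kN.
  have [y0 y0U y0w] := dbl_aug_lift w_small.
  have [y yN _] := update (fun p q => 0) y0; exists y; split; rewrite ?yN //.
  move=> p q pq; rewrite leqn0 => /eqP q0; move: pq; rewrite q0 addn0 => ->.
  by rewrite yN.
have [y [yU yw yx]] := IH (ltnW kN).
have [p pk] : exists p, (p + k).+1 = N by exists (N - k.+1)%N; lia.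
(* The part of [x p k] that the vertical term has to produce. It is introduced through an equation
   so that it can be generalized when [k] is split below. *)
have [z zE] : exists z, z = x p k - hor p k (y p.+1 k) by eexists.
have zU : z \in dbl_small (U k) p k.
  rewrite zE; apply: rpredB; last by apply/hor_small/yU; lia.
  by apply: dbl_small_mono (x_small pk); apply: prec_refine; lia.
have [a aU az] : exists2 a, a \in dbl_small (U k.+1) p k.+1 & ver p k a = z.
  have [_ prec0 precS] := U_prec kN.
  case: k {IH kN} pk z zE zU yx yw yU prec0 precS => [|k] pk z zE zU yx yw yU prec0 precS.
    apply: prec0 => //; rewrite zE (raddfB (dbl_aug p)) dbl_aug_hor.
    move: pk; rewrite addn0 => pN; move: (x_aug pN) yw; rewrite -pN => -> ->.
    by rewrite subrr.
  (* The defect is a vertical cycle, by the cycle condition on [x] and the equation already solved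
     at [(p.+1, k)]. *)
  apply: precS => //; rewrite zE (raddfB (ver p k)) ver_hor.
  have : hor p k (x p.+1 k) + ver p k (x p k.+1) *~ (-1) ^+ p = 0.
    by apply: x_cycle; lia.
  rewrite -(yx p.+1 k); try lia.
  rewrite (raddfD (hor p k)) hor_hor add0r (raddfMz (hor p k)) exprS mulN1r mulrNz.
  rewrite addrC -mulrzBl => /(congr1 (fun u => u *~ (-1) ^+ p)).
  by rewrite mul0rz -mulrzA -exprD addnn -signr_odd odd_double expr0 mulr1z.
(* The sign compensates the one with which [ver] enters the total differential in column [p]. *)
have [y' y'a y'y] := update y (a *~ (-1) ^+ p).
exists y'; split.
- move=> p' q pq qk; have [qk'|qk'] := eqVneq q k.+1.
    move: pq; rewrite qk' => pq; have -> : p' = p by lia.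
    by rewrite y'a rpred_sign.
  rewrite y'y ?qk' ?orbT //.
  apply: dbl_small_mono (yU p' q pq _); last by lia.
  by have [] := U_prec kN.
- by rewrite y'y ?orbT.
- move=> p' q pq; rewrite ltnS leq_eqVlt => /predU1P[qk|qk].
    move: pq; rewrite qk => pq; have -> : p' = p by lia.
    rewrite y'a y'y; last by apply/orP; right; lia.
    rewrite (raddfMz (ver p k)) az -mulrzA -exprD addnn -signr_odd odd_double.
    by rewrite expr0 mulr1z zE addrC subrK.
  rewrite !y'y; [exact: yx|apply/orP; right; lia..].
Qed.

End Chase.
End Small.

(** * Fillings from HLC *)

Section Point.
Variables (G : zmodType) (K : symmetric_set).
Hypothesis K1 : forall n (x y : K n), x = y.

Lemma malg_unique n (x : K n) (c : malg (K n) G) : c = mkmalgU x (mcoeff x c).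
Proof. by apply/malgP => y; rewrite (K1 y x) mcoeffUU. Qed.

Lemma alternating_sum_unique (A : zmodType) (a : A) m :
  \sum_(i < m) a *~ (-1) ^+ i = a *+ odd m.
Proof.
elim: m => [|m IH]; first by rewrite big_ord0.
rewrite big_ord_recr /= IH -signr_odd; case: (odd m) => /=.
  by rewrite expr1 mulrN1z subrr.
by rewrite expr0 mulr1z add0r.
Qed.

Lemma free_d_unique n (y : K n) (x : K n.+1) g :
  free_d (mkmalgU x g) = mkmalgU y g *+ odd n :> malg (K n) G.
Proof.
rewrite [LHS]free_dU; have -> : odd n = odd n.+2 by rewrite /= negbK.
rewrite -alternating_sum_unique; apply: eq_bigr => i _.
by rewrite (K1 (ss_re (lift i) x) y).
Qed.

(** With one simplex in each degree, the boundary from degree [n.+1] is the identity for odd [n] and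
    zero for even [n]. So a cycle of positive degree is either zero or the boundary of the next
    simplex with the same coefficient. *)
Lemma point_acyclic n (c : malg (K n.+1) G) (x : K n.+2) :
  free_d c = 0 -> exists b, free_d b = c.
Proof.
pose y := ss_re (lift ord0) x; pose z := ss_re (lift ord0) y.
rewrite (malg_unique y c) (free_d_unique z); set g := mcoeff y c.
case: (boolP (odd n)) => [_|n_even _]; last first.
  by exists (mkmalgU x g); rewrite (free_d_unique y) /= n_even.
move=> /(congr1 (mcoeff z)); rewrite mulr1n mcoeffUU mcoeff0 => ->.
by exists 0; rewrite !raddf0.
Qed.

End Point.

Section Fill.
Variables (R : realType) (G : zmodType) (X : topologicalType).

Lemma set_val_continuous (A : set X) : continuous (@set_val X A).
Proof. exact: initial_continuous. Qed.

Definition push (A : set X) n (s : singular_simplex R A n) : sing R X n :=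
  singular_map_set R (@set_val_continuous A) n s.

Lemma pushE (A : set X) n (s : singular_simplex R A n) y :
  set_val (push s) y = set_val (set_val s y).
Proof. by rewrite /push /= set_val_restrict. Qed.

Lemma push_inj (A : set X) n : injective (@push A n).
Proof.
move=> s s' ss'; apply: set_val_inj; apply: funext => y; apply: set_val_inj.
by rewrite -!pushE ss'.
Qed.

Lemma push_lift (A : set X) n (s : sing R X n) :
  range (set_val s) `<=` A -> exists s', push (A := A) s' = s.
Proof.
move=> sA; have sA' y : [set: std_simplex R n] y -> A (set_val s y).
  by move=> _; apply: sA; exists y.
pose r (y : std_simplex R n) : A :=
  exist _ (set_val s y) (mem_set (sA' y I)).
have rE y : set_val (r y) = set_val s y by rewrite set_val_exist.
have rc : continuous r.
  apply: (@continuous_comp_initial _ _ _ (@set_val X A)).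
  have -> : set_val \o r = set_val s by apply: funext => y; exact: rE.
  exact: (set_valP s).
exists (exist _ r (mem_set rc)); apply: set_val_inj; apply: funext => y.
by rewrite pushE -rE; congr set_val; rewrite set_val_exist.
Qed.

Definition push_chain (A : set X) n :
    {additive malg (singular_simplex R A n) G -> schain R G X n} :=
  malg_map G (@push A n).

Lemma push_chain_d (A : set X) n c :
  push_chain A n (@free_d G (singular_set R A) n c) =
  schain_d R G X n (push_chain A n.+1 c).
Proof. exact: (free_map_subproof (singular_map_set R (@set_val_continuous A))). Qed.

Lemma push_chain_inj (A : set X) n : injective (push_chain A n).
Proof. exact/malg_map_inj/push_inj. Qed.

Lemma push_chain_lift (A : set X) n (c : schain R G X n) :
  c \in supported G (fun s : sing R X n => range (set_val s) `<=` A) ->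
  exists c', push_chain A n c' = c.
Proof.
move=> cA; have [|c' _ c'E] := @malg_map_lift _ _ G (@push A n) (fun=> True) c.
  by apply: supportedS cA => s /push_lift[s' <-]; exists s'.
by exists c'.
Qed.

Lemma push_chain_supported (A : set X) n c :
  push_chain A n c \in supported G (fun s : sing R X n => range (set_val s) `<=` A).
Proof.
apply/asboolP => s /eqP sc; apply: contrapT => sA; apply: sc.
move: c; apply: (@malg_ext _ _ _ (mcoeff s \o push_chain A n) \0) => s' g /=.
rewrite malg_mapU mcoeffU; case: eqP => // s's; exfalso; apply: sA.
by rewrite -s's => _ [y _ <-]; rewrite pushE; exact: set_valP.
Qed.

Variables (A B : set X) (AB : A `<=` B).
Hypothesis AB0 : forall n (z : reduced_homology R G A n),
  reduced_map R G (@set_incl_continuous X A B AB) n z = 0.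

Lemma push_incl n c :
  push_chain B n (malg_map G (singular_map_set R (@set_incl_continuous X A B AB) n) c) =
  push_chain A n c.
Proof.
apply/esym/malg_map_comp => s; apply: set_val_inj; apply: funext => y.
rewrite !pushE; have -> : set_val (singular_map_set R (@set_incl_continuous X A B AB) n s)
  = set_incl AB \o set_val s by exact: set_val_restrict.
by rewrite /= /set_incl set_val_restrict.
Qed.

(** A cycle with vanishing augmentation defines a reduced class, which [AB0] kills in [B]; a
    bounding chain in [B] is then pushed to [X]. *)
Lemma fill_class n (c : cycles (free_complex G (singular_set R A)) n) :
  augmentation R G A n (homology_class c) = 0 ->
  exists2 e, e \in supported G (fun s : sing R X n.+1 => range (set_val s) `<=` B)
    & schain_d R G X n e = push_chain A n (sg_val c).
Proof.
move=> /eqP c0; pose z : reduced_homology R G A n := Subgroup (c0 : _ \in ker _).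
have := congr1 (fun z => sg_val z) (AB0 z).
rewrite /= /singular_map homology_mapE => /homology_class_eq0[b bE].
exists (push_chain B n.+1 b); first exact: push_chain_supported.
rewrite -push_chain_d; transitivity (push_chain B n (sg_val (cycles_map (free_map G
  (singular_map_set R (@set_incl_continuous X A B AB))) n c))).
  by congr (push_chain B n _).
exact: push_incl.
Qed.

Lemma point_simplex_unique n (s s' : singular_set R (discrete_topology unit) n) :
  s = s'.
Proof.
apply: set_val_inj; apply: funext => y.
by case: (set_val s y); case: (set_val s' y).
Qed.

(** In degree 0 the augmentation to the point is the sum of the coefficients, so [saug c = 0] says
    that the class is reduced. *)
Lemma fill0 c :
  c \in supported G (fun s : sing R X 0 => range (set_val s) `<=` A) ->
  saug R G X c = 0 ->
  exists2 e, e \in supported G (fun s : sing R X 1 => range (set_val s) `<=` B)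
    & schain_d R G X 0 e = c.
Proof.
move=> /push_chain_lift[c' <-] c0.
have c'0 : boundary_out (free_complex G (singular_set R A)) 0 c' = 0 by [].
apply: (@fill_class 0 (Subgroup (cycleP c'0))).
rewrite /augmentation /singular_map homology_mapE; apply/homology_class_eq0.
exists 0; rewrite raddf0; apply/esym.
change (malg_map G (singular_map_set R (@to_point_continuous A) 0) c' = 0).
set c1 := malg_map _ _ _.
pose x : singular_set R (discrete_topology unit) 0 :=
  @const_sing R (discrete_topology unit) 0 tt.
rewrite (malg_unique point_simplex_unique x c1) -[RHS](raddf0 (mkmalgU x)).
congr mkmalgU; rewrite -c0 /c1; move: (c').
apply: (@malg_ext _ _ _
  (mcoeff x \o malg_map G (singular_map_set R (@to_point_continuous A) 0))
  (saug R G X \o push_chain A 0)) => s g.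
change (mcoeff x
    (malg_map G (singular_map_set R (@to_point_continuous A) 0) (mkmalgU s g)) =
  saug R G X (push_chain A 0 (mkmalgU s g))).
rewrite malg_mapU; move: (singular_map_set R _ 0 s) => s1.
rewrite (point_simplex_unique s1 x) mcoeffUU.
rewrite [push_chain A 0 _]malg_mapU; exact/esym/saugU.
Qed.

(** The point has no homology in positive degrees, so every cycle there is reduced. *)
Lemma fillS n c :
  c \in supported G (fun s : sing R X n.+1 => range (set_val s) `<=` A) ->
  schain_d R G X n c = 0 ->
  exists2 e, e \in supported G (fun s : sing R X n.+2 => range (set_val s) `<=` B)
    & schain_d R G X n.+1 e = c.
Proof.
move=> /push_chain_lift[c' <-] c0.
have c'0 : boundary_out (free_complex G (singular_set R A)) n.+1 c' = 0.
  by apply: push_chain_inj; rewrite /= push_chain_d c0 raddf0.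
apply: (@fill_class n.+1 (Subgroup (cycleP c'0))).
rewrite /augmentation /singular_map homology_mapE; apply/homology_class_eq0.
apply: (point_acyclic point_simplex_unique).
  exact: (@const_sing R (discrete_topology unit) n.+2 tt).
by move: (cycles_map _ _ _) => z; exact: (cycle_boundary_out z).
Qed.

End Fill.

(** * Exactness of the columns up to a shift *)

Section Columns.
Variables (R : realType) (G : zmodType) (X : topologicalType).
Local Notation tup := (tup X).
Local Notation sing := (sing R X).
Local Notation dbl := (dbl R G X).
Local Notation schain := (schain R G X).
Local Notation schain_d := (schain_d R G X).
Local Notation saug := (saug R G X).
Implicit Types (U : set (set X)).

Lemma osim_small U p q (v : tup p) (c : schain q) :
  c \in supported G (fun s : sing q => fits U v s) ->
  osim (schain q) v c \in dbl_small R G U p q.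
Proof.
by move: c; apply: (@supported_map _ _ _ _ (osim (schain q) v)) => s g; exact: dsim_small.
Qed.

Lemma normal_form_small U p q (x : dbl p q) v : x \in dbl_small R G U p q ->
  mcoeff v (normal_form x) \in supported G (fun s : sing q => fits U v s).
Proof.
move: x; apply: (@dbl_small_map _ _ _ _ _ _ _
  (mcoeff v \o @normal_form X (triv X) p (schain q))).
move=> w s g [W [UW wW sW]].
change (mcoeff v (normal_form (osim (schain q) w (ssim G s g))) \in
  supported G (fun s : sing q => fits U v s)).
rewrite normal_formU mcoeffU; case: eqP => [<-|_]; last first.
  by rewrite mulr0n (rpred0 (supported G _)).
rewrite mulr1n -(raddfMz (ssim G s)); apply: supportedU.
exists W; split=> // i; have [t ->] := vrepP w.
by rewrite vtuple_reE.
Qed.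

(** The normal form splits [x] into one singular chain per tuple. It is natural in the coefficients,
    so [coef phi x = 0] says that [phi] kills each of these chains, and they can be filled one by
    one. Only finitely many choices are made, for this one [x]. *)
Lemma column_fill U U' p q (B : zmodType) (phi : {additive schain q -> B}) :
  (forall (v : tup p) (c : schain q), c \in supported G (fun s : sing q => fits U v s) ->
    phi c = 0 -> exists2 e : schain q.+1,
      e \in supported G (fun s : sing q.+1 => fits U' v s) & schain_d q e = c) ->
  forall x : dbl p q, x \in dbl_small R G U p q -> coef phi x = 0 ->
  exists2 y, y \in dbl_small R G U' p q.+1 & ver R G X p q y = x.
Proof.
move=> fill x xU x0; pose m := normal_form x.
have /choice[e eP] : forall v : tup p, exists e : schain q.+1,
    e \in supported G (fun s : sing q.+1 => fits U' v s) /\ schain_d q e = mcoeff v m.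
  move=> v; have [||e eU eE] := fill v (mcoeff v m); last by exists e.
    exact: normal_form_small.
  by rewrite -mcoeff_malg_coef -normal_form_coef x0 raddf0 mcoeff0.
exists (\sum_(v <- finmap.enum_fset (msupp m)) osim (schain q.+1) v (e v)).
  by apply: rpred_sum => v _; apply: osim_small; case: (eP v).
rewrite raddf_sum -[RHS](normal_formK x) -/m [in RHS](monalgE m).
rewrite [RHS](raddf_sum (orient (schain q) (triv X) p)).
by apply: eq_bigr => v _; have [_ <-] := eP v; exact: ver_osim.
Qed.

Definition fillable (A W : set X) : Prop :=
  (forall c : schain 0,
    c \in supported G (fun s : sing 0 => range (set_val s) `<=` A) ->
    saug c = 0 -> exists2 e : schain 1,
      e \in supported G (fun s : sing 1 => range (set_val s) `<=` W)
      & schain_d 0 e = c) /\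
  (forall n (c : schain n.+1),
    c \in supported G (fun s : sing n.+1 => range (set_val s) `<=` A) ->
    schain_d n c = 0 -> exists2 e : schain n.+2,
      e \in supported G (fun s : sing n.+2 => range (set_val s) `<=` W)
      & schain_d n.+1 e = c).

(** Every member that contains a tuple contains its vertex 0, hence lies in the set [A] belonging to
    that vertex. So all simplices that fit the tuple lie in [A] and can be filled in [W], and [W]
    contains the tuple as well. *)
Lemma prec_fillable U U' :
  (forall (x : X) V, U V -> V x -> exists A W,
    [/\ U' W, A `<=` W, forall V', U V' -> V' x -> V' `<=` A & fillable A W]) ->
  prec R G U U'.
Proof.
move=> H; have col p q (B : zmodType) (phi : {additive schain q -> B}) :
  (forall A W, fillable A W -> forall c : schain q,
    c \in supported G (fun s : sing q => range (set_val s) `<=` A) ->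
    phi c = 0 -> exists2 e : schain q.+1,
      e \in supported G (fun s : sing q.+1 => range (set_val s) `<=` W)
      & schain_d q e = c) ->
  forall x : dbl p q, x \in dbl_small R G U p q -> coef phi x = 0 ->
  exists2 y, y \in dbl_small R G U' p q.+1 & ver R G X p q y = x.
  move=> fill; apply: column_fill => v c cU c0.
  have [[V [UV vV]]|noV] := pselect (exists V, U V /\ forall i, V (set_val v i)).
    have [A [W [UW AW VA AWf]]] := H _ V UV (vV ord0).
    have [|e eW eE] := fill A W AWf c _ c0.
      by apply: supportedS cU => s [V' [UV' vV' sV']]; apply: subset_trans (VA V' UV' _).
    exists e => //; apply: supportedS eW => s sW; exists W; split=> // i.
    by apply/AW/(VA V).
  (* A tuple contained in no member carries only the zero chain. *)
  exists 0; rewrite ?(rpred0 (supported G _)) // raddf0; apply/esym.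
  apply: supported_eq0 cU => s [V [UV vV _]]; apply: noV; by exists V.
split.
- move=> W UW [x Wx]; have [A [W' [UW' AW' WA _]]] := H x W UW Wx.
  by exists W' => //; apply: subset_trans AW'; exact: WA.
- by move=> p x xU x0; apply: (col p 0 G saug) xU x0 => A W [].
- move=> p q x xU x0; apply: (col p q.+1 _ (schain_d q)) xU x0 => A W [_].
  exact.
Qed.

End Columns.

Definition cover_family (X : topologicalType) (A : set X) (alpha : cover A) :
    set (set X) :=
  [set @set_val X A @` U | U in cover_sets alpha].

Section Sublevels.
Variables (R : realType) (G : zmodType) (X : topologicalType) (f : X -> R).
Hypothesis f_paracompact : forall t : R, paracompact (sublevel f t).
Hypothesis f_hausdorff : forall t : R, hausdorff_space (sublevel f t).
Hypothesis f_HLC : HLC f (reduced_functor R G).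

(** For each [x], HLC inside a member of [alpha] around [x] gives a neighborhood whose part below
    [r] is fillable. A point-star refinement of these neighborhoods on [sublevel f s] meets the
    hypothesis of [prec_fillable]. *)
Lemma HLC_prec (s t : R) (alpha : cover (sublevel f t)) : s < t ->
  exists beta : cover (sublevel f s), prec R G (cover_family beta) (cover_family alpha).
Proof.
(* HLC requires [f x] to be strictly below its lower level, so the points with [f x <= s] are
   treated at a level above [s]. *)
move=> st; pose r := (s + t) / 2.
have [sr rt] : s < r /\ r < t by rewrite /r; split; lra.
pose P (x : X) (UW : set X * set X) :=
  [/\ nbhs x UW.1, cover_family alpha UW.2, sublevel f r `&` UW.1 `<=` UW.2 &
      fillable R G (sublevel f r `&` UW.1) UW.2].
have /choice[UW UWP] : forall x, exists UW, sublevel f s x -> P x UW.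
  move=> x; have [xs|] := pselect (sublevel f s x); last by exists (set0, set0).
  have xt : sublevel f t x by apply: sublevel_mono xs; exact: ltW.
  pose x' : sublevel f t := exist _ x (mem_set xt).
  have [W aW Wx] : (\bigcup_(W in cover_sets alpha) W) x' by rewrite cover_full.
  have [V oV VW] := cover_open aW.
  have Vx : V x by have : W x' by []; rewrite -VW /= set_val_exist.
  have [|U [UV [xU Uzero]]] := f_HLC rt (open_nbhs_nbhs (conj oV Vx)).
    exact: le_lt_trans sr.
  have WE : set_val @` W = sublevel f t `&` V.
    rewrite eqEsubset; split=> [_ [y Wy <-]|y [yt Vy]].
      by split; [exact: set_valP|move: Wy; rewrite -VW].
    exists (exist _ y (mem_set yt)); last by rewrite set_val_exist.
    by rewrite -VW /= set_val_exist.
  exists (U, sublevel f t `&` V) => _; split => //=.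
  - by exists W.
  - by apply: setISS => //; exact: sublevel_mono (ltW rt).
  - split=> [c|n c].
      by apply: (@fill0 _ _ _ _ _ (setISS (@sublevel_mono R X f _ _ (ltW rt)) UV)).
    by apply: (@fillS _ _ _ _ _ (setISS (@sublevel_mono R X f _ _ (ltW rt)) UV)).
pose O (x : sublevel f s) : set (sublevel f s) := set_val @^-1` (UW (set_val x)).1^°.
have copen V : range O V -> open V.
  move=> [x _ <-]; apply: open_comp; last exact: open_interior.
  by move=> y _; exact: set_val_continuous.
have cfull : \bigcup_(V in range O) V = setT.
  rewrite -subTset => y _; exists (O y); first by exists y.
  by have [] := UWP _ (set_valP y).
have [beta betaP] := @point_star_refinement _ (@f_paracompact s) (@f_hausdorff s)
  (Cover copen cfull).
exists beta; apply: prec_fillable => x _ [V0 bV0 <-] [y _ yx].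
have [_ [z _ <-] star] := betaP y.
have [_ aW UWsub fill] := UWP _ (set_valP z).
exists (sublevel f r `&` (UW (set_val z)).1), (UW (set_val z)).2; split=> //.
move=> _ [V bV <-] [y' Vy']; rewrite -yx => /set_val_inj y'y.
move=> _ [u Vu <-]; split; first exact: sublevel_mono (ltW sr) _ (set_valP u).
by apply: interior_subset; apply: (star V) => //; rewrite -y'y.
Qed.

Lemma HLC_prec_sequence N (s t : R) (alpha : cover (sublevel f t)) : s < t ->
  exists (beta : cover (sublevel f s)) (U : nat -> set (set X)),
    [/\ U 0 = cover_family beta, refine_family (U N) (cover_family alpha) &
        forall i, (i < N)%N -> prec R G (U i) (U i.+1)].
Proof.
elim: N s => [|N IH] s st.
  (* No column is filled here; the lemma only supplies a cover at level [s] that refines [alpha]. *)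
  have [beta [bref _ _]] := HLC_prec alpha st.
  by exists beta, (fun=> cover_family beta).
have [sr rt] : s < (s + t) / 2 /\ (s + t) / 2 < t by split; lra.
have [gamma [U [U0 UN Uprec]]] := IH _ rt.
have [beta bprec] := HLC_prec gamma sr.
exists beta, (fun i => if i is j.+1 then U j else cover_family beta); split=> // -[|i].
  by rewrite U0.
by rewrite ltnS; exact: Uprec.
Qed.

End Sublevels.

(** * From covers of sublevel sets to families of subsets *)

Section Meet.
Variables (Y : topologicalType) (alpha beta : cover Y).

Definition meet_sets : set (set Y) :=
  [set W | exists U V, [/\ cover_sets alpha U, cover_sets beta V & W = U `&` V]].

Fact meet_open W : meet_sets W -> open W.
Proof.
move=> [U [V [aU bV ->]]]; apply: openI; [exact: cover_open aU|exact: cover_open bV].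
Qed.

Fact meet_full : \bigcup_(W in meet_sets) W = setT.
Proof.
rewrite -subTset => y _.
have [U aU Uy] : (\bigcup_(U in cover_sets alpha) U) y by rewrite cover_full.
have [V bV Vy] : (\bigcup_(V in cover_sets beta) V) y by rewrite cover_full.
by exists (U `&` V) => //; exists U, V.
Qed.

Definition meet_cover : cover Y := Cover meet_open meet_full.

Lemma meet_cover_l : refines meet_cover alpha.
Proof. by move=> _ [U [V [aU bV ->]]]; exists U => // _ [y [Uy Vy] <-]. Qed.

Lemma meet_cover_r : refines meet_cover beta.
Proof. by move=> _ [U [V [aU bV ->]]]; exists V => // _ [y [Uy Vy] <-]. Qed.

End Meet.

Lemma refines_cover_family (X : topologicalType) (A : set X) (alpha beta : cover A) :
  refines alpha beta -> refine_family (cover_family alpha) (cover_family beta).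
Proof.
move=> ab _ [U aU <-] _; have [V bV UV] := ab U aU.
exists (set_val @` V); first by exists V.
by move=> _ [y Uy <-]; exists y => //; apply: UV; exists y.
Qed.

Section Transfer.
Variables (R : realType) (G : zmodType) (X : topologicalType).
Local Notation vchain := (vchain G X).
Local Notation schain := (schain R G X).
Local Notation vchain_d := (vchain_d G X).
Local Notation schain_d := (schain_d R G X).

Lemma v_small_mono U U' n (x : vchain n) : refine_family U U' ->
  x \in v_small G U n -> x \in v_small G U' n.
Proof.
move=> UU'; move: x; apply: (gen_map (f := idfun)) => _ [v [g [[W UW vW] ->]]].
have [|W' UW' WW'] := UU' W UW; first by exists (set_val v ord0).
by apply: (vsim_small _ UW') => i; exact: WW'.
Qed.

Section Cover.
Variables (A : set X) (alpha : cover A).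

Fact val_refines_triv : refines_along (@set_val X A) alpha (triv X).
Proof. by move=> U _; exists setT. Qed.

Definition vpush : chain_map (vietoris G alpha) (vietoris G (triv X)) :=
  vietoris_map G val_refines_triv.

Lemma vpush_osim n (v : vtuple alpha n) g :
  vpush n (osim G v g) = vsim G (vtuple_map val_refines_triv v) g.
Proof. by rewrite [LHS]oriented_mapE malg_mapU. Qed.

Lemma vpush_small n x : vpush n x \in v_small G (cover_family alpha) n.
Proof.
have [c <-] := orientP x; rewrite (monalgE c) (raddf_sum (orient G alpha n)).
rewrite raddf_sum; apply: rpred_sum => v _; rewrite osimE vpush_osim.
have [U aU vU] := set_valP v; apply: (@vsim_small G X _ n _ _ (set_val @` U)).
  by exists U.
by move=> i; rewrite set_val_restrict ffunE; exists (set_val v i).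
Qed.

Lemma vtuple_lift n (v : tup X n) W :
  cover_family alpha W -> (forall i, W (set_val v i)) ->
  exists v', vtuple_map val_refines_triv v' = v.
Proof.
move=> [U aU <-] vU.
have /choice[u uP] : forall i, exists u : A, U u /\ set_val u = set_val v i.
  by move=> i; have [u Uu uE] := vU i; exists u.
have uU : exists2 U, cover_sets alpha U & forall i, U ([ffun i => u i] i).
  by exists U => // i; rewrite ffunE; case: (uP i).
exists (exist _ [ffun i => u i] (mem_set uU)); apply: set_val_inj.
apply/ffunP => i; rewrite set_val_restrict ffunE set_val_exist ffunE.
by case: (uP i).
Qed.

Lemma vpush_lift n x : x \in v_small G (cover_family alpha) n -> exists y, vpush n y = x.
Proof.
move=> xU; apply: (@gen_ind _ _ (fun x => exists y, vpush n y = x) x xU).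
- by exists 0; rewrite raddf0.
- by move=> _ _ [y <-] [z <-]; exists (y - z); rewrite raddfB.
- move=> _ [v [g [[W aW vW] ->]]]; have [v' v'E] := vtuple_lift aW vW.
  by exists (osim G v' g); rewrite vpush_osim v'E.
Qed.

Lemma vtuple_map_val_inj n : injective (@vtuple_map _ _ _ _ _ val_refines_triv n).
Proof.
move=> v v' vv'; apply: set_val_inj; apply/ffunP => i; apply: set_val_inj.
have := congr1 (fun w : tup X n => set_val w i) vv'.
by rewrite !set_val_restrict !ffunE.
Qed.

(** A left inverse of [vpush]: tuples that are not small are sent to zero. *)
Definition vpull_gen n (v : tup X n) : {additive G -> oriented G alpha n} :=
  if pselect (exists v', vtuple_map val_refines_triv v' = v) is left e
  then osim G (projT1 (cid e)) else \0.

Lemma vpull_genE n v' : vpull_gen (vtuple_map val_refines_triv v') = osim G (n := n) v'.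
Proof.
rewrite /vpull_gen; case: pselect => [e|[]]; last by exists v'.
by case: (cid e) => u /= /vtuple_map_val_inj ->.
Qed.

Lemma vpull_gen0 n (v : tup X n) :
  ~ (exists v', vtuple_map val_refines_triv v' = v) -> vpull_gen v = \0.
Proof. by rewrite /vpull_gen; case: pselect. Qed.

Fact vpull_alternating n : alternating (@vpull_gen n).
Proof.
split=> [v s g|v g vi].
  have [[v' <-]|nv] := pselect (exists v', vtuple_map val_refines_triv v' = v).
    by rewrite -vtuple_map_re !vpull_genE osim_perm.
  rewrite !vpull_gen0 //= ?mul0rz // => -[v' v'E]; apply: nv.
  exists (vtuple_re (s^-1)%g v').
  by rewrite vtuple_map_re v'E vtuple_re_perm mulVg vtuple_re1.
have [[v' v'E]|nv] := pselect (exists v', vtuple_map val_refines_triv v' = v).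
  rewrite -v'E vpull_genE osim_degenerate // => inj; apply: vi => i j.
  by rewrite -v'E !set_val_restrict !ffunE => /set_val_inj/inj.
by rewrite vpull_gen0.
Qed.

(** For quotient groups injectivity cannot be read off supports, as it is for [spush]; the
    retraction given by [vpull_gen] provides it. *)
Lemma vpush_inj n : injective (vpush n).
Proof.
suff K : cancel (vpush n) (oriented_lin (@vpull_alternating n)) by exact: can_inj K.
apply: (@oriented_ext _ _ _ _ _ (oriented_lin (@vpull_alternating n) \o vpush n) idfun).
move=> v g.
change (oriented_lin (@vpull_alternating n) (vpush n (osim G v g)) = osim G v g).
by rewrite vpush_osim oriented_linU vpull_genE.
Qed.

Definition spush n : {additive malg (small_simplex R alpha n) G -> schain n} :=
  push_chain R G A n \o malg_map G (small_incl_set R alpha n).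

Lemma spush_d n c :
  spush n (@free_d G (small_set R alpha) n c) = schain_d n (spush n.+1 c).
Proof.
transitivity (push_chain R G A n (@free_d G (singular_set R A) n
  (malg_map G (small_incl_set R alpha n.+1) c))); last exact: push_chain_d.
by congr (push_chain R G A n _); exact: (free_map_subproof (small_incl_set R alpha)).
Qed.

Lemma spush_inj n : injective (spush n).
Proof.
move=> c c' /push_chain_inj; apply: malg_map_inj; exact: set_val_inj.
Qed.

Lemma spush_lift n c :
  c \in s_small R G (cover_family alpha) n -> exists c', spush n c' = c.
Proof.
move=> cU; have [|c' _ <-] := @malg_map_lift _ _ G
    (@push R X A n \o small_incl_set R alpha n) (fun=> True) c.
  apply: supportedS cU => s [_ [U aU <-] sU].
  have sA : range (set_val s) `<=` A by move=> y /sU[a _ <-]; exact: set_valP.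
  have [s' s'E] := push_lift sA.
  have sU' : exists2 U, cover_sets alpha U & range (set_val s') `<=` U.
    exists U => // _ [y _ <-].
    have [|a Ua aE] := sU (set_val s y); first by exists y.
    by move: aE; rewrite -s'E pushE => /set_val_inj <-.
  pose u : small_simplex R alpha n := exist _ s' (mem_set sU').
  have uE : set_val u = s' by exact: set_val_exist.
  by exists u => //; rewrite -s'E -uE.
by exists c'; exact/esym/malg_map_comp.
Qed.

Lemma spush_small n c : spush n c \in s_small R G (cover_family alpha) n.
Proof.
have [] : c \in supported G (fun=> True) /\ true by split=> //; apply/asboolP.
move=> + _; move: c; apply: (@supported_map _ _ _ _ (spush n)) => s g _.
have [U aU sU] := set_valP s.
change (push_chain R G A n (malg_map G (small_incl_set R alpha n) (mkmalgU s g))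
  \in s_small R G (cover_family alpha) n).
rewrite malg_mapU [push_chain _ _ _ _ _]malg_mapU; apply: supportedU.
exists (set_val @` U); first by exists U.
by move=> _ [y _ <-]; rewrite pushE; eexists; last by []; apply: sU; exists y.
Qed.

Lemma vert_spush n c : vert R G X n (spush n c) = vpush n (mu R G alpha n c).
Proof.
move: c; apply: (@malg_ext _ _ _ (vert R G X n \o spush n) (vpush n \o mu R G alpha n)).
move=> s g.
change (vert R G X n (push_chain R G A n
    (malg_map G (small_incl_set R alpha n) (mkmalgU s g))) =
  vpush n (orient G alpha n (malg_map G (@vertices R A alpha n) (mkmalgU s g)))).
rewrite !malg_mapU osimE vpush_osim.
rewrite -[mkmalgU _ g]/(ssim G (push (small_incl_set R alpha n s)) g).
rewrite -> vertU; congr (vsim G _ g); apply: set_val_inj; apply/ffunP => i.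
rewrite mktupE /singn inord_val pushE set_val_restrict ffunE.
by rewrite verticesE.
Qed.

End Cover.
End Transfer.

Lemma cycles_mapE (C D : chain_complex) (h : chain_map C D) n (z : cycles C n) :
  sg_val (cycles_map h n z) = h n (sg_val z).
Proof. by []. Qed.

Lemma sing_range_nonempty (R : realType) (X : topologicalType) n (s : sing R X n) :
  range (set_val s) !=set0.
Proof. by exists (set_val s (vertex R ord0)); exists (vertex R ord0). Qed.

(** * The two outcomes of the chase *)

Section Zigzag.
Variables (R : realType) (G : zmodType) (X : topologicalType) (n : nat).
Variable U : nat -> set (set X).
Local Notation vchain := (vchain G X).
Local Notation schain := (schain R G X).
Local Notation dbl := (dbl R G X).

(** The Alexander-Whitney components of [C] form a total cycle whose augmentation [vert C] bounds
    [w], so the chase solves for them in total degree [n.+1]. Applying [forget] to the equation at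
    [(0, n)] kills the horizontal term and leaves [C] as a boundary. *)
Lemma fill_of_vert_boundary (C : schain n) (w : vchain n.+1) :
  (forall i, (i < n.+1)%N -> prec R G (U i) (U i.+1)) ->
  C \in s_small R G (U 0) n ->
  boundary_out (free_complex G (singular_set R X)) n C = 0 ->
  w \in v_small G (U 0) n.+1 -> vert R G X n C = vchain_d G X n w ->
  exists2 e, e \in s_small R G (U n.+1) n.+1 & schain_d R G X n e = C.
Proof.
move=> Uprec CU C0 wU wC.
(* The family extends [w] by zero in the other degrees. *)
pose W : forall m, vchain m := @dfwith nat vchain (fun=> 0) n.+1 w.
have WE : W n.+1 = w by exact: dfwith_in.
have [|p q pq|p q pq|M Mn|y [yU _ yE]] := @dbl_chase R G X n.+1 U Uprec W
    (fun p q => aw R G X p q n C).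
- by rewrite WE.
- by apply: aw_small CU; lia.
- have {pq} : n = (p + q).+1 by lia.
  move=> nE; move: C0; clear -nE; move: C; rewrite nE => C C0.
  rewrite aw_d //; rewrite [X in aw _ _ _ _ _ _ X](_ : _ = 0) ?raddf0 //.
- have {}Mn : M = n by lia.
  by rewrite Mn WE -wC dbl_aug_aw.
have := yE 0 n erefl; rewrite expr0 mulr1z => /(congr1 (forget R G X n)).
rewrite (raddfD (forget R G X n)) forget_hor add0r forget_ver forget_aw => <-.
by exists (forget R G X n.+1 (y 0 n.+1)) => //; apply/forget_small/yU.
Qed.

(** The chase with zero right-hand side extends [z] to a total cycle. Its component at [(0, n)]
    gives [C], and [join_homotopy] compares [vert C] with the augmentation [z]. *)
Lemma vert_lift (z : vchain n) :
  (forall i, (i < n)%N -> prec R G (U i) (U i.+1)) ->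
  z \in v_small G (U 0) n -> boundary_out (vietoris G (triv X)) n z = 0 ->
  exists C : schain n, [/\ C \in s_small R G (U n) n,
    boundary_out (free_complex G (singular_set R X)) n C = 0 &
    exists2 K, K \in v_small G (U n) n.+1 &
      vchain_d G X n K = vert R G X n C - z].
Proof.
move=> Uprec zU z0.
pose W : forall m, vchain m := @dfwith nat vchain (fun=> 0) n z.
have WE : W n = z by exact: dfwith_in.
have [|p q pq|p q pq|M Mn|y [yU yz yE]] := @dbl_chase R G X n U Uprec W
    (fun p q => 0).
- by rewrite WE.
- exact: rpred0.
- by rewrite !raddf0 mul0rz addr0.
- rewrite raddf0; subst n; rewrite WE; exact/esym.
rewrite WE in yz.
exists (forget R G X n (y 0 n)); split.
- by apply/forget_small/yU.
- case: n y yU yE {Uprec zU z0 W WE yz z} => [|m] y yU yE //.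
  have := yE 0 m erefl; rewrite expr0 mulr1z => /(congr1 (forget R G X m)).
  by rewrite (raddfD (forget R G X m)) forget_hor add0r forget_ver raddf0.
- have [K KU KE] := join_homotopy yU yE.
  by exists K => //; rewrite KE yz.
Qed.

End Zigzag.

(** * Injectivity and surjectivity of [mu] up to a shift *)

Section Shift.
Variables (R : realType) (G : zmodType) (X : topologicalType) (f : X -> R).
Hypothesis f_paracompact : forall t : R, paracompact (sublevel f t).
Hypothesis f_hausdorff : forall t : R, hausdorff_space (sublevel f t).
Hypothesis f_HLC : HLC f (reduced_functor R G).
Variables (s t : R) (st : s < t) (n : nat) (AB : sublevel f s `<=` sublevel f t).
Local Notation incl := (@set_incl_continuous X _ _ AB).
Local Notation push_map := (singular_map_set R incl).

Lemma boundary_out_inj (C D : chain_complex) (h : chain_map C D) m c :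
  injective (h m.-1) -> boundary_out D m (h m c) = 0 -> boundary_out C m c = 0.
Proof.
by move=> hi; rewrite -boundary_out_map -[X in _ = X](raddf0 (h m.-1)) => /hi.
Qed.

Definition spush_map (A : set X) (alpha : cover A) :
    chain_map (free_complex G (small_set R alpha)) (free_complex G (singular_set R X)) :=
  @ChainMap (free_complex G (small_set R alpha)) (free_complex G (singular_set R X))
    (spush R G alpha) (@spush_d R G X A alpha).

(** Only a bounding chain somewhere in [sublevel f t] is sought, so the sequence of families may end
    at the trivial cover. That [beta] does not depend on [x] is what makes the lifts compatible in
    [natural_coker_zero]. *)
Lemma mu_injective_shift : exists beta : cover (sublevel f s),
  forall x : homology (free_complex G (small_set R beta)) n,
  homology_map (mu R G beta) n x = 0 ->
  singular_map R G incl n (@small_incl R G _ n beta x) = 0.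
Proof.
have [beta [U [U0 UN Uprec]]] :=
  HLC_prec_sequence f_paracompact f_hausdorff f_HLC n.+1 (triv (sublevel f t)) st.
exists beta => x; have [c <-] := homology_classP x.
rewrite homology_mapE => /homology_class_eq0[w wE].
have [||||e eU eE] := @fill_of_vert_boundary R G X n U (spush R G beta n (sg_val c))
  (vpush G beta n.+1 w) Uprec.
- by rewrite U0; exact: spush_small.
- by rewrite -(boundary_out_map (spush_map beta)) cycle_boundary_out raddf0.
- by rewrite U0; exact: vpush_small.
- rewrite vert_spush; transitivity (vpush G beta n (cc_d (vietoris G beta) n w)).
    by rewrite wE.
  exact: (cm_d (vpush G beta)).
have [e' e'E] : exists e', push_chain R G (sublevel f t) n.+1 e' = e.
  apply: push_chain_lift; apply: supportedS eU => y [W UW yW].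
  have W0 : W !=set0 by exact: subset_nonempty yW (sing_range_nonempty y).
  have [_ [V _ <-] WV] := UN W UW W0.
  by move=> a /yW/WV[b _ <-]; exact: set_valP.
rewrite /small_incl.
rewrite [homology_map (free_map G (small_incl_set R beta)) n _]homology_mapE.
rewrite /singular_map homology_mapE; apply/homology_class_eq0.
exists e'; rewrite !cycles_mapE; apply: (@push_chain_inj R G X (sublevel f t) n).
have := @push_incl R G X _ _ AB n (malg_map G (small_incl_set R beta n) (sg_val c)).
have := push_chain_d (A := sublevel f t) e'.
rewrite e'E eE => pe' pc.
transitivity (spush R G beta n (sg_val c)); first exact: pe'.
exact: esym pc.
Qed.

Lemma mu_surjective_shift (alpha : cover (sublevel f t)) :
  exists (beta : cover (sublevel f s)) (ba : refines_along (set_incl AB) beta alpha),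
    refines beta (pull_cover incl alpha) /\
    forall z : homology (vietoris G beta) n,
    exists c, homology_map (mu R G alpha) n c = homology_map (vietoris_map G ba) n z.
Proof.
have [gamma [U [U0 UN Uprec]]] :=
  HLC_prec_sequence f_paracompact f_hausdorff f_HLC n alpha st.
(* The intersection with the restriction of [alpha] makes [beta] comparable to it in the limit
   system, empty members included. *)
pose beta := meet_cover gamma (pull_cover incl alpha).
have bp : refines beta (pull_cover incl alpha) by exact: meet_cover_r.
have ba : refines_along (set_incl AB) beta alpha.
  move=> _ [V [_ [gV [W aW <-] ->]]]; exists W => //.
  by move=> _ [y [_ yW] <-].
exists beta, ba; split=> // x; have [z <-] := homology_classP x.
have [||C [CU C0 [K KU KE]]] := @vert_lift R G X n U (vpush G beta n (sg_val z)) Uprec.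
- rewrite U0.
  apply: (@v_small_mono G X (cover_family beta)); last exact: vpush_small.
  exact/refines_cover_family/meet_cover_l.
- by rewrite -(boundary_out_map (vpush G beta)) cycle_boundary_out raddf0.
have [c cE] : exists c, spush R G alpha n c = C.
  apply: spush_lift; apply: supportedS CU => y [W UW yW].
  have W0 : W !=set0 by exact: subset_nonempty yW (sing_range_nonempty y).
  by have [V aV WV] := UN W UW W0; exists V => //; exact: subset_trans WV.
have c0 : boundary_out (free_complex G (small_set R alpha)) n c = 0.
  apply: (@boundary_out_inj _ _ (spush_map alpha)); first exact: spush_inj.
  by rewrite -C0 -cE.
have [k kE] : exists k, vpush G alpha n.+1 k = K.
  by apply: vpush_lift; exact: v_small_mono UN KU.
exists (homology_class (Subgroup (cycleP c0))); rewrite !homology_mapE.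
apply/eqP; rewrite -subr_eq0 -(raddfB (@homology_class _ _)).
apply/eqP/homology_class_eq0.
exists k; apply: (@vpush_inj G X _ alpha n).
transitivity (vchain_d G X n (vpush G alpha n.+1 k)); first exact: (cm_d (vpush G alpha)).
rewrite kE KE -cE vert_spush; apply/esym.
change (vpush G alpha n (mu R G alpha n c - vietoris_map G ba n (sg_val z)) =
  vpush G alpha n (mu R G alpha n c) - vpush G beta n (sg_val z)).
rewrite (raddfB (vpush G alpha n)); congr (_ - _); apply/esym.
apply: vietoris_map_comp => y.
by rewrite /set_incl set_val_restrict.
Qed.

End Shift.

(** * Barycentric subdivision and small simplices *)

Section TupleComplex.
Variables (G : zmodType) (Y : choiceType).

Definition tuple_re m n (f : 'I_m.+1 -> 'I_n.+1) (v : {ffun 'I_n.+1 -> Y}) :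
  {ffun 'I_m.+1 -> Y} := [ffun i => v (f i)].

Fact tuple_reM l m n (f : 'I_l.+1 -> 'I_m.+1) (g : 'I_m.+1 -> 'I_n.+1)
    (v : {ffun 'I_n.+1 -> Y}) :
  tuple_re f (tuple_re g v) = tuple_re (g \o f) v.
Proof. by apply/ffunP => i; rewrite !ffunE. Qed.

(** Affine simplices are recorded by their vertices. The algebra of subdivision then takes place
    over an arbitrary set; geometry enters through the choice of [bary]. *)
Definition tuple_set : symmetric_set :=
  @SymmetricSet (fun n => {ffun 'I_n.+1 -> Y}) tuple_re tuple_reM.

Definition tcone_tuple (b : Y) n (v : tuple_set n) : tuple_set n.+1 :=
  [ffun i => if unlift ord0 i is Some j then v j else b].

Lemma tcone_tuple0 b n (v : tuple_set n) : tcone_tuple b v ord0 = b.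
Proof. by rewrite ffunE unlift_none. Qed.

Lemma tcone_tupleS b n (v : tuple_set n) j : tcone_tuple b v (lift ord0 j) = v j.
Proof. by rewrite ffunE liftK. Qed.

Definition tcone (b : Y) n : {additive malg (tuple_set n) G -> malg (tuple_set n.+1) G} :=
  malg_map G (@tcone_tuple b n).

Lemma tcone_face0 b n (v : tuple_set n) :
  tuple_re (lift ord0) (tcone_tuple b v) = v.
Proof. by apply/ffunP => i; rewrite ffunE tcone_tupleS. Qed.

Lemma tcone_faceS b n (v : tuple_set n.+1) i :
  tuple_re (lift (lift ord0 i)) (tcone_tuple b v) = tcone_tuple b (tuple_re (lift i) v).
Proof.
apply/ffunP => k; rewrite ffunE; case: (unliftP ord0 k) => [j ->|->].
  rewrite [RHS]tcone_tupleS [RHS]ffunE -(tcone_tupleS b v (lift i j)).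
  congr (tcone_tuple b v _).
  by apply: ord_inj; rewrite /= /bump; lia.
rewrite [RHS]tcone_tuple0; transitivity (tcone_tuple b v ord0);
  last exact: tcone_tuple0.
congr (tcone_tuple b v _).
exact: ord_inj.
Qed.

Lemma free_d_tcone b n (c : malg (tuple_set n.+1) G) :
  free_d (tcone b n.+1 c) = c - tcone b n (free_d c).
Proof.
move: c; apply: (@malg_ext _ _ _ (@free_d G tuple_set n.+1 \o tcone b n.+1)
  (idfun \- (tcone b n \o @free_d G tuple_set n))) => v g.
change (free_d (tcone b n.+1 (mkmalgU v g)) =
  mkmalgU v g - tcone b n (@free_d G tuple_set n (mkmalgU v g))).
rewrite malg_mapU !free_dU big_ord_recl
  [ss_re (lift ord0) _]tcone_face0 expr0 mulr1z.
congr (_ + _); rewrite (raddf_sum (tcone b n)) -sumrN; apply: eq_bigr => i _.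
rewrite (raddfMz (tcone b n)) malg_mapU [ss_re _ _]tcone_faceS.
by rewrite /= /bump /= exprS mulN1r mulrNz.
Qed.

Definition taug : {additive malg (tuple_set 0) G -> G} := malg_lin (fun=> idfun).

Lemma taugU v g : taug (mkmalgU v g) = g.
Proof. exact: malg_linU. Qed.

Lemma free_d_tcone0 b (c : malg (tuple_set 0) G) :
  free_d (tcone b 0 c) = c - mkmalgU [ffun=> b] (taug c).
Proof.
move: c; apply: (@malg_ext _ _ _ (@free_d G tuple_set 0 \o tcone b 0)
  (idfun \- (mkmalgU [ffun=> b] \o taug))) => v g.
change (free_d (tcone b 0 (mkmalgU v g)) =
  mkmalgU v g - mkmalgU [ffun=> b] (taug (mkmalgU v g))).
rewrite malg_mapU !free_dU taugU !big_ord_recl big_ord0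
  [ss_re (lift ord0) _]tcone_face0.
rewrite expr0 expr1 mulr1z mulrN1z addr0; congr (_ - mkmalgU _ g).
apply/ffunP => k; rewrite !ffunE.
have -> : lift (lift ord0 ord0) k = ord0.
  by apply: ord_inj; rewrite /= /bump /=; have := ltn_ord k; lia.
by rewrite unlift_none.
Qed.

Lemma tuple_aug_d (c : malg (tuple_set 1) G) :
  taug (free_d c) = 0.
Proof.
move: c; apply: (@malg_ext _ _ _ (taug \o @free_d G tuple_set 0) \0).
move=> v g; change (taug (@free_d G tuple_set 0 (mkmalgU v g)) = 0).
rewrite free_dU !big_ord_recl big_ord0 addr0 (raddfD taug).
rewrite 2!(raddfMz taug); rewrite -> !taugU.
by rewrite expr0 expr1 mulr1z mulrN1z subrr.
Qed.

(** Barycentric subdivision with respect to an arbitrary choice of an apex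
    [bary v] for each tuple. *)
Variable bary : forall n, tuple_set n -> Y.

Fixpoint tsd n : {additive malg (tuple_set n) G -> malg (tuple_set n) G} :=
  if n is m.+1 return {additive malg (tuple_set n) G -> malg (tuple_set n) G} then
    malg_lin (fun v : tuple_set m.+1 =>
      tcone (bary v) m \o tsd m \o @free_d G tuple_set m \o mkmalgU v)
  else idfun.

(** The usual homotopy from the identity to subdivision: the cone from the barycenter over [v] minus
    the prism on its boundary. *)
Fixpoint tprism n : {additive malg (tuple_set n) G -> malg (tuple_set n.+1) G} :=
  if n is m.+1 return {additive malg (tuple_set n) G -> malg (tuple_set n.+1) G} then
    malg_lin (fun v : tuple_set m.+1 => tcone (bary v) m.+1 \o
      (idfun \- (tprism m \o @free_d G tuple_set m)) \o mkmalgU v)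
  else \0.

Lemma tsdU n (v : tuple_set n.+1) g : tsd n.+1 (mkmalgU v g) =
  tcone (bary v) n (tsd n (free_d (mkmalgU v g))).
Proof. exact: malg_linU. Qed.

Lemma tprismU n (v : tuple_set n.+1) g : tprism n.+1 (mkmalgU v g) =
  tcone (bary v) n.+1 (mkmalgU v g - tprism n (free_d (mkmalgU v g))).
Proof. exact: malg_linU. Qed.

Lemma free_d_tsd n (c : malg (tuple_set n.+1) G) :
  free_d (tsd n.+1 c) = tsd n (free_d c).
Proof.
elim: n c => [|n IH]; apply: (@malg_ext _ _ _
  (@free_d G tuple_set _ \o tsd _) (tsd _ \o @free_d G tuple_set _)) => v g.
  change (free_d (tsd 1 (mkmalgU v g)) = free_d (mkmalgU v g)).
  rewrite tsdU free_d_tcone0.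
  change (free_d (mkmalgU v g) - mkmalgU [ffun=> bary v] (taug (free_d (mkmalgU v g)))
    = free_d (mkmalgU v g) :> malg (tuple_set 0) G).
  rewrite tuple_aug_d (raddf0 (mkmalgU _)); exact: subr0.
change (free_d (tsd n.+2 (mkmalgU v g)) = tsd n.+1 (free_d (mkmalgU v g))).
by rewrite tsdU free_d_tcone IH free_dd !raddf0 addr0.
Qed.

Lemma free_d_tprism0 (c : malg (tuple_set 0) G) :
  free_d (tprism 0 c) = c - tsd 0 c.
Proof. by rewrite /= raddf0 subrr. Qed.

Lemma free_d_tprism n (c : malg (tuple_set n.+1) G) :
  free_d (tprism n.+1 c) = c - tsd n.+1 c - tprism n (free_d c).
Proof.
elim: n c => [|n IH]; apply: (@malg_ext _ _ _
  (@free_d G tuple_set _ \o tprism _)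
  ((idfun \- tsd _) \- (tprism _ \o @free_d G tuple_set _))) => v g.
  change (free_d (tprism 1 (mkmalgU v g)) =
    mkmalgU v g - tsd 1 (mkmalgU v g) - tprism 0 (free_d (mkmalgU v g))).
  by rewrite tprismU tsdU free_d_tcone /= !subr0.
change (free_d (tprism n.+2 (mkmalgU v g)) =
  mkmalgU v g - tsd n.+2 (mkmalgU v g) - tprism n.+1 (free_d (mkmalgU v g))).
rewrite tprismU tsdU free_d_tcone (raddfB (@free_d G tuple_set n.+1)) /= IH.
by rewrite free_dd !raddf0 addr0 subKr addrAC.
Qed.

End TupleComplex.

Section TupleMap.
Variables (G : zmodType) (Y Z : choiceType) (h : Y -> Z).

Definition tmap_fun n (v : tuple_set Y n) : tuple_set Z n := [ffun i => h (v i)].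

Fact tmap_re m n (f : 'I_m.+1 -> 'I_n.+1) (v : tuple_set Y n) :
  tmap_fun (tuple_re f v) = tuple_re f (tmap_fun v).
Proof. by apply/ffunP => i; rewrite !ffunE. Qed.

Definition tmap_set : symmetric_map (tuple_set Y) (tuple_set Z) :=
  @SymmetricMap (tuple_set Y) (tuple_set Z) tmap_fun tmap_re.

Definition tmap n : {additive malg (tuple_set Y n) G -> malg (tuple_set Z n) G} :=
  malg_map G (@tmap_fun n).

Lemma tmap_d n (c : malg (tuple_set Y n.+1) G) :
  tmap n (free_d c) = free_d (tmap n.+1 c).
Proof. exact: (free_map_subproof tmap_set). Qed.

Lemma tmap_tcone b n (c : malg (tuple_set Y n) G) :
  tmap n.+1 (tcone G b n c) = tcone G (h b) n (tmap n c).
Proof.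
move: c; apply: (@malg_ext _ _ _ (tmap n.+1 \o tcone G b n)
  (tcone G (h b) n \o tmap n)) => v g.
change (tmap n.+1 (tcone G b n (mkmalgU v g)) = tcone G (h b) n (tmap n (mkmalgU v g))).
rewrite !malg_mapU; congr mkmalgU; apply/ffunP => i; rewrite !ffunE.
by case: unliftP => // j _; rewrite ffunE.
Qed.

Variables (by_ : forall n, tuple_set Y n -> Y) (bz : forall n, tuple_set Z n -> Z).
Hypothesis h_bary : forall n (v : tuple_set Y n), h (by_ v) = bz (tmap_fun v).

Lemma tmap_tsd n (c : malg (tuple_set Y n) G) :
  tmap n (tsd G by_ n c) = tsd G bz n (tmap n c).
Proof.
elim: n c => [//|n IH]; apply: (@malg_ext _ _ _ (tmap n.+1 \o tsd G by_ n.+1)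
  (tsd G bz n.+1 \o tmap n.+1)) => v g.
change (tmap n.+1 (tsd G by_ n.+1 (mkmalgU v g)) =
  tsd G bz n.+1 (tmap n.+1 (mkmalgU v g))).
by rewrite [tmap n.+1 (mkmalgU v g)]malg_mapU !tsdU tmap_tcone IH tmap_d
  [tmap _ (mkmalgU v g)]malg_mapU h_bary.
Qed.

Lemma tmap_tprism n (c : malg (tuple_set Y n) G) :
  tmap n.+1 (tprism G by_ n c) = tprism G bz n (tmap n c).
Proof.
elim: n c => [|n IH] c; first by rewrite /= !raddf0.
move: c; apply: (@malg_ext _ _ _ (tmap n.+2 \o tprism G by_ n.+1)
  (tprism G bz n.+1 \o tmap n.+1)) => v g.
change (tmap n.+2 (tprism G by_ n.+1 (mkmalgU v g)) =
  tprism G bz n.+1 (tmap n.+1 (mkmalgU v g))).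
by rewrite [tmap n.+1 (mkmalgU v g)]malg_mapU !tprismU tmap_tcone raddfB IH tmap_d
  [tmap _ (mkmalgU v g)]malg_mapU h_bary.
Qed.

End TupleMap.

(** * Affine simplices and the mesh of their subdivisions *)

Section LinearSimplex.
Variables (R : realType) (N : nat).
Local Notation Delta := (std_simplex R).
Local Notation tuples := (tuple_set (Delta N)).

Definition lin_fun n (w : tuples n) (x : 'rV[R]_n.+1) : 'rV[R]_N.+1 :=
  \sum_i x 0 i *: set_val (w i).

Fact lin_simplex n (w : tuples n) x : Delta n x -> Delta N (lin_fun w x).
Proof.
move=> [x0 x1]; split=> [j|].
  rewrite summxE sumr_ge0 // => i _; rewrite mxE mulr_ge0 //.
  by case: (set_valP (w i)) => + _; apply.
transitivity (\sum_i x 0 i * \sum_j set_val (w i) 0 j).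
  under eq_bigr do rewrite summxE; rewrite exchange_big; apply: eq_bigr => i _.
  by rewrite mulr_sumr; apply: eq_bigr => j _; rewrite mxE.
rewrite -[RHS]x1; apply: eq_bigr => i _.
by case: (set_valP (w i)) => _ ->; rewrite mulr1.
Qed.

Definition lin n (w : tuples n) : Delta n -> Delta N := restrict (@lin_simplex n w).

Lemma linE n (w : tuples n) x :
  set_val (lin w x) = \sum_i set_val x 0 i *: set_val (w i).
Proof. exact: set_val_restrict. Qed.

Lemma lin_continuous n (w : tuples n) : continuous (lin w).
Proof.
apply: restrict_continuous; apply: continuous_mx => i j.
have -> : (fun x => lin_fun w x i j) =
    (fun x : 'rV[R]_n.+1 => \sum_k x 0 k * set_val (w k) i j).
  by apply: funext => x; rewrite summxE; apply: eq_bigr => k _; rewrite mxE.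
apply: continuous_big => [|k _]; first exact: add_continuous.
have ck : continuous (fun x : 'rV[R]_n.+1 => x 0 k) by exact: coord_continuous.
by move=> x; exact: (cvgM (ck x) (cvg_cst _)).
Qed.

Lemma lin_vertex n (w : tuples n) i : lin w (vertex R i) = w i.
Proof.
apply: set_val_inj; rewrite linE set_val_exist (bigD1 i) //= mxE !eqxx scale1r.
rewrite big1 ?addr0 // => j ji; rewrite mxE (negPf ji) andbF scale0r //.
Qed.

Lemma lin_simplex_map m n (w : tuples n) (g : 'I_m.+1 -> 'I_n.+1) x :
  lin w (simplex_map g x) = lin (tuple_re g w) x.
Proof.
apply: set_val_inj; rewrite !linE set_val_restrict.
rewrite [RHS](partition_big g predT) //=; apply: eq_bigr => j _.
rewrite mxE scaler_suml; apply: eq_bigr => i /eqP gij.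
by rewrite ffunE gij.
Qed.

Fact center_subproof n : Delta n (\row__ n.+1%:R^-1).
Proof.
split=> [i|]; first by rewrite mxE invr_ge0.
under eq_bigr do rewrite mxE.
by rewrite sumr_const card_ord -[LHS]mulr_natl mulfV // pnatr_eq0.
Qed.

Definition center n : Delta n := exist _ (\row__ n.+1%:R^-1) (mem_set (center_subproof n)).

Definition bary n (w : tuples n) : Delta N := lin w (center n).

Lemma baryE n (w : tuples n) :
  set_val (bary w) = n.+1%:R^-1 *: \sum_i set_val (w i).
Proof.
rewrite linE scaler_sumr; apply: eq_bigr => i _.
by rewrite set_val_exist mxE.
Qed.

Lemma lin_ball n (w : tuples n) x y (rho : R) :
  (forall j, `|set_val (w j) - x| <= rho) -> `|set_val (lin w y) - x| <= rho.
Proof.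
move=> wx; have [y0 y1] := set_valP y.
have -> : set_val (lin w y) - x = \sum_i set_val y 0 i *: (set_val (w i) - x).
  rewrite linE; under [in RHS]eq_bigr do rewrite scalerBr.
  by rewrite sumrB -scaler_suml y1 scale1r.
apply: le_trans (ler_norm_sum _ _ _) _.
have -> : rho = \sum_i set_val y 0 i * rho by rewrite -mulr_suml y1 mul1r.
by apply: ler_sum => i _; rewrite normrZ ger0_norm // ler_wpM2l.
Qed.

(** The difference of [w i] and the barycenter is the average of [n.+1] differences of vertices, one
    of which is zero; hence the factor n/(n+1). *)
Lemma bary_dist n (w : tuples n) (r : R) i :
  (forall j k, `|set_val (w j) - set_val (w k)| <= r) ->
  `|set_val (w i) - set_val (bary w)| <= n%:R / n.+1%:R * r.
Proof.
move=> wr; have -> : set_val (w i) - set_val (bary w) =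
    n.+1%:R^-1 *: \sum_j (set_val (w i) - set_val (w j)).
  rewrite baryE sumrB scalerBr sumr_const card_ord.
  rewrite -(scaler_nat n.+1 (set_val (w i))) scalerA.
  by rewrite mulVf ?scale1r // pnatr_eq0.
have -> : n%:R / n.+1%:R * r = n.+1%:R^-1 * (n%:R * r) by rewrite mulrAC mulrC.
rewrite normrZ ger0_norm ?invr_ge0 // ler_wpM2l ?invr_ge0 //.
apply: le_trans (ler_norm_sum _ _ _) _; rewrite (bigD1 i) //= subrr normr0 add0r.
have -> : n%:R * r = \sum_(j in predC1 i) r.
  by rewrite sumr_const cardC1 card_ord mulr_natl.
by apply: ler_sum => j _; exact: wr.
Qed.

End LinearSimplex.

Section Mesh.
Variables (R : realType) (G : zmodType) (N : nat).
Local Notation Delta := (std_simplex R).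
Local Notation tuples := (tuple_set (Delta N)).
Local Notation bary := (@bary R N).
Local Notation tsd := (@tsd G (Delta N) bary).

Definition mesh n (w : tuples n) (r : R) : Prop :=
  forall i j, `|set_val (w i) - set_val (w j)| <= r.

(** The first condition stands in for containment in the convex hull. Applied to balls about the
    barycenter, it bounds the new edges in the induction. *)
Definition finer n (w u : tuples n) : Prop :=
  (forall x (rho : R), (forall j, `|set_val (w j) - x| <= rho) ->
     forall i, `|set_val (u i) - x| <= rho) /\
  (forall r, mesh w r -> mesh u (n%:R / n.+1%:R * r)).

Lemma ratio_mono n (r : R) : 0 <= r -> n%:R / n.+1%:R * r <= n.+1%:R / n.+2%:R * r.
Proof.
move=> r0; rewrite ler_wpM2r // ler_pdivrMr ?ltr0n // mulrAC ler_pdivlMr ?ltr0n //.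
by rewrite -!natrM ler_nat; lia.
Qed.

Lemma mesh_ge0 n (w : tuples n) r : mesh w r -> 0 <= r.
Proof. by move=> /(_ ord0 ord0); rewrite subrr normr0. Qed.

(** Edges of a piece within a face are bounded by induction, and the ratio n/(n+1) grows with n;
    edges to the barycenter are bounded by [bary_dist], since balls are convex. *)
Lemma tsd_finer n (w : tuples n) g :
  tsd n (mkmalgU w g) \in supported G (fun u : tuples n => finer w u).
Proof.
elim: n w g => [|n IH] w g.
  apply: supportedU; split=> // r _ i j.
  by rewrite !ord1 subrr normr0 !mul0r.
rewrite tsdU free_dU (raddf_sum (tsd n)) (raddf_sum (tcone G (bary w) n)).
apply: rpred_sum => i _.
rewrite (raddfMz (tsd n)) (raddfMz (tcone G (bary w) n)); apply: rpred_sign.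
have := @malg_map_supported _ _ G (@tcone_tuple _ (bary w) n) _ _
  (IH (tuple_re (lift i) w) g).
apply: supportedS => _ [u [uball umesh] <-]; split=> [x rho wx k|r wr].
  case: (unliftP ord0 k) => [j ->|->]; last first.
    by rewrite tcone_tuple0; exact: lin_ball.
  by rewrite tcone_tupleS; apply: uball => l; rewrite ffunE.
have r0 := mesh_ge0 wr.
have uu j k : `|set_val (u j) - set_val (u k)| <= n.+1%:R / n.+2%:R * r.
  apply: le_trans (ratio_mono n r0); apply: umesh => l m; rewrite !ffunE.
  exact: wr.
have bu j : `|set_val (u j) - set_val (bary w)| <= n.+1%:R / n.+2%:R * r.
  by apply: uball => l; rewrite ffunE; exact: bary_dist.
move=> j k; case: (unliftP ord0 j) => [j' ->|->]; case: (unliftP ord0 k) => [k' ->|->];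
  rewrite ?tcone_tuple0 ?tcone_tupleS //.
- by rewrite distrC.
- by rewrite subrr normr0 mulr_ge0 // divr_ge0.
Qed.

Lemma tsd_mesh n m c (r : R) :
  c \in supported G (fun u : tuples n => mesh u r) ->
  iter m (tsd n) c \in
    supported G (fun u : tuples n => mesh u ((n%:R / n.+1%:R) ^+ m * r)).
Proof.
move=> cr; elim: m => [|m IH]; first by rewrite expr0 mul1r.
rewrite iterS; move: IH; move: (iter m _ c) => {cr}c.
apply: (supported_map (f := tsd n)) => w g wr.
apply: supportedS (tsd_finer w g) => u [_ /(_ _ wr)].
by rewrite exprS mulrA.
Qed.

End Mesh.

(** * Subdivision of singular chains *)

Section Subdivision.
Variables (R : realType) (G : zmodType) (Y : topologicalType).
Local Notation Delta := (std_simplex R).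
Local Notation tuples N := (tuple_set (Delta N)).
Local Notation sing := (sing R Y).
Local Notation sing_d := (schain_d R G Y).

Lemma lin_lin N m n (w : tuples N m) (u : tuples m n) x :
  lin w (lin u x) = lin (tmap_fun (lin w) u) x.
Proof.
apply: set_val_inj; rewrite !linE.
under [RHS]eq_bigr do rewrite ffunE linE scaler_sumr.
rewrite exchange_big; apply: eq_bigr => i _.
by rewrite summxE scaler_suml; apply: eq_bigr => j _; rewrite mxE scalerA.
Qed.

Lemma lin_bary N m n (w : tuples N m) (u : tuples m n) :
  lin w (bary u) = bary (tmap_fun (lin w) u).
Proof. exact: lin_lin. Qed.

Definition vertex_tuple n : tuples n n := [ffun i => vertex R i].

Lemma lin_iota n x : lin (vertex_tuple n) x = x.
Proof.
apply: set_val_inj; rewrite linE; apply/rowP => j; rewrite summxE (bigD1 j) //=.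
rewrite !mxE ffunE set_val_exist mxE !eqxx mulr1 big1 ?addr0 // => i ij.
by rewrite !mxE ffunE set_val_exist mxE eqxx eq_sym (negPf ij) mulr0.
Qed.

Lemma tmap_iota N n (w : tuples N n) : tmap_fun (lin w) (vertex_tuple n) = w.
Proof. by apply/ffunP => i; rewrite !ffunE lin_vertex. Qed.

Fact evt_subproof N (s : sing N) n (w : tuples N n) :
  [set t : Delta n -> Y | continuous t] (set_val s \o lin w).
Proof.
move=> x; apply: continuous_comp; first exact: lin_continuous.
exact: (set_valP s).
Qed.

Definition evt N (s : sing N) n (w : tuples N n) : sing n :=
  exist _ (set_val s \o lin w) (mem_set (@evt_subproof N s n w)).

Lemma evtE N (s : sing N) n (w : tuples N n) x :
  set_val (evt s w) x = set_val s (lin w x).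
Proof. by rewrite set_val_exist. Qed.

Lemma sing_ext n (s s' : sing n) : (forall x, set_val s x = set_val s' x) -> s = s'.
Proof. by move=> ss'; apply: set_val_inj; apply: funext. Qed.

Fact evt_re N (s : sing N) m n (g : 'I_m.+1 -> 'I_n.+1) (w : tuples N n) :
  evt s (tuple_re g w) = singular_re g (evt s w).
Proof.
apply: sing_ext => x; rewrite evtE set_val_restrict /= evtE.
by rewrite lin_simplex_map.
Qed.

Definition evt_set N (s : sing N) : symmetric_map (tuples N) (singular_set R Y) :=
  @SymmetricMap (tuples N) (singular_set R Y) (@evt N s) (@evt_re N s).

Definition ev N (s : sing N) n : {additive malg (tuples N n) G -> malg (sing n) G} :=
  malg_map G (@evt N s n).

Lemma ev_d N (s : sing N) n c :
  ev s n (free_d c) = sing_d n (ev s n.+1 c).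
Proof. exact: (free_map_subproof (evt_set s)). Qed.

Lemma ev_iota N (s : sing N) g : ev s N (mkmalgU (vertex_tuple N) g) = mkmalgU s g.
Proof.
rewrite [LHS]malg_mapU; congr mkmalgU.
by apply: sing_ext => x; rewrite evtE lin_iota.
Qed.

Lemma ev_evt N m (s : sing N) (w : tuples N m) n c :
  ev (evt s w) n c = ev s n (tmap G (lin w) n c).
Proof.
apply: malg_map_comp => u; apply: sing_ext => x.
by rewrite !evtE lin_lin.
Qed.

Notation tsd N n := (tsd G (@bary R N) n).
Notation tprism N n := (tprism G (@bary R N) n).

Definition sd n : {additive malg (sing n) G -> malg (sing n) G} :=
  malg_lin (fun s => ev s n \o tsd n n \o mkmalgU (vertex_tuple n)).

Definition prism n : {additive malg (sing n) G -> malg (sing n.+1) G} :=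
  malg_lin (fun s => ev s n.+1 \o tprism n n \o mkmalgU (vertex_tuple n)).

Lemma sdU n s g : sd n (mkmalgU s g) = ev s n (tsd n n (mkmalgU (vertex_tuple n) g)).
Proof. exact: malg_linU. Qed.

Lemma prismU n s g :
  prism n (mkmalgU s g) = ev s n.+1 (tprism n n (mkmalgU (vertex_tuple n) g)).
Proof. exact: malg_linU. Qed.

(** Affine maps preserve barycenters, so subdividing an affine piece of [s] is subdividing inside
    the simplex and then applying [s]. With [ev_iota] this reduces the identities for [sd] to those
    for tuples. *)
Lemma sd_ev N (s : sing N) n c : sd n (ev s n c) = ev s n (tsd N n c).
Proof.
move: c; apply: (@malg_ext _ _ _ (sd n \o ev s n) (ev s n \o tsd N n)) => w g.
change (sd n (ev s n (mkmalgU w g)) = ev s n (tsd N n (mkmalgU w g))).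
rewrite [ev s n (mkmalgU w g)]malg_mapU sdU ev_evt.
rewrite (tmap_tsd (bz := @bary R N)); last by move=> k v; exact: (lin_bary w v).
by rewrite [tmap _ _ _ _]malg_mapU tmap_iota.
Qed.

Lemma prism_ev N (s : sing N) n c : prism n (ev s n c) = ev s n.+1 (tprism N n c).
Proof.
move: c; apply: (@malg_ext _ _ _ (prism n \o ev s n) (ev s n.+1 \o tprism N n)) => w g.
change (prism n (ev s n (mkmalgU w g)) = ev s n.+1 (tprism N n (mkmalgU w g))).
rewrite [ev s n (mkmalgU w g)]malg_mapU prismU ev_evt.
rewrite (tmap_tprism (bz := @bary R N)); last by move=> k v; exact: (lin_bary w v).
by rewrite [tmap _ _ _ _]malg_mapU tmap_iota.
Qed.


Lemma sd_d n (c : malg (sing n.+1) G) : sing_d n (sd n.+1 c) = sd n (sing_d n c).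
Proof.
move: c; apply: (@malg_ext _ _ _ (sing_d n \o sd n.+1) (sd n \o sing_d n)) => s g.
change (sing_d n (sd n.+1 (mkmalgU s g)) = sd n (sing_d n (mkmalgU s g))).
by rewrite -[mkmalgU s g]ev_iota -ev_d !sd_ev -ev_d free_d_tsd.
Qed.

Lemma prism_d n (c : malg (sing n.+1) G) :
  sing_d n.+1 (prism n.+1 c) = c - sd n.+1 c - prism n (sing_d n c).
Proof.
move: c; apply: (@malg_ext _ _ _ (sing_d n.+1 \o prism n.+1)
  ((idfun \- sd n.+1) \- (prism n \o sing_d n))) => s g.
change (sing_d n.+1 (prism n.+1 (mkmalgU s g)) =
  mkmalgU s g - sd n.+1 (mkmalgU s g) - prism n (sing_d n (mkmalgU s g))).
rewrite -[mkmalgU s g]ev_iota -ev_d !prism_ev !sd_ev -ev_d free_d_tprism.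
by rewrite !(raddfB (ev s n.+1)).
Qed.

Lemma prism_d0 (c : malg (sing 0) G) : sing_d 0 (prism 0 c) = c - sd 0 c.
Proof.
move: c; apply: (@malg_ext _ _ _ (sing_d 0 \o prism 0) (idfun \- sd 0)) => s g.
change (sing_d 0 (prism 0 (mkmalgU s g)) = mkmalgU s g - sd 0 (mkmalgU s g)).
rewrite -[mkmalgU s g]ev_iota prism_ev sd_ev -ev_d free_d_tprism0.
by rewrite (raddfB (ev s 0)).
Qed.

Variable alpha : cover Y.
Let small n : zmodClosed (malg (sing n) G) :=
  supported G (fun s : sing n =>
    exists2 U, cover_sets alpha U & range (set_val s) `<=` U).

Lemma ev_small N (s : sing N) n c U : cover_sets alpha U ->
  range (set_val s) `<=` U -> ev s n c \in small n.
Proof.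
move=> aU sU; have : c \in supported G (fun=> True) by apply/asboolP.
move: c; apply: (@supported_map _ _ _ _ (ev s n)) => w g _.
rewrite [ev s n _]malg_mapU; apply: supportedU; exists U => // _ [x _ <-].
by rewrite evtE; apply: sU; exists (lin w x).
Qed.

Lemma sd_small n c : c \in small n -> sd n c \in small n.
Proof.
move: c; apply: (@supported_map _ _ _ _ (sd n)) => s g [U aU sU].
by rewrite sdU; exact: ev_small sU.
Qed.

Lemma prism_small n c : c \in small n -> prism n c \in small n.+1.
Proof.
move: c; apply: (@supported_map _ _ _ _ (prism n)) => s g [U aU sU].
by rewrite prismU; exact: ev_small sU.
Qed.

Lemma iter_sd_small n m c : c \in small n -> iter m (sd n) c \in small n.
Proof. by move=> cs; elim: m => // m IH; rewrite iterS; exact: sd_small. Qed.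

Lemma iter_sd_ev N (s : sing N) n m c :
  iter m (sd n) (ev s n c) = ev s n (iter m (tsd N n) c).
Proof. by elim: m => // m IH; rewrite !iterS IH sd_ev. Qed.

Lemma iter_sdB n m c c' : iter m (sd n) (c - c') = iter m (sd n) c - iter m (sd n) c'.
Proof. by elim: m => // m IH; rewrite !iterS IH (raddfB (sd n)). Qed.

Lemma iter_sd_d n m c :
  sing_d n (iter m (sd n.+1) c) = iter m (sd n) (sing_d n c).
Proof. by elim: m => // m IH; rewrite !iterS sd_d IH. Qed.

(** The prisms on the successive iterates telescope. That the homotopy preserves smallness is used
    for the injectivity of [small_incl]. *)
Lemma iter_sd_homotopy n m c :
  boundary_out (free_complex G (singular_set R Y)) n c = 0 ->
  exists2 b, sing_d n b = c - iter m (sd n) c & c \in small n -> b \in small n.+1.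
Proof.
move=> c0; elim: m => [|m [b bE bs]].
  by exists 0; rewrite ?raddf0 ?subrr ?rpred0.
exists (b + prism n (iter m (sd n) c)); last first.
  by move=> cs; rewrite rpredD ?bs // prism_small // iter_sd_small.
rewrite (raddfD (sing_d n)) bE iterS.
have -> : sing_d n (prism n (iter m (sd n) c)) =
    iter m (sd n) c - sd n (iter m (sd n) c).
  case: n c c0 {b bE bs} => [|n] c c0; first by rewrite prism_d0.
  rewrite prism_d iter_sd_d; have -> : sing_d n c = 0 by exact: c0.
  have -> : iter m (sd n) 0 = 0 by elim: m => // m IH; rewrite iterS IH raddf0.
  by rewrite (raddf0 (prism n)) subr0.
by rewrite addrA subrK.
Qed.

End Subdivision.

Lemma std_simplex_compact (R : realType) n : compact (std_simplex R n).
Proof.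
apply: bounded_closed_compact.
  (* Points are convex combinations of the vertices, so any ball about 0 containing the vertices
     contains the simplex. *)
  exists (\sum_j `|set_val (vertex_tuple R n j)|); split; first exact: num_real.
  move=> r /ltW rn x xn; pose x' : std_simplex R n := exist _ x (mem_set xn).
  have -> : x = set_val (lin (vertex_tuple R n) x') - 0.
    by rewrite lin_iota subr0 set_val_exist.
  apply: le_trans rn; apply: lin_ball => j; rewrite subr0.
  by rewrite (bigD1 j) //= lerDl sumr_ge0.
have cc i : continuous (fun x : 'rV[R]_n.+1 => x 0 i) by exact: coord_continuous.
have -> : std_simplex R n = (\bigcap_(i in [set: 'I_n.+1]) [set x | 0 <= x 0 i]) `&`
    [set x | \sum_i x 0 i = 1].
  by rewrite eqEsubset; split=> x [x0 x1]; split=> // i; [move=> _|]; exact: x0.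
apply: closedI.
  apply: closed_bigI => i _.
  exact: (proj1 (continuous_closedP _) (cc i) _ (@closed_ge _ (0 : R))).
have sc : continuous (fun x : 'rV[R]_n.+1 => \sum_i x 0 i).
  by apply: continuous_big => [|i _]; [exact: add_continuous|exact: cc].
exact: (proj1 (continuous_closedP _) sc _ (@closed_eq _ (1 : R))).
Qed.

(** * Small chains compute singular homology *)

Section SmallSimplices.
Variables (R : realType) (G : zmodType) (Y : topologicalType) (alpha : cover Y).
Local Notation Delta := (std_simplex R).
Local Notation sing := (sing R Y).
Local Notation is_small := (fun s : sing _ =>
  exists2 U, cover_sets alpha U & range (set_val s) `<=` U).

(** If the ball of radius [d] about [x] maps into a member, then every [e < d / 2] works for all
    centers in the ball of radius [d / 2]; compactness makes [e] uniform. *)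
Lemma lebesgue_number n (s : sing n) : exists2 e : R, 0 < e &
  forall x : Delta n, exists2 U, cover_sets alpha U &
    forall y : Delta n, `|set_val y - set_val x| < e -> U (set_val s y).
Proof.
pose P (e : R) (x : 'rV[R]_n.+1) := exists2 U, cover_sets alpha U &
  forall y : Delta n, `|set_val y - x| < e -> U (set_val s y).
have loc x : Delta n x -> \forall x' \near x & e \near (0 : R)^'+, P e x'.
  move=> xD; pose x' : Delta n := exist _ x (mem_set xD).
  have [U aU Ux] : (\bigcup_(U in cover_sets alpha) U) (set_val s x').
    by rewrite cover_full.
  have oU : open (set_val s @^-1` U).
    by apply: open_comp (cover_open aU) => y _; exact: (set_valP s).
  have [V oV VU] := oU.
  have Vx : V x by have : (set_val s @^-1` U) x' by []; rewrite -VU /= set_val_exist.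
  have /nbhs_ballP[d /= d0 dV] := open_nbhs_nbhs (conj oV Vx).
  have d20 : 0 < d / 2 by rewrite divr_gt0.
  exists (ball x (d / 2), [set e | e < d / 2]).
    by split; [exact: nbhsx_ballx|exact: nbhs_right_lt].
  move=> [x1 e] /= [xx1 ed]; exists U => // y yx1.
  suff : (set_val s @^-1` U) y by [].
  rewrite -VU; apply: dV; rewrite [d]splitr; apply: ball_triangle xx1 _.
  by rewrite -ball_normE /= distrC; exact: lt_trans ed.
have /compact_near_coveringP/(_ R (0 : R)^'+ P _ loc) H := @std_simplex_compact R n.
have [e [e0 He]] := filter_ex (filterI (nbhs_right_gt (0 : R)) H).
by exists e => // x; apply: He; exact: set_valP.
Qed.

(** The pieces of the subdivided standard simplex shrink geometrically below the Lebesgue number of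
    [s]. The claim is for all large [m], so that several generators admit a common [m]. *)
Lemma iter_sd_generator n (s : sing n) (g : G) : exists m0, forall m, (m0 <= m)%N ->
  iter m (sd R G Y n) (mkmalgU s g) \in supported G is_small.
Proof.
have [e e0 eP] := lebesgue_number s.
pose r := \sum_i \sum_j `|set_val (vertex_tuple R n i) - set_val (vertex_tuple R n j)|.
have iotar : mesh (vertex_tuple R n) r.
  move=> i j; rewrite /r (bigD1 i) //= (bigD1 j) //= -addrA lerDl.
  by rewrite addr_ge0 // sumr_ge0 // => k _; rewrite sumr_ge0.
pose q : R := n%:R / n.+1%:R.
have q1 : `|q| < 1.
  rewrite ger0_norm ?divr_ge0 // ltr_pdivrMr ?ltr0n // mul1r ltr_nat //.
have /cvgrPdist_lt/(_ e e0)[m0 _ m0P] := cvg_geometric r q1.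
exists m0 => m m0m; rewrite -(ev_iota s g) iter_sd_ev.
have i0 : mkmalgU (vertex_tuple R n) g \in
  supported G (fun w : tuple_set (Delta n) n => mesh w r) by exact: supportedU.
have := tsd_mesh m i0.
apply: (@supported_map _ _ _ _ (ev G s n)) => w g' wm.
rewrite [ev G s n _]malg_mapU; apply: supportedU.
have [U aU sU] := eP (w ord0); exists U => // _ [x _ <-].
rewrite evtE; apply: sU; apply: le_lt_trans (lin_ball _ (fun j => wm j ord0)) _.
have := m0P m m0m; rewrite /= sub0r normrN /geometric /= mulrC => /(le_lt_trans _); apply.
exact: ler_norm.
Qed.

Lemma iter_sd_eventually_small n (c : malg (sing n) G) : exists m,
  iter m (sd R G Y n) c \in supported G is_small.
Proof.
suff [m mP] : exists m0, forall m, (m0 <= m)%N ->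
    iter m (sd R G Y n) c \in supported G is_small by exists m; exact: mP.
have : c \in supported G (fun=> True) by apply/asboolP.
move: c; apply: supported_ind => [|c c' [m mP] [m' mP']|s g _].
- by exists 0 => m _; rewrite -(subrr 0) iter_sdB subrr rpred0.
- exists (maxn m m') => k; rewrite geq_max => /andP[mk m'k].
  by rewrite iter_sdB rpredB ?mP ?mP'.
- exact: iter_sd_generator.
Qed.

Local Notation incl n := (small_incl_set R alpha n).

Lemma small_lift n (c : malg (sing n) G) : c \in supported G is_small ->
  exists c', malg_map G (incl n) c' = c.
Proof.
move=> cs; have [|c' _ <-] := @malg_map_lift _ _ G (incl n) (fun=> True) c.
  apply: supportedS cs => s sU.
  pose u : small_simplex R alpha n := exist _ s (mem_set sU).
  have uE : set_val u = s by exact: set_val_exist.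
  by exists u => //; exact: uE.
by exists c'.
Qed.

Lemma incl_small n (c : malg (small_simplex R alpha n) G) :
  malg_map G (incl n) c \in supported G is_small.
Proof.
have /malg_map_supported : c \in supported G (fun=> True) by apply/asboolP.
move=> /(_ _ (incl n)); apply: supportedS => _ [s _ <-].
exact: (set_valP s).
Qed.

Lemma incl_inj n : injective (malg_map G (incl n)).
Proof. exact/malg_map_inj/set_val_inj. Qed.

Lemma small_incl_surj n (x : singular_homology R G Y n) :
  exists y, @small_incl R G Y n alpha y = x.
Proof.
have [c <-] := homology_classP x.
have c0 := cycle_boundary_out c.
have [m ms] := iter_sd_eventually_small (sg_val c).
have [b bE _] := iter_sd_homotopy alpha m c0.
have [c' c'E] := small_lift ms.
have c'0 : boundary_out (free_complex G (small_set R alpha)) n c' = 0.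
  apply: (@boundary_out_inj _ _ (free_map G (small_incl_set R alpha))).
    exact: incl_inj.
  change (boundary_out (free_complex G (singular_set R Y)) n (malg_map G (incl n) c') = 0).
  rewrite c'E; have -> : iter m (sd R G Y n) (sg_val c) = sg_val c - schain_d R G Y n b.
    by rewrite bE subKr.
  rewrite (raddfB (boundary_out _ n)) c0 sub0r; apply/eqP; rewrite oppr_eq0; apply/eqP.
  by case: n b {x c c0 m ms bE c' c'E} => [|n] b //=; exact: schain_dd.
exists (homology_class (Subgroup (cycleP c'0))); rewrite [LHS]homology_mapE.
apply/eqP; rewrite -subr_eq0 -(raddfB (@homology_class _ _)).
apply/eqP/homology_class_eq0.
exists (- b); rewrite raddfN.
change (- schain_d R G Y n b = malg_map G (incl n) c' - sg_val c).
by rewrite bE c'E opprB.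
Qed.

(** If [e] bounds the small cycle [C], a small iterated subdivision of [e] bounds the corresponding
    subdivision of [C]; the small chain [b] leads from there back to [C]. *)
Lemma small_incl_inj n : injective (@small_incl R G Y n alpha).
Proof.
apply: raddf_inj => x; have [c <-] := homology_classP x; rewrite [X in X = _ -> _]homology_mapE.
move=> /homology_class_eq0[e eE]; apply/homology_class_eq0.
pose C := malg_map G (incl n) (sg_val c).
have C0 : boundary_out (free_complex G (singular_set R Y)) n C = 0.
  by rewrite -(boundary_out_map (free_map G (small_incl_set R alpha)))
    cycle_boundary_out raddf0.
have {}eE : schain_d R G Y n e = C by exact: eE.
have [m ms] := iter_sd_eventually_small e.
have [b bE bs] := iter_sd_homotopy alpha m C0.
have [e' e'E] : exists e', malg_map G (incl n.+1) e' = iter m (sd R G Y n.+1) e + b.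
  by apply: small_lift; rewrite rpredD // bs // incl_small.
exists e'; apply: incl_inj; transitivity (schain_d R G Y n (malg_map G (incl n.+1) e')).
  exact: (free_map_subproof (small_incl_set R alpha)).
rewrite e'E (raddfD (schain_d R G Y n)) bE iter_sd_d eE.
by rewrite addrC subrK.
Qed.

End SmallSimplices.

(** * The natural map *)

Section SmallMap.
Variables (R : realType) (G : zmodType) (A Y : topologicalType) (h : A -> Y).
Hypothesis hc : continuous h.
Variables (alpha : cover A) (beta : cover Y).
Hypothesis hab : refines_along h alpha beta.

Fact small_map_subproof n (s : singular_simplex R A n) :
  (exists2 U, cover_sets alpha U & range (set_val s) `<=` U) ->
  exists2 V, cover_sets beta V &
    range (set_val (singular_map_set R hc n s)) `<=` V.
Proof.
move=> [U /hab[V bV UV] sU]; exists V => // _ [y _ <-].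
by rewrite set_val_restrict; apply: UV; exists (set_val s y) => //; apply: sU; exists y.
Qed.

Definition small_map_fun n : small_simplex R alpha n -> small_simplex R beta n :=
  restrict (@small_map_subproof n).

Fact small_map_re m n (g : 'I_m.+1 -> 'I_n.+1) (s : small_simplex R alpha n) :
  small_map_fun (small_re g s) = small_re g (small_map_fun s).
Proof.
apply: set_val_inj; rewrite !set_val_restrict.
exact: (sm_re (singular_map_set R hc)).
Qed.

Definition small_map_set : symmetric_map (small_set R alpha) (small_set R beta) :=
  @SymmetricMap (small_set R alpha) (small_set R beta) small_map_fun small_map_re.

Definition small_map n :
    {additive homology (free_complex G (small_set R alpha)) n ->
              homology (free_complex G (small_set R beta)) n} :=
  homology_map (free_map G small_map_set) n.

Lemma small_incl_map n y :
  @small_incl R G Y n beta (small_map n y) =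
  singular_map R G hc n (@small_incl R G A n alpha y).
Proof.
pose p : symmetric_map (small_set R alpha) (singular_set R Y) :=
  @SymmetricMap (small_set R alpha) (singular_set R Y)
    (fun n s => set_val (small_map_fun s))
    (fun m n g s => etrans (congr1 set_val (small_map_re g s))
      (set_val_restrict _ (small_map_fun s))).
transitivity (homology_map (free_map G p) n y).
  by apply/esym/homology_map_comp => m c; exact: malg_map_comp.
apply: homology_map_comp => m c; apply: malg_map_comp => s.
exact: set_val_restrict.
Qed.

Lemma mu_small_map n y :
  homology_map (mu R G beta) n (small_map n y) =
  homology_map (vietoris_map G hab) n (homology_map (mu R G alpha) n y).
Proof.
have [z <-] := homology_classP y; rewrite [small_map n _]homology_mapE !homology_mapE.
congr homology_class; apply: val_inj => /=; case: z => z /= _.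
rewrite [RHS]oriented_mapE; apply: (congr1 (orient G beta n)).
rewrite -(@malg_map_comp _ _ _ G (@small_map_fun n)
  (@vertices R Y beta n) (fun s => vtuple_map hab (vertices s))).
  exact: malg_map_comp.
move=> s; apply: set_val_inj; rewrite set_val_restrict.
apply/ffunP => i; rewrite [RHS]verticesE [LHS]ffunE verticesE.
by rewrite !set_val_restrict.
Qed.

End SmallMap.
Arguments small_map {R} G {A Y h} hc {alpha beta} hab n.

Section NaturalMap.
Variables (R : realType) (G : zmodType).

Lemma small_incl_refine (Y : topologicalType) n (alpha beta : cover Y)
    (ab : refines alpha beta) y :
  @small_incl R G Y n beta (homology_map (free_map G (small_refine_set R ab)) n y) =
  @small_incl R G Y n alpha y.
Proof.
apply/esym/homology_map_comp => m c; apply: malg_map_comp => s.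
exact/esym/set_val_restrict.
Qed.

(** Preimages chosen cover by cover are compatible because [small_incl] is injective, so
    [small_family] is not the default value. By injectivity again, any preimage [y] computes the
    component at [alpha]. *)
Lemma natural_mapE (Y : topologicalType) n (alpha : cover Y) x y :
  @small_incl R G Y n alpha y = x ->
  lim_proj (natural_map R G Y n x) alpha = homology_map (mu R G alpha) n y.
Proof.
move=> yx; pose z0 : dep_prod (@is_obj (small_system R G Y n)) :=
  fun alpha => projT1 (cid (small_incl_surj alpha x)).
have z0E beta : @small_incl R G Y n beta (z0 beta) = x.
  by rewrite /z0; case: cid.
have z0C : z0 \in compatible (small_system R G Y n).
  apply/asboolP => beta gamma bg; apply: small_incl_inj.
  by rewrite z0E -(z0E beta); exact: small_incl_refine.
have : [set z : inv_lim (small_system R G Y n) | forall alpha,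
    @small_incl R G Y n alpha (@lim_proj (small_system R G Y n) z alpha) = x]
    (small_family x).
  by apply: (@xgetPex _ 0); exists (Subgroup z0C) => beta; exact: z0E.
move=> /(_ alpha); rewrite -yx => /small_incl_inj.
exact: (congr1 (homology_map (mu R G alpha) n)).
Qed.

Fact natural_map_additive (Y : topologicalType) n :
  zmod_morphism (natural_map R G Y n).
Proof.
move=> x x'; apply: lim_ext => alpha.
have [y yx] := small_incl_surj alpha x.
have [y' yx'] := small_incl_surj alpha x'.
rewrite (@natural_mapE _ _ alpha (x - x') (y - y')); last by rewrite raddfB yx yx'.
by rewrite raddfB -(natural_mapE yx) -(natural_mapE yx').
Qed.

HB.instance Definition _ (Y : topologicalType) n :=
  GRing.isZmodMorphism.Build _ _ (natural_map R G Y n) (@natural_map_additive Y n).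

Lemma natural_map_nat (A Y : topologicalType) (h : A -> Y) (hc : continuous h) n x :
  natural_map R G Y n (singular_map R G hc n x) =
  cech_map G hc n (natural_map R G A n x).
Proof.
apply: lim_ext => alpha.
have [y yx] := small_incl_surj (pull_cover hc alpha) x.
rewrite (@natural_mapE _ _ alpha _ (small_map G hc (pull_cover_refines hc alpha) n y));
  last first.
  by rewrite small_incl_map yx.
by rewrite mu_small_map -(natural_mapE yx).
Qed.

End NaturalMap.

(** * Kernel and cokernel of the natural map *)

Section WeakIsomorphism.
Variables (R : realType) (G : zmodType) (X : topologicalType) (f : X -> R).
Hypothesis f_paracompact : forall t : R, paracompact (sublevel f t).
Hypothesis f_hausdorff : forall t : R, hausdorff_space (sublevel f t).
Hypothesis f_HLC : HLC f (reduced_functor R G).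
Variable n : nat.
Local Notation incl st := (@set_incl_continuous X _ _ (@sublevel_mono R X f _ _ st)).

Definition natural_additive (t : R) :
    {additive persistent f (singular_functor R G) n t -> persistent f (cech_functor G) n t} :=
  natural_map R G (sublevel f t) n.

Fact natural_additive_nat s t (st : s <= t) x :
  natural_additive t (pm_map (persistent f (singular_functor R G) n) st x) =
  pm_map (persistent f (cech_functor G) n) st (natural_additive s x).
Proof. exact: natural_map_nat. Qed.

Definition natural_pmorphism := PMorphism natural_additive_nat.

Lemma natural_ker_zero s t (st : s < t) (le_st : s <= t) x :
  natural_map R G (sublevel f s) n x = 0 -> singular_map R G (incl le_st) n x = 0.
Proof.
move=> x0; have [beta betaP] :=
  mu_injective_shift f_paracompact f_hausdorff f_HLC st n (@sublevel_mono R X f _ _ le_st).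
have [y yx] := small_incl_surj beta x.
by rewrite -yx; apply: betaP; rewrite -(natural_mapE yx) x0.
Qed.

(** At the midpoint [r] every component of [c] lifts, though not coherently. With [beta] chosen for
    the injectivity from [r] to [t], the lift [y0] at [beta] is pushed to [t]; the components of its
    image are then checked one cover at a time. *)
Lemma natural_coker_zero s t (st : s < t) (le_st : s <= t) c :
  exists x, natural_map R G (sublevel f t) n x = cech_map G (incl le_st) n c.
Proof.
have [sr rt] : s < (s + t) / 2 /\ (s + t) / 2 < t by split; lra.
move: sr rt; set r := (s + t) / 2 => sr rt.
pose e := cech_map G (incl (ltW sr)) n c.
have lift (alpha : cover (sublevel f r)) : exists y,
    homology_map (mu R G alpha) n y = lim_proj e alpha.
  have [beta [ba [bp /(_ (lim_proj c beta))[y yE]]]] := mu_surjective_shift f_paracompact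
    f_hausdorff f_HLC sr n (@sublevel_mono R X f _ _ (ltW sr)) alpha.
  exists y; rewrite yE /e; transitivity (homology_map (vietoris_map G
    (pull_cover_refines (incl (ltW sr)) alpha)) n
    (homology_map (vietoris_map G bp) n (lim_proj c beta))).
    by apply: homology_map_comp; exact: vietoris_map_comp.
  by congr (homology_map _ n _); exact: (@lim_projP (cech_system G _ n) c beta _ bp).
have [beta betaP] :=
  mu_injective_shift f_paracompact f_hausdorff f_HLC rt n (@sublevel_mono R X f _ _ (ltW rt)).
have [y0 y0E] := lift beta.
exists (singular_map R G (incl (ltW rt)) n (@small_incl R G _ n beta y0)).
transitivity (cech_map G (incl (ltW rt)) n e); last first.
  by apply/esym/cech_map_comp => y; apply: set_val_inj; rewrite !set_val_restrict.
apply: lim_ext => gamma.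
(* A lift over a common refinement of [beta] and the restriction of [gamma] can be compared with
   [y0] over [beta] and evaluated at [gamma]. *)
pose pg := pull_cover (incl (ltW rt)) gamma; pose alpha := meet_cover beta pg.
have ab : refines alpha beta by exact: meet_cover_l.
have ap : refines alpha pg by exact: meet_cover_r.
have ag : refines_along (set_incl (@sublevel_mono R X f _ _ (ltW rt))) alpha gamma.
  by move=> _ [V [_ [_ [W gW <-] ->]]]; exists W => // _ [y [_ yW] <-].
have [y yE] := lift alpha.
pose y' := homology_map (free_map G (small_refine_set R ab)) n y.
(* Both classes have the same image under [mu] at [beta], so their difference dies at level [t]. *)
have y'0 : singular_map R G (incl (ltW rt)) n (@small_incl R G _ n beta (y' - y0)) = 0.
  apply: betaP; rewrite raddfB y0E mu_refine yE.
  by rewrite (@lim_projP (cech_system G _ n) e alpha beta ab) subrr.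
have -> : singular_map R G (incl (ltW rt)) n (@small_incl R G _ n beta y0) =
    @small_incl R G _ n gamma (small_map G (incl (ltW rt)) ag n y).
  rewrite small_incl_map -(small_incl_refine ab); apply/esym/eqP.
  by rewrite -subr_eq0 -!raddfB y'0.
rewrite (natural_mapE erefl) mu_small_map yE.
transitivity (homology_map (vietoris_map G (pull_cover_refines (incl (ltW rt)) gamma)) n
  (homology_map (vietoris_map G ap) n (lim_proj e alpha))).
  by apply: homology_map_comp; exact: vietoris_map_comp.
by congr (homology_map _ n _); exact: (@lim_projP (cech_system G _ n) e alpha _ ap).
Qed.

Lemma natural_weak_isomorphism : weak_isomorphism natural_pmorphism.
Proof.
split=> s t st lt_st x.
  apply: val_inj; case: x => x x0; apply: (natural_ker_zero lt_st st).
  exact/eqP.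
rewrite -[x]reprK [LHS]quotient_mapE; set c := repr x.
rewrite -[RHS](raddf0 (\pi_({ideal_quot (im (natural_pmorphism t))})%qT)).
apply/eqP; rewrite -Quotient.idealrBE subr0; apply/asboolP.
have [y yE] := natural_coker_zero lt_st st c; exists y; exact: yE.
Qed.

End WeakIsomorphism.

Theorem theorem1p2 (R : realType) (G : zmodType) (X : topologicalType)
    (f : X -> R)
    (f_paracompact : forall t : R, paracompact (sublevel f t))
    (f_hausdorff : forall t : R, hausdorff_space (sublevel f t))
    (f_HLC : HLC f (reduced_functor R G))
    (n : nat) :
  exists phi : pmorphism (persistent f (singular_functor R G) n)
                         (persistent f (cech_functor G) n),
    (forall (t : R) (x : singular_homology R G (sublevel f t) n),
       phi t x = natural_map R G (sublevel f t) n x) /\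
    weak_isomorphism phi.
Proof.
by exists (natural_pmorphism G f n); split=> //; exact: natural_weak_isomorphism.
Qed.
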